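(* Let $S_{16,92}$ and $B_{15,66}$ be the simplicial complexes defined in the context. Then $B_{15,66}$ is a $15$-vertex triangulation of the $3$-ball that contains a double trefoil knotted spanning edge, and $B_{15,66}$ is not collapsible. Coning off the boundary of $B_{15,66}$ with a new vertex one obtains the knotted $3$-sphere $S_{16,92}$, which is locally constructible. Removing the tetrahedron $1\,9\,14\,15$ from $S_{16,92}$ one obtains a knotted $3$-ball that is collapsible and locally constructible.
   Context: Simplicial complexes are finite; a simplicial (triangulated) $3$-ball or $3$-sphere is a simplicial complex whose geometric realization is homeomorphic to the $3$-ball or $3$-sphere. Coning off the boundary of a $3$-ball $B$ means forming $\partial(v*B)=B\cup(v*\partial B)$ with $v$ a new vertex. Removing a tetrahedron means removing only that facet and keeping its proper faces. A double trefoil is a connected sum of two trefoil knots (granny knot or square knot). A spanning edge of a $3$-ball $B$ is an interior edge with both endpoints on $\partial B$. It is $\mathfrak L$-knotted if some simple path on $\partial B$ between its endpoints completes the edge to a knot of type $\mathfrak L$ (the knot type does not depend on the path); a double trefoil knotted spanning edge is one for which $\mathfrak L$ is a double trefoil. The sphere $S_{16,92}$ and the ball obtained by removing $1\,9\,14\,15$ from it are called knotted in the sense that they contain a double trefoil knot as a $3$-edge subcomplex of their $1$-skeleton. Elementary collapse: simultaneous removal of a pair of faces $(\sigma,\Sigma)$ such that $\Sigma$ is the only face properly containing $\sigma$. $C$ collapses onto $D$ if it can be reduced to $D$ by finitely many elementary collapses; $C$ is collapsible if it collapses onto a single vertex. A simplicial $3$-ball is locally constructible (LC) if it collapses onto its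 boundary minus a triangle. A simplicial $3$-sphere is locally constructible (LC) if the removal of some tetrahedron makes it collapsible onto one of its vertices. $S_{16,92}$ is the simplicial complex on $\{1,\dots,16\}$ with the following $92$ facets: $1\,2\,5\,6$, $1\,2\,5\,12$, $1\,2\,6\,12$, $1\,3\,7\,8$, $1\,3\,7\,11$, $1\,3\,8\,11$, $1\,4\,5\,6$, $1\,4\,5\,16$, $1\,4\,6\,12$, $1\,4\,10\,13$, $1\,4\,10\,16$, $1\,4\,12\,13$, $1\,5\,12\,13$, $1\,5\,13\,16$, $1\,7\,8\,9$, $1\,7\,9\,11$, $1\,8\,9\,14$, $1\,8\,10\,14$, $1\,8\,10\,15$, $1\,8\,11\,15$, $1\,9\,11\,15$, $1\,9\,14\,15$, $1\,10\,13\,14$, $1\,10\,15\,16$, $1\,13\,14\,16$, $1\,14\,15\,16$, $2\,3\,4\,13$, $2\,3\,4\,15$, $2\,3\,13\,15$, $2\,4\,7\,8$, $2\,4\,7\,15$, $2\,4\,8\,16$, $2\,4\,10\,13$, $2\,4\,10\,16$, $2\,5\,6\,14$, $2\,5\,12\,14$, $2\,6\,8\,12$, $2\,6\,8\,16$, $2\,6\,9\,14$, $2\,6\,9\,16$, $2\,7\,8\,9$, $2\,7\,9\,10$, $2\,7\,10\,13$, $2\,7\,13\,15$, $2\,8\,9\,14$, $2\,8\,12\,14$, $2\,9\,10\,16$, $3\,4\,12\,13$, $3\,4\,12\,15$, $3\,5\,6\,7$, $3\,5\,6\,14$, $3\,5\,7\,8$, $3\,5\,8\,11$, $3\,5\,11\,14$,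 $3\,6\,7\,16$, $3\,6\,9\,14$, $3\,6\,9\,16$, $3\,7\,11\,14$, $3\,7\,14\,16$, $3\,9\,12\,13$, $3\,9\,12\,16$, $3\,9\,13\,15$, $3\,9\,14\,15$, $3\,12\,15\,16$, $3\,14\,15\,16$, $4\,5\,6\,7$, $4\,5\,7\,8$, $4\,5\,8\,16$, $4\,6\,7\,15$, $4\,6\,12\,15$, $5\,8\,11\,13$, $5\,8\,13\,16$, $5\,11\,12\,13$, $5\,11\,12\,14$, $6\,7\,13\,15$, $6\,7\,13\,16$, $6\,8\,12\,15$, $6\,8\,13\,15$, $6\,8\,13\,16$, $7\,9\,10\,12$, $7\,9\,11\,12$, $7\,10\,12\,14$, $7\,10\,13\,14$, $7\,11\,12\,14$, $7\,13\,14\,16$, $8\,10\,12\,14$, $8\,10\,12\,15$, $8\,11\,13\,15$, $9\,10\,12\,16$, $9\,11\,12\,13$, $9\,11\,13\,15$, $10\,12\,15\,16$. $B_{15,66}$ is obtained from $S_{16,92}$ by removing the star of the vertex $1$: its facets are the $66$ tetrahedra in the list that do not contain the vertex $1$. *)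

(* Defs.v *)
From HB Require Import structures.
From mathcomp Require Import all_boot all_order all_algebra.

Set Implicit Arguments.
Unset Strict Implicit.
Unset Printing Implicit Defensive.

Section Complexes.
Local Open Scope nat_scope.
Local Open Scope set_scope.
Variable V : finType.
Implicit Types (K F : {set {set V}}) (s t e : {set V}).

(* Faces are nonempty: the empty set is never a face. *)
Definition simplicial_complex K : bool :=
  (set0 \notin K) &&
  [forall s in K, forall t : {set V}, (t != set0) && (t \subset s) ==> (t \in K)].

Definition generated F : {set {set V}} :=
  [set t : {set V} | (t != set0) && [exists s in F, t \subset s]].

Definition vertices K : {set V} := [set v | [set v] \in K].

Definition faces K (k : nat) : {set {set V}} := [set s in K | #|s| == k.+1].

(* For a triangulated 3-ball: the triangles in the topological boundary are
   those that lie in exactly one tetrahedron. *)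
Definition boundary3 K : {set {set V}} :=
  generated [set t in faces K 2 | #|[set s in faces K 3 | t \subset s]| == 1].

Definition cone (v : V) K : {set {set V}} :=
  [set v] |: (K :|: [set v |: s | s in K]).

Definition cone_off (v : V) K : {set {set V}} := K :|: cone v (boundary3 K).

Definition free_pair K s t : bool :=
  [&& s \in K, t \in K, s \proper t &
      [forall u in K, (s \proper u) ==> (u == t)]].

Definition elementary_collapse : rel {set {set V}} := fun K L =>
  [exists s : {set V}, exists t : {set V},
     free_pair K s t && (L == K :\: [set s; t])].

Definition collapses : rel {set {set V}} := connect elementary_collapse.

Definition collapsible K : bool := [exists v, collapses K [set [set v]]].

(* To be used for K a 3-ball, respectively a 3-sphere. *)
Definition LC_ball K : bool :=
  [exists t in faces (boundary3 K) 2, collapses K (boundary3 K :\ t)].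

Definition LC_sphere K : bool :=
  [exists t in faces K 3, collapsible (K :\ t)].

Definition joined_by_edge K : rel V := fun u v => [set u; v] \in faces K 1.

Definition spanning_edge K e : bool :=
  [&& e \in faces K 1, e \notin boundary3 K & e \subset vertices (boundary3 K)].

Definition path_edges (u : V) (p : seq V) : {set {set V}} :=
  [set:: [seq [set x.1; x.2] | x <- zip (u :: p) p]].

End Complexes.

(* Vertex labels 1, ..., 16 are the elements of 'I_17 with that value; the
   element 0 is not a vertex. *)
Definition label (i : nat) : 'I_17 := inord i.

Definition simplex (s : seq nat) : {set 'I_17} := [set:: map label s].

Definition facets16_92 : seq (seq nat) := ([::
   [:: 1; 2; 5; 6]; [:: 1; 2; 5; 12]; [:: 1; 2; 6; 12]; [:: 1; 3; 7; 8];
   [:: 1; 3; 7; 11]; [:: 1; 3; 8; 11]; [:: 1; 4; 5; 6]; [:: 1; 4; 5; 16];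
   [:: 1; 4; 6; 12]; [:: 1; 4; 10; 13]; [:: 1; 4; 10; 16]; [:: 1; 4; 12; 13];
   [:: 1; 5; 12; 13]; [:: 1; 5; 13; 16]; [:: 1; 7; 8; 9]; [:: 1; 7; 9; 11];
   [:: 1; 8; 9; 14]; [:: 1; 8; 10; 14]; [:: 1; 8; 10; 15]; [:: 1; 8; 11; 15];
   [:: 1; 9; 11; 15]; [:: 1; 9; 14; 15]; [:: 1; 10; 13; 14]; [:: 1; 10; 15; 16];
   [:: 1; 13; 14; 16]; [:: 1; 14; 15; 16]; [:: 2; 3; 4; 13]; [:: 2; 3; 4; 15];
   [:: 2; 3; 13; 15]; [:: 2; 4; 7; 8]; [:: 2; 4; 7; 15]; [:: 2; 4; 8; 16];
   [:: 2; 4; 10; 13]; [:: 2; 4; 10; 16]; [:: 2; 5; 6; 14]; [:: 2; 5; 12; 14];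
   [:: 2; 6; 8; 12]; [:: 2; 6; 8; 16]; [:: 2; 6; 9; 14]; [:: 2; 6; 9; 16];
   [:: 2; 7; 8; 9]; [:: 2; 7; 9; 10]; [:: 2; 7; 10; 13]; [:: 2; 7; 13; 15];
   [:: 2; 8; 9; 14]; [:: 2; 8; 12; 14]; [:: 2; 9; 10; 16]; [:: 3; 4; 12; 13];
   [:: 3; 4; 12; 15]; [:: 3; 5; 6; 7]; [:: 3; 5; 6; 14]; [:: 3; 5; 7; 8];
   [:: 3; 5; 8; 11]; [:: 3; 5; 11; 14]; [:: 3; 6; 7; 16]; [:: 3; 6; 9; 14];
   [:: 3; 6; 9; 16]; [:: 3; 7; 11; 14]; [:: 3; 7; 14; 16]; [:: 3; 9; 12; 13];
   [:: 3; 9; 12; 16]; [:: 3; 9; 13; 15]; [:: 3; 9; 14; 15]; [:: 3; 12; 15; 16];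
   [:: 3; 14; 15; 16]; [:: 4; 5; 6; 7]; [:: 4; 5; 7; 8]; [:: 4; 5; 8; 16];
   [:: 4; 6; 7; 15]; [:: 4; 6; 12; 15]; [:: 5; 8; 11; 13]; [:: 5; 8; 13; 16];
   [:: 5; 11; 12; 13]; [:: 5; 11; 12; 14]; [:: 6; 7; 13; 15]; [:: 6; 7; 13; 16];
   [:: 6; 8; 12; 15]; [:: 6; 8; 13; 15]; [:: 6; 8; 13; 16]; [:: 7; 9; 10; 12];
   [:: 7; 9; 11; 12]; [:: 7; 10; 12; 14]; [:: 7; 10; 13; 14]; [:: 7; 11; 12; 14];
   [:: 7; 13; 14; 16]; [:: 8; 10; 12; 14]; [:: 8; 10; 12; 15]; [:: 8; 11; 13; 15];
   [:: 9; 10; 12; 16]; [:: 9; 11; 12; 13]; [:: 9; 11; 13; 15]; [:: 10; 12; 15; 16]])%N.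

Definition S16_92 : {set {set 'I_17}} :=
  generated [set:: [seq simplex s | s <- facets16_92]].

Definition B15_66 : {set {set 'I_17}} :=
  generated [set:: [seq simplex s | s <- facets16_92 & 1%N \notin s]].

(* S16_92 with the facet removed, but not its proper faces. *)
Definition S16_92_minus : {set {set 'I_17}} :=
  S16_92 :\ simplex [:: 1; 9; 14; 15]%N.

(* Imported only here: the library of classical sets shadows set0, subset, and
   other names of finset. *)
From mathcomp Require Import all_classical all_reals all_analysis.

Import Order.TTheory GRing.Theory Num.Theory.
Import numFieldNormedType.Exports.

Local Open Scope classical_set_scope.
Local Open Scope ring_scope.

Section Topology.
Variable R : realType.

Definition homeomorphism (T U : topologicalType) (A : set T) (B : set U)
    (f : T -> U) : Prop :=
  exists g : U -> T,
    [/\ {within A, continuous f}, {within B, continuous g},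
        (forall x, A x -> B (f x)) /\ (forall y, B y -> A (g y)),
        (forall x, A x -> g (f x) = x) & (forall y, B y -> f (g y) = y)].

Definition sqnorm d (x : 'rV[R]_d) : R := \sum_i x ord0 i ^+ 2.

Definition unit_ball d : set 'rV[R]_d := [set x : 'rV[R]_d | sqnorm x <= 1].

Definition unit_sphere d : set 'rV[R]_d.+1 :=
  [set x : 'rV[R]_d.+1 | sqnorm x = 1].

(* Barycentric coordinates, with the vertices at the standard basis. *)
Definition realization n (K : {set {set 'I_n}}) : set 'rV[R]_n :=
  [set x : 'rV[R]_n |
    [/\ forall i, 0 <= x ord0 i, \sum_i x ord0 i = 1
      & [set i | x ord0 i != 0]%SET \in K]].

Definition is_ball3 n (K : {set {set 'I_n}}) : Prop :=
  simplicial_complex K /\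
  exists h, homeomorphism (realization K) (@unit_ball 3) h.

Definition is_sphere3 n (K : {set {set 'I_n}}) : Prop :=
  simplicial_complex K /\
  exists h, homeomorphism (realization K) (@unit_sphere 3) h.

Definition knot (K : set 'rV[R]_3) : Prop :=
  exists h, homeomorphism (@unit_sphere 1) K h.

Definition ambient_isotopic (K L : set 'rV[R]_3) : Prop :=
  exists H : R -> 'rV[R]_3 -> 'rV[R]_3,
    [/\ {within `[0, 1] `*` [set: 'rV[R]_3],
          continuous (fun p : R * 'rV[R]_3 => H p.1 p.2)},
        forall t, 0 <= t <= 1 ->
          homeomorphism [set: 'rV[R]_3] [set: 'rV[R]_3] (H t),
        forall x, H 0 x = x
      & H 1 @` K = L].

Definition segment (p q : 'rV[R]_3) : set 'rV[R]_3 :=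
  [set (1 - t) *: p + t *: q | t in `[0, 1]].

Definition polygonal (K : set 'rV[R]_3) : Prop :=
  exists s : seq ('rV[R]_3 * 'rV[R]_3),
    K = \bigcup_(pq in [set` s]) segment pq.1 pq.2.

(* Up to isotopy, K is a polygonal knot that crosses the plane x_0 = 0 in just
   two points p and q, and the part of it on either side, closed up by the
   segment [p, q], is of the type of K1, respectively of K2.  Polygonality
   excludes wild behaviour at p and q.  Orientations of the summands are not
   recorded; this is harmless for trefoils, which are invertible. *)
Definition connected_sum (K1 K2 K : set 'rV[R]_3) : Prop :=
  exists (K' : set 'rV[R]_3) (p q : 'rV[R]_3),
    [/\ ambient_isotopic K K',
        knot K' /\ polygonal K',
        p <> q /\ K' `&` [set x : 'rV[R]_3 | x ord0 ord0 = 0] = [set p; q],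
        ambient_isotopic K1
          ((K' `&` [set x : 'rV[R]_3 | x ord0 ord0 <= 0]) `|` segment p q)
      & ambient_isotopic K2
          ((K' `&` [set x : 'rV[R]_3 | 0 <= x ord0 ord0]) `|` segment p q)].

Definition point3 (x y z : R) : 'rV[R]_3 := \row_i nth 0 [:: x; y; z] i.

Definition closed_polygon (s : seq 'rV[R]_3) : set 'rV[R]_3 :=
  \bigcup_(pq in [set` zip s (rot 1 s)]) segment pq.1 pq.2.

(* The projection along the last axis is the standard alternating diagram with
   three crossings c1, c2, c3, which are traversed in the order
   c1 c2 c3 c1 c2 c3.  It is invariant under the order 3 linear map
   (x, y, z) |-> (- y, x - y, z). *)
Definition standard_trefoil : set 'rV[R]_3 :=
  closed_polygon
    [:: point3 2 0 0;       point3 (-2) (-1) 1;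
        point3 0 2 0;       point3 1 (-1) 1;
        point3 (-2) (-2) 0; point3 1 2 1].

Definition mirror (x : 'rV[R]_3) : 'rV[R]_3 :=
  point3 (x ord0 (inord 0)) (x ord0 (inord 1)) (- x ord0 (inord 2)).

(* Both chiralities are trefoil knots. *)
Definition trefoil (K : set 'rV[R]_3) : Prop :=
  ambient_isotopic K standard_trefoil \/
  ambient_isotopic K (mirror @` standard_trefoil).

(* The three types: the two (mirror) granny knots and the square knot. *)
Definition double_trefoil (K : set 'rV[R]_3) : Prop :=
  exists K1 K2, [/\ trefoil K1, trefoil K2 & connected_sum K1 K2 K].

(* Projection from the point (0, 0, 0, 1). *)
Definition stereographic (x : 'rV[R]_4) : 'rV[R]_3 :=
  \row_i (x ord0 (widen_ord (leqnSn 3) i) / (1 - x ord0 ord_max)).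

(* The subcomplex C of the 3-ball K realizes a knot of type L.  Any two choices
   of h differ by a self-homeomorphism of the unit ball, which extends radially
   to R^3, so the choice matters only up to mirror image. *)
Definition knot_in_ball (L : set (set 'rV[R]_3)) n
    (K C : {set {set 'I_n}}) : Prop :=
  exists2 h, homeomorphism (realization K) (@unit_ball 3) h
           & L (h @` realization C).

(* Likewise in a 3-sphere, viewed as R^3 with a point at infinity that is not
   on the knot. *)
Definition knot_in_sphere (L : set (set 'rV[R]_3)) n
    (K C : {set {set 'I_n}}) : Prop :=
  exists h, [/\ homeomorphism (realization K) (@unit_sphere 3) h,
                forall x, realization C x -> h x ord0 ord_max <> 1
              & L (stereographic @` (h @` realization C))].

Definition knotted_spanning_edge (L : set (set 'rV[R]_3)) n
    (K : {set {set 'I_n}}) (e : {set 'I_n}) : Prop :=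
  spanning_edge K e /\
  exists (u v : 'I_n) (p : seq 'I_n),
    [/\ e = [set u; v]%SET,
        path (joined_by_edge (boundary3 K)) u p, last u p = v, uniq (u :: p)
      & knot_in_ball L K (generated (e |: path_edges u p))].

Definition three_edge_subcomplex n (K C : {set {set 'I_n}}) : Prop :=
  [/\ simplicial_complex C, C \subset K,
      forall s, s \in C -> (#|s| <= 2)%N & #|faces C 1| = 3%N].

Definition knotted_ball n (K : {set {set 'I_n}}) : Prop :=
  exists C, three_edge_subcomplex K C /\ knot_in_ball double_trefoil K C.

Definition knotted_sphere n (K : {set {set 'I_n}}) : Prop :=
  exists C, three_edge_subcomplex K C /\ knot_in_sphere double_trefoil K C.

End Topology.

Arguments is_ball3 R {n} K.
Arguments is_sphere3 R {n} K.
Arguments knotted_ball R {n} K.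
Arguments knotted_sphere R {n} K.
Arguments knotted_spanning_edge {R} L {n} K e.
Arguments double_trefoil {R} K.

(* Main.v *)
From Stdlib Require Import BinInt.
Require Import Defs.
From mathcomp Require Import all_boot all_order all_algebra.
From mathcomp Require Import ring lra zify ssrZ.

(** All the complexes are given by lists of facets, so that their combinatorics (boundaries,
    cones, collapses of the sphere minus a tetrahedron) is decided by computation; what needs
    an idea is that the ball is not collapsible, that the complexes are balls and a sphere,
    and that the knots are double trefoils.

    The ball is not collapsible. Attach to each edge of B15_66 a vector over the field with
    three elements so that in every triangle each of the three vectors is spanned by the other
    two. An elementary collapse that removes an edge and a triangle does not change the span
    of the vectors of the edges, and one that removes a vertex and an edge lowers its
    dimension by at most one. Hence the span has dimension less than the number of vertices if
    the complex is collapsible (collapsible_edge_span), but a table gives vectors that span a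
    space of dimension 15, the number of vertices (edge_span_full). The coordinates of the
    vectors are twisted cocycles that come from the Fox 3-colourings of the double trefoil: a
    collapse would present its knot group with too few generators.

    The homeomorphisms. A stellar exchange replaces the star of a face s, which is s joined
    with the boundary of t and a link, by t joined with the boundary of s and the same link.
    It is realized by the piecewise linear map psi, which moves the minimum of the coordinates
    on s to t, and its inverse is of the same form (exchangesP). One list of 117 exchanges
    turns S16_92 into the boundary of a 4-simplex, S16_92 minus the tetrahedron into that
    boundary minus a facet, and B15_66 into a single tetrahedron. These three have explicit
    homeomorphisms to the round sphere and ball (sphere_model, starred_ball, simplex_ball), in
    which a tetrahedron in space becomes round by a radial map. The radial map is isotopic to
    the identity (radial_isotopic), so it does not matter for the knot type.

    The knots. Subdivided where psi fails to be affine, a closed path of edges is tracked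
    through the exchanges as a list of points with integral homogeneous coordinates
    (track_knotP), and ends as a polygon with more than 80 vertices in space. Moving a vertex
    is an ambient isotopy if a certificate of affine forms shows that the triangles swept out
    do not meet the rest of the polygon (vertex_move). Scripts of such moves, checked by
    computation, lead to a polygon with 11 vertices which the plane x_0 = 0 cuts into two
    arcs; one, closed up, goes by further moves to the standard trefoil and the other to its
    mirror image (double_trefoil_knot_polygon). So the knot is the square knot. That the
    polygon is homeomorphic to the circle needs no geometry: it is the image of a cycle of
    three edges under homeomorphisms. *)

Set Implicit Arguments.
Unset Strict Implicit.
Unset Printing Implicit Defensive.

(** * Simplicial complexes given by lists of faces *)

(** A simplex is the list of its labels, up to order, which makes all the checks on complexes
    computable. *)
Definition sub (s t : seq nat) : bool := all (fun x => x \in t) s.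

Definition labels (s : seq nat) : bool := all (fun x => x < 17) s.

Definition code (t : {set 'I_17}) : seq nat := [seq val i | i <- enum t].

Definition cplx (F : seq (seq nat)) : {set {set 'I_17}} :=
  generated [set:: map simplex F].

Lemma val_label i : i < 17 -> val (label i) = i.
Proof. by move=> lti; rewrite /label /= inordK. Qed.

Lemma label_val (i : 'I_17) : label (val i) = i.
Proof. exact: inord_val. Qed.

Lemma in_simplex (s : seq nat) (i : 'I_17) :
  labels s -> (i \in simplex s) = (val i \in s).
Proof.
move=> /allP ls; rewrite inE; apply/mapP/idP => [[x xs ->]|is_].
  by rewrite val_label // ls.
by exists (val i); rewrite ?label_val.
Qed.

Lemma simplex_sub s t : labels s -> labels t ->
  (simplex s \subset simplex t) = sub s t.
Proof.
move=> ls lt; apply/subsetP/allP => [st x xs|st i].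
  have xl: x < 17 := allP ls _ xs.
  have := st (label x); rewrite !in_simplex // val_label //; exact.
by rewrite !in_simplex //; exact: st.
Qed.

Lemma simplex_eq0 s : (simplex s == set0) = nilp s.
Proof.
case: s => [|x s] /=; first by apply/eqP/setP => i; rewrite !inE.
by apply/negbTE/set0Pn; exists (label x); rewrite !inE eqxx.
Qed.

Lemma card_simplex s : labels s -> uniq s -> #|simplex s| = size s.
Proof.
move=> ls us; rewrite cardsE; have /card_uniqP -> : uniq (map label s).
  rewrite map_inj_in_uniq // => x y /(allP ls) xl /(allP ls) yl e.
  by rewrite -(val_label xl) -(val_label yl) e.
by rewrite size_map.
Qed.

Lemma in_cplx F t :
  (t \in cplx F) = (t != set0) && has (fun s => t \subset simplex s) F.
Proof.
rewrite inE; congr (_ && _); apply/existsP/hasP => [[s]|[s sF ts]].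
  by rewrite inE => /andP[/mapP[u uF ->] ts]; exists u.
by exists (simplex s); rewrite inE map_f.
Qed.

Lemma in_cplx_simplex F s : all labels F -> labels s ->
  (simplex s \in cplx F) = ~~ nilp s && has (sub s) F.
Proof.
move=> lF ls; rewrite in_cplx simplex_eq0; congr (_ && _).
by apply: eq_in_has => u uF; rewrite simplex_sub // (allP lF).
Qed.

Lemma cplx_complex F : simplicial_complex (cplx F).
Proof.
apply/andP; split; first by rewrite in_cplx eqxx.
apply/forall_inP => s; rewrite in_cplx => /andP[_ /hasP[u uF su]].
apply/forallP => t; apply/implyP => /andP[t0 ts].
by rewrite in_cplx t0; apply/hasP; exists u => //; exact: subset_trans su.
Qed.

Definition refines (F G : seq (seq nat)) : bool :=
  all (fun s => has (sub s) G) F.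

Lemma cplx_sub F G : all labels F -> all labels G -> refines F G ->
  cplx F \subset cplx G.
Proof.
move=> lF lG FG; apply/subsetP => t; rewrite !in_cplx => /andP[-> /hasP[s sF ts]].
have /hasP[u uG su] := allP FG _ sF.
apply/hasP; exists u => //; apply: subset_trans ts _.
by rewrite simplex_sub ?(allP lF _ sF) ?(allP lG _ uG).
Qed.

Lemma cplx_eq F G : all labels F -> all labels G -> refines F G -> refines G F ->
  cplx F = cplx G.
Proof. by move=> lF lG FG GF; apply/eqP; rewrite eqEsubset !cplx_sub. Qed.

Fixpoint subseqs (s : seq nat) : seq (seq nat) :=
  if s is x :: s' then
    let r := subseqs s' in [seq x :: t | t <- r] ++ r
  else [:: [::]].

Lemma filter_subseqs p s : filter p s \in subseqs s.
Proof.
by elim: s => //= x s IH; case: ifP => _; rewrite mem_cat ?map_f ?IH ?orbT.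
Qed.

Lemma subseqs_sub s t : t \in subseqs s -> subseq t s.
Proof.
elim: s t => [|x s IH] t /=; first by rewrite inE => /eqP ->.
rewrite mem_cat => /orP[/mapP[u /IH us ->]|/IH ts]; first by rewrite /= eqxx.
exact: subseq_trans ts (subseq_cons s x).
Qed.

Lemma sub_filter s (t : {set 'I_17}) : labels s -> t \subset simplex s ->
  simplex [seq x <- s | label x \in t] = t.
Proof.
move=> ls ts; apply/setP => i.
have lt : labels [seq x <- s | label x \in t].
  by apply/allP => x; rewrite mem_filter => /andP[_]; exact: (allP ls).
rewrite in_simplex // mem_filter label_val andb_idr // => it.
by rewrite -in_simplex //; exact: (subsetP ts).
Qed.

Definition face_list (F : seq (seq nat)) : seq (seq nat) :=
  [seq t <- undup (flatten (map subseqs F)) | ~~ nilp t].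

Lemma labels_subseq s t : subseq t s -> labels s -> labels t.
Proof. by move=> ts /allP ls; apply/allP => x /(mem_subseq ts) /ls. Qed.

Lemma face_listP F t :
  reflect (exists2 s, s \in F & subseq t s /\ ~~ nilp t /\ t \in subseqs s)
          (t \in face_list F).
Proof.
rewrite mem_filter mem_undup; apply: (iffP andP) => [[t0 /flatten_mapP[s sF ts]]|].
  by exists s => //; split; [exact: subseqs_sub | split].
by case=> s sF [_ [t0 ts]]; split=> //; apply/flatten_mapP; exists s.
Qed.

Lemma cplx_faces F : all labels F ->
  cplx F = [set:: map simplex (face_list F)].
Proof.
move=> lF; apply/setP => t; rewrite in_cplx inE; apply/andP/mapP.
  move=> [t0 /hasP[s sF ts]].
  have ls := allP lF _ sF.
  exists [seq x <- s | label x \in t]; last by rewrite sub_filter.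
  apply/face_listP; exists s => //; split; first exact: filter_subseq.
  by rewrite filter_subseqs -simplex_eq0 sub_filter.
move=> [u /face_listP[s sF [us [u0 _]]] ->]; rewrite simplex_eq0; split=> //.
apply/hasP; exists s => //; have ls := allP lF _ sF.
rewrite simplex_sub ?(labels_subseq us) //; apply/allP => x.
exact: mem_subseq.
Qed.

Lemma all_labels_face_list F : all labels F -> all labels (face_list F).
Proof.
move=> lF; apply/allP => t /face_listP[s sF [ts _]].
exact: labels_subseq ts (allP lF _ sF).
Qed.

(** * Collapses *)

(** A move names the free face and the label that extends it to the unique larger face. Exactly
    two faces of the list contain a free face: itself and the larger one. *)
Definition collapse_step (L : seq (seq nat)) (m : seq nat * nat) :=
  let: (s, x) := m in let t := x :: s in
  if [seq u <- L | sub s u] is [:: u; v]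
  then if (x \notin s) && ((sub u s && sub t v && sub v t)
                         || (sub v s && sub t u && sub u t))
       then Some [seq u <- L | ~~ sub s u] else None
  else None.

Fixpoint collapse_run L ms :=
  if ms is m :: ms' then obind (fun L' => collapse_run L' ms') (collapse_step L m)
  else Some L.

Lemma collapse_stepP L m L' : all labels L -> labels (m.2 :: m.1) ->
  collapse_step L m = Some L' ->
  elementary_collapse [set:: map simplex L] [set:: map simplex L'].
Proof.
case: m => s x /= lL /andP[xl ls].
case E: [seq u <- L | sub s u] => [|u [|v [|]]] //.
case: ifP => // /andP[xs H] [<-].
set t := x :: s.
have lt : labels t by rewrite /t /= xl.
have mE w : w \in L -> sub s w -> w = u \/ w = v.
  move=> wL sw; have : w \in [seq u <- L | sub s u] by rewrite mem_filter sw.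
  by rewrite E !inE => /orP[] /eqP; [left|right].
have [uL su] : u \in L /\ sub s u.
  by apply/andP; rewrite andbC -mem_filter E !inE eqxx.
have [vL sv] : v \in L /\ sub s v.
  by apply/andP; rewrite andbC -mem_filter E !inE eqxx orbT.
have st : simplex s \proper simplex t.
  rewrite properE !simplex_sub //; apply/andP; split.
    by apply/allP => y ys; rewrite inE ys orbT.
  by rewrite /= negb_and xs.
have eqs w w' : w \in L -> labels w' -> sub w w' -> sub w' w -> simplex w = simplex w'.
  move=> wL lw' h1 h2; apply/eqP; rewrite eqEsubset.
  by rewrite !simplex_sub ?(allP lL _ wL) // h1 h2.
have [a [b [aL bL as_ bt ab]]] : exists a b, [/\ a \in L, b \in L,
    simplex a = simplex s, simplex b = simplex t &
    forall w, w \in L -> sub s w -> w = a \/ w = b].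
  case/orP: H => /andP[/andP[h1 h2] h3].
    by exists u, v; split=> //; apply: eqs.
  exists v, u; split=> //; try by apply: eqs.
  by move=> w wL /(mE _ wL) []; [right|left].
have key w : w \in L -> simplex s \subset simplex w ->
    simplex w = simplex s \/ simplex w = simplex t.
  move=> wL; rewrite simplex_sub ?(allP lL _ wL) // => /(ab _ wL) [] ->.
    by left.
  by right.
apply/existsP; exists (simplex s); apply/existsP; exists (simplex t).
apply/andP; split.
  apply/and4P; split=> //.
  - by rewrite inE -as_ map_f.
  - by rewrite inE -bt map_f.
  - apply/forall_inP => w; rewrite inE => /mapP[w' w'L ->]; apply/implyP => /[dup] sw.
    move=> /proper_sub /(key _ w'L) [] e; last by rewrite e.
    by move: sw; rewrite e properxx.
apply/eqP/setP => w; rewrite !inE; apply/mapP/andP.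
  move=> [w']; rewrite mem_filter => /andP[nsw w'L ->]; split; last exact: map_f.
  rewrite -simplex_sub ?(allP lL _ w'L) // in nsw.
  by apply/norP; split; apply: contra nsw => /eqP ->; rewrite ?subxx ?(proper_sub st).
move=> [/norP[ws wt] /mapP[w' w'L e]]; exists w' => //.
rewrite mem_filter w'L andbT -simplex_sub ?(allP lL _ w'L) //.
apply/negP => /(key _ w'L) [] e'; first by rewrite e e' eqxx in ws.
by rewrite e e' eqxx in wt.
Qed.

Lemma collapse_step_labels L m L' : all labels L ->
  collapse_step L m = Some L' -> all labels L'.
Proof.
case: m => s x lL /=; case: [seq u <- L | sub s u] => [|u [|v [|]]] //.
case: ifP => // _ [<-]; apply/allP => w; rewrite mem_filter => /andP[_].
exact: (allP lL).
Qed.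

Lemma collapse_runP L ms L' : all labels L ->
  all (fun m => labels (m.2 :: m.1)) ms -> collapse_run L ms = Some L' ->
  collapses [set:: map simplex L] [set:: map simplex L'].
Proof.
rewrite /collapses; elim: ms L => [|m ms IH] L lL /=.
  by move=> _ [->]; exact: connect0.
move=> /andP[lm lms]; case E: (collapse_step L m) => [L1|] //= R.
apply: connect_trans (connect1 (collapse_stepP lL lm E)) _.
exact: IH (collapse_step_labels lL E) lms R.
Qed.

(** * Boundaries and cones *)

Definition triangles (F : seq (seq nat)) : seq (seq nat) :=
  undup (flatten [seq [seq t <- subseqs s | size t == 3] | s <- F]).

Definition boundary_list (F : seq (seq nat)) : seq (seq nat) :=
  [seq t <- triangles F | count (sub t) F == 1].

Definition tetrahedra (F : seq (seq nat)) : bool :=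
  all (fun s => [&& labels s, uniq s & size s == 4]) F && pairwise (fun s t => ~~ sub s t) F.

Lemma tetrahedra_labels F : tetrahedra F -> all labels F.
Proof. by case/andP => + _; apply: sub_all => s /and3P[]. Qed.

Lemma in_triangles F t : t \in triangles F ->
  exists2 s, s \in F & subseq t s /\ size t = 3.
Proof.
rewrite mem_undup => /flatten_mapP[s sF]; rewrite mem_filter => /andP[/eqP ts].
by move=> /subseqs_sub; exists s.
Qed.

Lemma simplex_inj_tetrahedra F : tetrahedra F -> {in F &, injective simplex}.
Proof.
move=> tF; have lF := tetrahedra_labels tF; case/andP: tF => tF pF s t sF tF' e.
apply/eqP; apply: contraT => st.
have sub_st : sub s t && sub t s.
  by rewrite -!simplex_sub ?(allP lF _ sF) ?(allP lF _ tF') // e subxx.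
case/andP: sub_st => h1 h2.
have F0 : forall r : seq (seq nat), pairwise (fun s t => ~~ sub s t) r ->
    s \in r -> t \in r -> False.
  elim=> //= a r IH /andP[ar /IH {}IH]; rewrite !inE => /orP[/eqP sa|sr] /orP[/eqP ta|tr].
  - by rewrite sa ta eqxx in st.
  - by have := allP ar _ tr; rewrite -sa h1.
  - by have := allP ar _ sr; rewrite -ta h2.
  - exact: IH.
by case: (F0 F pF sF tF').
Qed.

Lemma card_le_facet F t : tetrahedra F -> t \in cplx F ->
  exists2 s, s \in F & t \subset simplex s /\ #|simplex s| = 4.
Proof.
move=> /andP[/allP tF _]; rewrite in_cplx => /andP[_ /hasP[s sF ts]].
exists s => //; split=> //; have /and3P[ls us /eqP ss] := tF s sF.
by rewrite card_simplex.
Qed.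

Lemma faces3_cplx F : tetrahedra F -> faces (cplx F) 3 = [set:: map simplex F].
Proof.
move=> tF; apply/setP => t; rewrite inE [RHS]inE; apply/andP/mapP.
  move=> [/(card_le_facet tF)[s sF [ts s4]] /eqP t4]; exists s => //.
  by apply/eqP; rewrite eqEcard ts s4 t4.
move=> [s sF ->]; rewrite in_cplx.
case/andP: tF => /allP /(_ s sF) /and3P[ls us /eqP ss] _.
rewrite card_simplex // ss; split=> //; apply/andP; split.
  by rewrite simplex_eq0 /nilp ss.
by apply/hasP; exists s.
Qed.

Lemma card_star F t : tetrahedra F -> labels t ->
  #|[set s in faces (cplx F) 3 | simplex t \subset s]| = count (sub t) F.
Proof.
move=> tF lt; rewrite faces3_cplx // -size_filter.
have lF := tetrahedra_labels tF.
set G := filter _ F.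
have GF : {subset G <= F} by move=> s; rewrite mem_filter => /andP[].
have uF : uniq F.
  case/andP: tF => _; elim: F {lF G GF} => //= a r IH /andP[ar /IH ->].
  rewrite andbT; apply/negP => /(allP ar) /negP; apply.
  by apply/allP.
have uG : uniq (map simplex G).
  rewrite map_inj_in_uniq ?filter_uniq // => s u /GF sF /GF uF'.
  exact: (simplex_inj_tetrahedra tF sF uF').
rewrite -(size_map simplex G) -(card_uniqP uG); apply: eq_card => s.
rewrite inE [s \in [set:: _]]inE; apply/andP/mapP.
  move=> [/mapP[u uF' ->]]; rewrite simplex_sub ?(allP lF _ uF') // => tu.
  by exists u => //; rewrite mem_filter tu.
move=> [u]; rewrite mem_filter => /andP[tu uF'] ->; split; first exact: map_f.
by rewrite simplex_sub ?(allP lF _ uF').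
Qed.

Lemma boundary3_cplx F : tetrahedra F ->
  boundary3 (cplx F) = cplx (boundary_list F).
Proof.
move=> tF; have lF := tetrahedra_labels tF.
rewrite /boundary3 /cplx; congr generated; apply/setP => t; rewrite inE [RHS]inE.
apply/andP/mapP.
  move=> [tK t1]; move: tK; rewrite inE => /andP[tK /eqP t3].
  have [s sF [ts _]] := card_le_facet tF tK.
  have ls := allP lF _ sF.
  have us : uniq s by case/andP: tF => /allP /(_ s sF) /and3P[].
  have et := sub_filter ls ts.
  set u := [seq x <- s | label x \in t] in et.
  have lu : labels u by apply: labels_subseq ls; exact: filter_subseq.
  exists u => //; rewrite mem_filter -card_star // et t1 mem_undup.
  apply/flatten_mapP; exists s => //; rewrite mem_filter filter_subseqs andbT.
  by rewrite -card_simplex ?et ?t3 // filter_uniq.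
move=> [u]; rewrite mem_filter => /andP[cu /in_triangles[s sF [us s3]] ->].
have ls := allP lF _ sF.
have lu := labels_subseq us ls.
have uu : uniq u by apply: subseq_uniq us _; case/andP: tF => /allP /(_ s sF) /and3P[].
rewrite card_star //; split=> //; rewrite inE card_simplex // s3 eqxx andbT.
rewrite in_cplx_simplex // /nilp s3; apply/hasP; exists s => //.
by apply/allP => x; exact: mem_subseq.
Qed.

Lemma cone_cplx v F : v < 17 -> all labels F -> ~~ nilp F -> all (fun s => ~~ nilp s) F ->
  cone (label v) (cplx F) = cplx [seq v :: s | s <- F].
Proof.
move=> lv lF F0 nF; apply/setP => t; rewrite in_cplx !inE.
have sv s : simplex (v :: s) = label v |: simplex s.
  by apply/setP => i; rewrite !inE.
apply/orP/andP.
  case=> [/eqP ->|].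
    split; first by apply/set0Pn; exists (label v); rewrite inE.
    case: F F0 {lF nF} => //= s F _; by rewrite sv sub1set !inE eqxx.
  case/orP => [/andP[t0 /existsP[s]]|/imsetP[s sK ->]].
    rewrite inE => /andP[/mapP[u uF ->] ts]; split=> //; apply/hasP.
    exists (v :: u); first by rewrite map_f.
    by rewrite sv subsetU // ts orbT.
  split; first by apply/set0Pn; exists (label v); rewrite !inE eqxx.
  move: sK; rewrite in_cplx => /andP[_ /hasP[u uF su]]; apply/hasP.
  by exists (v :: u); [rewrite map_f | rewrite sv setUS].
move=> [t0 /hasP[u /mapP[s sF ->]]]; rewrite sv => ts.
case: (boolP (label v \in t)) => vt.
  have [e|n0] := eqVneq (t :\ label v) set0.
    by left; rewrite -(setD1K vt) e setU0.
  right; apply/orP; right; apply/imsetP; exists (t :\ label v); last by rewrite setD1K.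
  rewrite in_cplx n0; apply/hasP; exists s => //; by rewrite subDset.
right; apply/orP; left; rewrite -[_ && _]/(_ && _).
apply/andP; split=> //; apply/existsP; exists (simplex s).
rewrite inE map_f //=; apply/subsetP => i it.
by have := subsetP ts i it; rewrite !inE => /orP[/eqP e|//]; rewrite -e it in vt.
Qed.

(** * Combinatorics of the sphere and of the two balls *)

Definition facets_ball : seq (seq nat) := [seq s <- facets16_92 | 1 \notin s].

Definition removed : seq nat := [:: 1; 9; 14; 15].

Definition facets_minus : seq (seq nat) := [seq s <- facets16_92 | s != removed].

Lemma S16_92_E : S16_92 = cplx facets16_92. Proof. exact: erefl. Qed.

Lemma B15_66_E : B15_66 = cplx facets_ball.
Proof. rewrite /B15_66 /cplx /facets_ball; exact: erefl. Qed.

Lemma labels_facets : all labels facets16_92. Proof. by vm_compute. Qed.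

Lemma labels_facets_ball : all labels facets_ball. Proof. by vm_compute. Qed.

Lemma labels_facets_minus : all labels facets_minus. Proof. by vm_compute. Qed.

Lemma tetrahedra_facets : tetrahedra facets16_92. Proof. by vm_compute. Qed.

Lemma tetrahedra_ball : tetrahedra facets_ball. Proof. by vm_compute. Qed.

Lemma tetrahedra_minus : tetrahedra facets_minus. Proof. by vm_compute. Qed.

(** The proper faces of the removed facet T survive because each ridge of T lies in another
    facet. *)
Lemma cplx_remove F T : all labels F -> labels T ->
  all (fun x => has (sub [seq y <- T | y != x]) [seq s <- F | s != T]) T ->
  all (fun s => ~~ sub T s) [seq s <- F | s != T] ->
  cplx F :\ simplex T = cplx [seq s <- F | s != T].
Proof.
set F' := [seq s <- F | s != T] => /allP lF lT /allP cov /allP nsub.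
have F'F s : s \in F' -> s \in F by rewrite mem_filter => /andP[].
apply/setP => t; rewrite in_setD1 !in_cplx andbCA; congr (_ && _).
apply/andP/hasP => [[tT /hasP[s sF ts]]|[s sF ts]].
  have [e|ns] := eqVneq s T; last by exists s; rewrite // mem_filter ns.
  rewrite {}e in ts.
  have : ~~ (simplex T \subset t).
    by apply: contra tT => Tt; rewrite eqEsubset ts.
  case/subsetPn => i; rewrite in_simplex // => iT it.
  have /hasP[u uF su] := cov _ iT; exists u => //; apply/subsetP => j jt.
  rewrite in_simplex ?(lF _ (F'F _ uF)) //; apply: (allP su).
  rewrite mem_filter -in_simplex // (subsetP ts) // andbT.
  by apply: contra it => /eqP /val_inj <-.
split; last by apply/hasP; exists s => //; exact: F'F.
apply/eqP => e; move: ts; rewrite e simplex_sub ?(lF _ (F'F _ sF)) //.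
by apply/negP/nsub.
Qed.

Lemma S16_92_minus_E : S16_92_minus = cplx facets_minus.
Proof.
rewrite /S16_92_minus S16_92_E; apply: cplx_remove; by vm_compute.
Qed.

Lemma in_vertices F v : all labels F ->
  (v \in vertices (cplx F)) = has (fun s => val v \in s) F.
Proof.
move=> lF; have e : [set v] = simplex [:: val v].
  by apply/setP => i; rewrite !inE /= label_val.
rewrite inE e in_cplx_simplex //= ?ltn_ord //.
by apply: eq_has => s; rewrite /= andbT.
Qed.

Lemma vertices_ball : vertices B15_66 = simplex (iota 2 15).
Proof.
apply/setP => v; rewrite B15_66_E in_vertices ?labels_facets_ball // in_simplex //.
have /allP : all (fun m => has (fun s => m \in s) facets_ball == (m \in iota 2 15)) (iota 0 17).
  by vm_compute.
by move=> /(_ (val v)); rewrite mem_iota ltn_ord => /(_ isT) /eqP.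
Qed.

Lemma card_vertices_ball : #|vertices B15_66| = 15.
Proof. by rewrite vertices_ball card_simplex ?size_iota ?iota_uniq. Qed.

Lemma apex_notin_ball : label 1 \notin vertices B15_66.
Proof. by rewrite vertices_ball in_simplex // val_label. Qed.

Lemma boundary_ball : boundary3 B15_66 = cplx (boundary_list facets_ball).
Proof. by rewrite B15_66_E (boundary3_cplx tetrahedra_ball). Qed.

Lemma labels_boundary_ball : all labels (boundary_list facets_ball).
Proof. by vm_compute. Qed.

Lemma cplx_cat F G : cplx (F ++ G) = cplx F :|: cplx G.
Proof.
by apply/setP => t; rewrite in_setU !in_cplx has_cat; case: (t != set0).
Qed.

Lemma cone_off_ball : cone_off (label 1) B15_66 = S16_92.
Proof.
have b0 : ~~ nilp (boundary_list facets_ball) by vm_compute.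
have bn : all (fun s => ~~ nilp s) (boundary_list facets_ball) by vm_compute.
rewrite /cone_off boundary_ball (@cone_cplx 1 _ isT labels_boundary_ball b0 bn).
rewrite B15_66_E -cplx_cat; apply: cplx_eq; by vm_compute.
Qed.

Lemma boundary_minus : boundary3 S16_92_minus = cplx (boundary_list facets_minus).
Proof. by rewrite S16_92_minus_E (boundary3_cplx tetrahedra_minus). Qed.

(** Found by computer search, as is the next sequence. *)
Definition collapse_to_vertex : seq (seq nat * nat) :=
  [:: ([:: 1; 9; 14], 8);
   ([:: 1; 8; 9], 7);
   ([:: 1; 9; 15], 11);
   ([:: 8; 9; 14], 2);
   ([:: 1; 7; 8], 3);
   ([:: 9; 11; 15], 13);
   ([:: 1; 11; 15], 8);
   ([:: 1; 14; 15], 16);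
   ([:: 2; 9; 14], 6);
   ([:: 11; 13; 15], 8);
   ([:: 1; 14; 16], 13);
   ([:: 1; 8; 14], 10);
   ([:: 2; 8; 14], 12);
   ([:: 14; 15; 16], 3);
   ([:: 9; 14; 15], 3);
   ([:: 1; 9; 11], 7);
   ([:: 7; 9; 11], 12);
   ([:: 2; 8; 12], 6);
   ([:: 1; 15; 16], 10);
   ([:: 13; 14; 16], 7);
   ([:: 3; 9; 14], 6);
   ([:: 1; 3; 7], 11);
   ([:: 1; 3; 8], 11);
   ([:: 3; 9; 15], 13);
   ([:: 3; 7; 8], 5);
   ([:: 3; 14; 16], 7);
   ([:: 2; 8; 9], 7);
   ([:: 3; 7; 11], 14);
   ([:: 1; 10; 15], 8);
   ([:: 3; 5; 8], 11);
   ([:: 8; 10; 14], 12);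
   ([:: 3; 11; 14], 5);
   ([:: 2; 7; 8], 4);
   ([:: 7; 9; 12], 10);
   ([:: 3; 6; 9], 16);
   ([:: 3; 13; 15], 2);
   ([:: 2; 13; 15], 7);
   ([:: 7; 10; 12], 14);
   ([:: 8; 10; 12], 15);
   ([:: 10; 15; 16], 12);
   ([:: 1; 13; 14], 10);
   ([:: 7; 13; 14], 10);
   ([:: 2; 7; 9], 10);
   ([:: 7; 10; 13], 2);
   ([:: 9; 11; 12], 13);
   ([:: 10; 12; 16], 9);
   ([:: 3; 9; 13], 12);
   ([:: 7; 13; 15], 6);
   ([:: 2; 12; 14], 5);
   ([:: 7; 12; 14], 11);
   ([:: 1; 10; 16], 4);
   ([:: 2; 5; 14], 6);
   ([:: 1; 10; 13], 4);
   ([:: 5; 12; 14], 11);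
   ([:: 3; 5; 14], 6);
   ([:: 9; 10; 16], 2);
   ([:: 2; 6; 9], 16);
   ([:: 6; 8; 12], 15);
   ([:: 3; 9; 12], 16);
   ([:: 2; 10; 16], 4);
   ([:: 2; 6; 12], 1);
   ([:: 2; 4; 10], 13);
   ([:: 1; 4; 13], 12);
   ([:: 3; 15; 16], 12);
   ([:: 3; 12; 13], 4);
   ([:: 7; 13; 16], 6);
   ([:: 6; 8; 15], 13);
   ([:: 3; 4; 13], 2);
   ([:: 2; 6; 8], 16);
   ([:: 1; 4; 16], 5);
   ([:: 2; 5; 6], 1);
   ([:: 1; 2; 12], 5);
   ([:: 3; 5; 6], 7);
   ([:: 1; 4; 5], 6);
   ([:: 2; 4; 7], 15);
   ([:: 1; 4; 6], 12);
   ([:: 2; 3; 15], 4);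
   ([:: 3; 4; 15], 12);
   ([:: 2; 8; 16], 4);
   ([:: 1; 5; 16], 13);
   ([:: 1; 5; 12], 13);
   ([:: 5; 7; 8], 4);
   ([:: 5; 6; 7], 4);
   ([:: 6; 8; 13], 16);
   ([:: 4; 12; 15], 6);
   ([:: 5; 8; 11], 13);
   ([:: 11; 12; 13], 5);
   ([:: 4; 6; 15], 7);
   ([:: 4; 5; 16], 8);
   ([:: 3; 7; 16], 6);
   ([:: 5; 13; 16], 8);
   ([:: 3; 8], 11);
   ([:: 9; 14], 6);
   ([:: 6; 8], 16);
   ([:: 3; 13], 2);
   ([:: 3; 9], 16);
   ([:: 1; 14], 10);
   ([:: 1; 16], 13);
   ([:: 10; 16], 4);
   ([:: 1; 15], 8);
   ([:: 11; 15], 8);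
   ([:: 6; 9], 16);
   ([:: 5; 16], 8);
   ([:: 2; 12], 5);
   ([:: 8; 14], 12);
   ([:: 14; 16], 7);
   ([:: 9; 15], 13);
   ([:: 2; 5], 1);
   ([:: 1; 3], 11);
   ([:: 1; 9], 7);
   ([:: 8; 9], 7);
   ([:: 3; 11], 5);
   ([:: 1; 2], 6);
   ([:: 7; 8], 4);
   ([:: 1; 7], 11);
   ([:: 9; 11], 13);
   ([:: 8; 12], 15);
   ([:: 7; 12], 11);
   ([:: 2; 14], 6);
   ([:: 2; 3], 4);
   ([:: 7; 9], 10);
   ([:: 2; 8], 4);
   ([:: 14; 15], 3);
   ([:: 9; 13], 12);
   ([:: 7; 11], 14);
   ([:: 3; 5], 7);
   ([:: 13; 14], 10);
   ([:: 2; 6], 16);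
   ([:: 7; 16], 6);
   ([:: 5; 7], 4);
   ([:: 3; 4], 12);
   ([:: 3; 15], 12);
   ([:: 1; 11], 8);
   ([:: 3; 12], 16);
   ([:: 1; 8], 10);
   ([:: 8; 10], 15);
   ([:: 8; 11], 13);
   ([:: 10; 15], 12);
   ([:: 3; 16], 6);
   ([:: 11; 13], 5);
   ([:: 6; 16], 13);
   ([:: 15; 16], 12);
   ([:: 12; 16], 9);
   ([:: 12; 15], 6);
   ([:: 9; 12], 10);
   ([:: 8; 15], 13);
   ([:: 10; 12], 14);
   ([:: 10; 14], 7);
   ([:: 7; 10], 2);
   ([:: 1; 10], 4);
   ([:: 7; 14], 3);
   ([:: 9; 16], 2);
   ([:: 2; 9], 10);
   ([:: 13; 15], 6);
   ([:: 6; 15], 7);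
   ([:: 2; 10], 13);
   ([:: 13; 16], 8);
   ([:: 6; 13], 7);
   ([:: 3; 7], 6);
   ([:: 2; 16], 4);
   ([:: 6; 7], 4);
   ([:: 12; 14], 11);
   ([:: 4; 7], 15);
   ([:: 3; 14], 6);
   ([:: 8; 16], 4);
   ([:: 4; 15], 2);
   ([:: 7; 15], 2);
   ([:: 2; 4], 13);
   ([:: 4; 10], 13);
   ([:: 8; 13], 5);
   ([:: 1; 4], 12);
   ([:: 7; 13], 2);
   ([:: 11; 14], 5);
   ([:: 6; 14], 5);
   ([:: 4; 13], 12);
   ([:: 4; 12], 6);
   ([:: 5; 11], 12);
   ([:: 4; 6], 5);
   ([:: 5; 8], 4);
   ([:: 5; 12], 13);
   ([:: 6; 12], 1);
   ([:: 5; 13], 1);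
   ([:: 1; 6], 5);
   ([:: 1; 13], 12);
   ([:: 14], 5);
   ([:: 16], 4);
   ([:: 7], 2);
   ([:: 15], 2);
   ([:: 3], 6);
   ([:: 6], 5);
   ([:: 11], 12);
   ([:: 8], 4);
   ([:: 9], 10);
   ([:: 4], 5);
   ([:: 10], 13);
   ([:: 2], 13);
   ([:: 5], 1);
   ([:: 13], 12);
   ([:: 12], 1)].

Definition collapse_to_boundary : seq (seq nat * nat) :=
  [:: ([:: 1; 9; 15], 11);
   ([:: 1; 11; 15], 8);
   ([:: 1; 9; 11], 7);
   ([:: 1; 7; 9], 8);
   ([:: 1; 7; 8], 3);
   ([:: 7; 9; 11], 12);
   ([:: 1; 8; 15], 10);
   ([:: 1; 8; 10], 14);
   ([:: 7; 9; 12], 10);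
   ([:: 9; 11; 12], 13);
   ([:: 11; 12; 13], 5);
   ([:: 8; 10; 15], 12);
   ([:: 1; 3; 7], 11);
   ([:: 1; 8; 14], 9);
   ([:: 9; 11; 13], 15);
   ([:: 9; 13; 15], 3);
   ([:: 3; 7; 8], 5);
   ([:: 8; 10; 12], 14);
   ([:: 3; 9; 15], 14);
   ([:: 1; 3; 8], 11);
   ([:: 8; 11; 15], 13);
   ([:: 3; 8; 11], 5);
   ([:: 3; 5; 7], 6);
   ([:: 10; 12; 14], 7);
   ([:: 7; 11; 12], 14);
   ([:: 3; 5; 11], 14);
   ([:: 8; 9; 14], 2);
   ([:: 7; 8; 9], 2);
   ([:: 3; 13; 15], 2);
   ([:: 8; 12; 15], 6);
   ([:: 9; 10; 12], 16);
   ([:: 3; 5; 6], 14);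
   ([:: 7; 9; 10], 2);
   ([:: 5; 12; 13], 1);
   ([:: 3; 9; 13], 12);
   ([:: 3; 12; 13], 4);
   ([:: 6; 8; 12], 2);
   ([:: 1; 10; 14], 13);
   ([:: 3; 9; 12], 16);
   ([:: 5; 8; 11], 13);
   ([:: 6; 8; 15], 13);
   ([:: 2; 7; 10], 13);
   ([:: 3; 4; 12], 15);
   ([:: 4; 12; 13], 1);
   ([:: 11; 12; 14], 5);
   ([:: 3; 6; 7], 16);
   ([:: 7; 11; 14], 3);
   ([:: 10; 13; 14], 7);
   ([:: 5; 7; 8], 4);
   ([:: 2; 7; 8], 4);
   ([:: 5; 8; 13], 16);
   ([:: 2; 9; 10], 16);
   ([:: 5; 12; 14], 2);
   ([:: 1; 4; 12], 6);
   ([:: 10; 12; 16], 15);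
   ([:: 8; 13; 16], 6);
   ([:: 1; 5; 13], 16);
   ([:: 1; 4; 6], 5);
   ([:: 4; 5; 8], 16);
   ([:: 10; 15; 16], 1);
   ([:: 5; 6; 7], 4);
   ([:: 2; 9; 16], 6);
   ([:: 6; 7; 16], 13);
   ([:: 2; 5; 14], 6);
   ([:: 2; 8; 12], 14);
   ([:: 3; 12; 15], 16);
   ([:: 6; 13; 15], 7);
   ([:: 2; 6; 8], 16);
   ([:: 1; 4; 13], 10);
   ([:: 2; 8; 16], 4);
   ([:: 2; 5; 6], 1);
   ([:: 2; 10; 16], 4);
   ([:: 6; 7; 15], 4);
   ([:: 7; 13; 14], 16);
   ([:: 1; 5; 12], 2);
   ([:: 2; 9; 14], 6);
   ([:: 4; 7; 15], 2);
   ([:: 3; 7; 16], 14);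
   ([:: 6; 9; 16], 3);
   ([:: 1; 10; 16], 4);
   ([:: 2; 10; 13], 4);
   ([:: 1; 4; 5], 16);
   ([:: 4; 6; 15], 12);
   ([:: 3; 4; 13], 2);
   ([:: 1; 15; 16], 14);
   ([:: 2; 4; 15], 3);
   ([:: 7; 13; 15], 2);
   ([:: 3; 15; 16], 14);
   ([:: 1; 6; 12], 2);
   ([:: 6; 9; 14], 3);
   ([:: 1; 13; 16], 14);
   ([:: 3; 8], 5);
   ([:: 9; 11], 15);
   ([:: 2; 10], 4);
   ([:: 3; 12], 16);
   ([:: 6; 15], 12);
   ([:: 7; 9], 2);
   ([:: 3; 5], 14);
   ([:: 8; 10], 14);
   ([:: 8; 15], 13);
   ([:: 9; 10], 16);
   ([:: 7; 8], 4);
   ([:: 9; 13], 12);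
   ([:: 10; 16], 4);
   ([:: 11; 15], 13);
   ([:: 5; 8], 16);
   ([:: 9; 12], 16);
   ([:: 12; 13], 1);
   ([:: 10; 14], 7);
   ([:: 8; 12], 14);
   ([:: 9; 16], 3);
   ([:: 11; 12], 5);
   ([:: 1; 7], 11);
   ([:: 5; 7], 4);
   ([:: 13; 15], 2);
   ([:: 1; 12], 2);
   ([:: 12; 16], 15);
   ([:: 7; 15], 2);
   ([:: 15; 16], 14);
   ([:: 3; 13], 2);
   ([:: 8; 14], 2);
   ([:: 5; 12], 2);
   ([:: 2; 15], 3);
   ([:: 7; 11], 3);
   ([:: 1; 3], 11);
   ([:: 1; 11], 8);
   ([:: 3; 11], 14);
   ([:: 2; 3], 4);
   ([:: 3; 4], 15);
   ([:: 3; 7], 14);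
   ([:: 11; 14], 5);
   ([:: 8; 11], 13);
   ([:: 5; 14], 6);
   ([:: 11; 13], 5);
   ([:: 4; 15], 12);
   ([:: 3; 15], 14);
   ([:: 4; 12], 6);
   ([:: 12; 15], 10);
   ([:: 5; 13], 16);
   ([:: 2; 5], 1);
   ([:: 6; 12], 2);
   ([:: 2; 12], 14);
   ([:: 8; 13], 6);
   ([:: 10; 12], 7);
   ([:: 10; 15], 1);
   ([:: 12; 14], 7);
   ([:: 7; 14], 16);
   ([:: 7; 16], 13);
   ([:: 7; 10], 13);
   ([:: 1; 8], 9);
   ([:: 8; 9], 2);
   ([:: 2; 9], 6);
   ([:: 2; 14], 6);
   ([:: 6; 8], 16);
   ([:: 6; 14], 3);
   ([:: 1; 2], 6);
   ([:: 2; 8], 4);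
   ([:: 8; 16], 4);
   ([:: 6; 9], 3);
   ([:: 3; 6], 16);
   ([:: 1; 6], 5);
   ([:: 5; 6], 4);
   ([:: 2; 6], 16);
   ([:: 6; 16], 13);
   ([:: 1; 5], 16);
   ([:: 5; 16], 4);
   ([:: 4; 6], 7);
   ([:: 2; 16], 4);
   ([:: 3; 9], 14);
   ([:: 4; 16], 1);
   ([:: 6; 7], 13);
   ([:: 7; 13], 2);
   ([:: 1; 4], 10);
   ([:: 2; 13], 4);
   ([:: 4; 13], 10);
   ([:: 1; 16], 14);
   ([:: 3; 14], 16);
   ([:: 2; 7], 4);
   ([:: 10; 13], 1);
   ([:: 13; 16], 14);
   ([:: 13; 14], 1);
   ([:: 3], 16);
   ([:: 11], 5);
   ([:: 16], 14);
   ([:: 5], 4);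
   ([:: 8], 4);
   ([:: 2], 4);
   ([:: 12], 7);
   ([:: 6], 13);
   ([:: 13], 1);
   ([:: 7], 4);
   ([:: 4], 10);
   ([:: 10], 1)].

Lemma collapse_to_vertex_run :
  collapse_run (face_list facets_minus) collapse_to_vertex = Some [:: [:: 1]].
Proof. by vm_compute. Qed.

Lemma collapsible_minus : collapsible S16_92_minus.
Proof.
apply/existsP; exists (label 1).
have -> : [set [set label 1]] = [set:: map simplex [:: [:: 1]]].
  apply/setP => t; rewrite !inE; congr (t == _).
  by apply/setP => i; rewrite !inE.
rewrite S16_92_minus_E (cplx_faces labels_facets_minus).
apply: collapse_runP collapse_to_vertex_run; by vm_compute.
Qed.

Lemma LC_sphere_S16_92 : LC_sphere S16_92.
Proof.
apply/exists_inP; exists (simplex removed); last exact: collapsible_minus.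
by rewrite S16_92_E (faces3_cplx tetrahedra_facets) inE map_f.
Qed.

Lemma collapse_to_boundary_run :
  exists2 L, collapse_run (face_list facets_minus) collapse_to_boundary = Some L
    & all [in [seq s <- face_list (boundary_list facets_minus) | s != [:: 1; 9; 15]]] L
      && all [in L] [seq s <- face_list (boundary_list facets_minus) | s != [:: 1; 9; 15]].
Proof.
have some (o : option (seq (seq nat))) p : (if o is Some L then p L else false) ->
    exists2 L, o = Some L & p L.
  by case: o => // L pL; exists L.
apply: some; by vm_compute.
Qed.

Lemma cplx_remove_face F t : all labels F -> labels t ->
  all (fun s => sub s t && sub t s ==> (s == t)) (face_list F) ->
  cplx F :\ simplex t = [set:: map simplex [seq s <- face_list F | s != t]].
Proof.
move=> lF lt /allP inj; rewrite cplx_faces //; apply/setP => u.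
rewrite in_setD1 in_set [RHS]in_set.
have st s : s \in face_list F -> (simplex s == simplex t) = (s == t).
  move=> sF; have ls := allP (all_labels_face_list lF) _ sF.
  have := inj s sF; rewrite eqEsubset !simplex_sub //.
  case: (boolP (sub s t && sub t s)) => [_ /= -> //|nst _].
  by apply/esym/negbTE; apply: contra nst => /eqP ->; rewrite andbb; apply/allP.
apply/andP/mapP => [[nt /mapP[s sF e]]|[s]].
  by exists s; rewrite // mem_filter sF andbT -st // -e.
rewrite mem_filter => /andP[ns sF] ->; split; last exact: map_f.
by rewrite st.
Qed.

Lemma set_of_seq_eq (L M : seq (seq nat)) : all [in M] L -> all [in L] M ->
  [set:: map simplex L] = [set:: map simplex M].
Proof.
move=> /allP LM /allP ML; apply/setP => u; rewrite !in_set.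
by apply/mapP/mapP => -[s] => [/LM|/ML] sin ->; exists s.
Qed.

Lemma labels_boundary_minus : all labels (boundary_list facets_minus).
Proof. by vm_compute. Qed.

Lemma free_triangle_boundary : has (sub [:: 1; 9; 15]) (boundary_list facets_minus).
Proof. by vm_compute. Qed.

Lemma free_triangle_once : all (fun s => sub s [:: 1; 9; 15] && sub [:: 1; 9; 15] s
    ==> (s == [:: 1; 9; 15])) (face_list (boundary_list facets_minus)).
Proof. by vm_compute. Qed.

Lemma labels_collapse_to_boundary :
  all (fun m : seq nat * nat => labels (m.2 :: m.1)) collapse_to_boundary.
Proof. by vm_compute. Qed.

Lemma LC_ball_minus : LC_ball S16_92_minus.
Proof.
have l3 : labels [:: 1; 9; 15] by [].
have lb := labels_boundary_minus.
rewrite /LC_ball boundary_minus; apply/exists_inP.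
exists (simplex [:: 1; 9; 15]).
  by rewrite inE (@in_cplx_simplex _ [:: 1; 9; 15] lb isT) free_triangle_boundary card_simplex.
have [L E /andP[h1 h2]] := collapse_to_boundary_run.
have eL := etrans (cplx_remove_face lb l3 free_triangle_once) (esym (set_of_seq_eq h1 h2)).
rewrite eL S16_92_minus_E (cplx_faces labels_facets_minus).
exact: (collapse_runP (all_labels_face_list labels_facets_minus) labels_collapse_to_boundary E).
Qed.

(** * An obstruction to collapsibility *)

Section EdgeVectors.
Variables (V : finType) (k : fieldType) (m : nat) (Y : {set V} -> 'rV[k]_m).
Implicit Types (K L : {set {set V}}) (s t e : {set V}).

Definition edge_span K : {vspace 'rV[k]_m} := (\sum_(e in faces K 1) <[Y e]>)%VS.

Definition spanned_in t e : bool :=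
  Y e \in (\sum_(e' : {set V} | [&& e' \subset t, #|e'| == 2 & e' != e]) <[Y e']>)%VS.

Definition triangle_closed K :=
  forall t e, t \in K -> #|t| = 3 -> e \subset t -> #|e| = 2 -> spanned_in t e.

Lemma free_pair_complex K s t : simplicial_complex K -> free_pair K s t ->
  simplicial_complex (K :\: [set s; t]) /\ #|t| = #|s|.+1.
Proof.
move=> /andP[K0 /forall_inP Kd] /and4P[sK tK st /forall_inP fr].
have fr' u : u \in K -> s \proper u -> u = t.
  by move=> uK su; apply/eqP; have := fr u uK; rewrite su.
have s0 : s != set0 by apply: contraNneq K0 => <-.
split.
  apply/andP; split; first by rewrite inE negb_and K0 orbT.
  apply/forall_inP => u; rewrite inE => /andP[nu uK].
  move: nu; rewrite !inE => /norP[us ut].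
  apply/forallP => w; apply/implyP => /andP[w0 wu]; rewrite !inE.
  have /forallP /(_ w) := Kd u uK; rewrite w0 wu /= => ->; rewrite andbT.
  apply/norP; split; apply/eqP => e; rewrite e in wu.
    have su : s \proper u by rewrite properEneq eq_sym us.
    by rewrite (fr' u uK su) eqxx in ut.
  have su : s \proper u := proper_sub_trans st wu.
  by rewrite (fr' u uK su) eqxx in ut.
have /properP[_ [x xt xs]] := st.
have xsK : x |: s \in K.
  have /forallP /(_ (x |: s)) := Kd t tK.
  rewrite subUset sub1set xt (proper_sub st) andbT.
  have -> : x |: s != set0 by apply/set0Pn; exists x; rewrite setU11.
  by [].
rewrite -(fr' _ xsK); first by rewrite cardsU1 xs.
by apply/properP; split; [exact: subsetUr | exists x; rewrite ?setU11].
Qed.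

Lemma triangle_closedS K L : L \subset K -> triangle_closed K -> triangle_closed L.
Proof. by move=> LK cK t e tL; apply: cK; exact: (subsetP LK). Qed.

Lemma in_faces K n e : (e \in faces K n) = (e \in K) && (#|e| == n.+1).
Proof. by rewrite inE. Qed.

Lemma in_vertices_of K w : (w \in vertices K) = ([set w] \in K).
Proof. by rewrite inE. Qed.

(** Only two kinds of collapse change the vertices or the edges. If a vertex and an edge
    disappear, one generator of the span is lost with one vertex; if an edge and a triangle
    disappear, the vector of the edge lies in the span of the other two sides, which remain. *)
Lemma edge_span_collapse_step K L : simplicial_complex K -> triangle_closed K ->
  elementary_collapse K L ->
  simplicial_complex L /\
  (\dim (edge_span K) + #|vertices L| <= \dim (edge_span L) + #|vertices K|)%N.
Proof.
move=> cK tcK /existsP[s /existsP[t /andP[fp /eqP ->]]].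
have [cL ct] := free_pair_complex cK fp; split=> //.
case/and4P: (fp) => sK tK st _.
have s0 : (0 < #|s|)%N.
  rewrite card_gt0; case/andP: cK => K0 _.
  by apply: contraNneq K0 => <-.
set L' := K :\: _.
have inL e : (e \in L') = [&& e != s, e != t & e \in K] by rewrite !inE negb_or andbA.
have ns e n : #|e| = n -> n != #|s| -> e != s.
  by move=> <-; apply: contra => /eqP ->.
have nt e n : #|e| = n -> n != #|s|.+1 -> e != t.
  by move=> <-; rewrite -ct; apply: contra => /eqP ->.
case es : #|s| s0 => [|[|[|d]]] // _; rewrite es in ns nt ct.
- (* a vertex disappears, and with it one generator *)
  have /cards1P[v sv] : #|s| == 1 by rewrite es.
  have vE : vertices K = v |: vertices L'.
    apply/setP => w; rewrite in_setU1 !in_vertices_of inL.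
    case: (eqVneq w v) => [->|wv] /=; first by rewrite -sv.
    rewrite (nt _ 1) ?cards1 //=.
    have -> : [set w] != s by rewrite sv; apply: contra wv => /eqP /set1_inj ->.
    by [].
  have vL : v \notin vertices L' by rewrite in_vertices_of -sv inL eqxx.
  rewrite vE cardsU1 vL /= addnA leq_add2r.
  have -> : edge_span K = (edge_span L' + <[Y t]>)%VS.
    rewrite /edge_span (bigD1 t) /=; last by rewrite in_faces tK ct.
    rewrite addvC; congr (_ + _)%VS; apply: eq_bigl => e.
    rewrite !in_faces inL; case: (e \in K); rewrite ?andbF //= andbT.
    by case: (eqVneq #|e| 2) => e2; rewrite ?andbF //= (ns _ 2) //= ?andbT.
  apply: leq_trans (leq_of_leqif (dimv_add_leqif _ _)) _.
  by rewrite leq_add2l dim_vline; case: (_ != _).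
- (* an edge disappears; its vector lies in the span of the other two sides *)
  have -> : vertices K = vertices L'.
    by apply/setP => w; rewrite !in_vertices_of inL (ns _ 1) ?cards1 // (nt _ 1) ?cards1.
  rewrite leq_add2r; apply: dimvS.
  have sides e : e \subset t -> #|e| = 2 -> e != s -> (<[Y e]> <= edge_span L')%VS.
    move=> et e2 es'; rewrite /edge_span (bigD1 e) ?addvSl //=.
    rewrite in_faces inL es' (nt _ 2) // e2 eqxx andbT /=.
    case/andP: cK => _ /forall_inP /(_ t tK) /forallP /(_ e); rewrite et andbT.
    by rewrite -card_gt0 e2.
  apply/subv_sumP => e; rewrite in_faces => /andP[eK /eqP e2].
  have [e_s|es'] := eqVneq e s; last first.
    rewrite /edge_span (bigD1 e) ?addvSl //=.
    by rewrite in_faces inL es' (nt _ 2) // e2 eqxx eK.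
  rewrite {}e_s -memvE.
  have := tcK t s tK ct (proper_sub st) es; rewrite /spanned_in.
  apply: subvP; apply/subv_sumP => e' /and3P[e't /eqP e'2 e's]; exact: sides.
- (* the vertices and the edges are unchanged *)
  have -> : vertices K = vertices L'.
    by apply/setP => w; rewrite !in_vertices_of inL (ns _ 1) ?cards1 // (nt _ 1) ?cards1.
  rewrite leq_add2r; apply: dimvS; rewrite /edge_span.
  apply/subv_sumP => e; rewrite in_faces => /andP[eK /eqP e2].
  rewrite (bigD1 e) ?addvSl //=.
  by rewrite in_faces inL (ns _ 2) // (nt _ 2) // e2 eqxx eK.
Qed.

Lemma edge_span_collapses K L : simplicial_complex K -> triangle_closed K ->
  collapses K L ->
  (\dim (edge_span K) + #|vertices L| <= \dim (edge_span L) + #|vertices K|)%N.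
Proof.
move=> cK tcK /connectP[p]; elim: p K cK tcK => [|K' p IH] K cK tcK /=.
  by move=> _ ->.
move=> /andP[KK' pth] lst.
have [cK' h] := edge_span_collapse_step cK tcK KK'.
have K'K : K' \subset K.
  by have /existsP[s /existsP[t /andP[_ /eqP ->]]] := KK'; exact: subsetDl.
have := IH K' cK' (triangle_closedS K'K tcK) pth lst.
move=> h'; rewrite -(leq_add2r #|vertices K'|) addnAC.
apply: leq_trans (leq_add h (leqnn _)) _.
rewrite addnAC (addnAC (\dim (edge_span L))) leq_add2r.
by rewrite addnC in h' *.
Qed.

(** A single vertex has no edge, so the dimension of the span stays below the number of vertices
    all along a sequence of collapses that ends there. *)
Lemma collapsible_edge_span K : simplicial_complex K -> triangle_closed K ->
  collapsible K -> (\dim (edge_span K) < #|vertices K|)%N.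
Proof.
move=> cK tcK /existsP[v /(edge_span_collapses cK tcK)].
have -> : edge_span [set [set v]] = 0%VS.
  rewrite /edge_span big_pred0 // => e; rewrite in_faces inE.
  by case: eqP => // ->; rewrite cards1.
have -> : #|vertices [set [set v]]| = 1.
  apply/eqP/cards1P; exists v; apply/setP => w; rewrite !inE.
  by apply/eqP/eqP => [/set1_inj|->].
by rewrite dimv0 add0n addn1.
Qed.
End EdgeVectors.

Import GRing.Theory.

(** * The ball is not collapsible *)

(** The vector of an edge, over the field with three elements. Each of the 15 coordinates is a
    1-cocycle, with coefficients twisted by signs, on the complement of the knotted edge. *)
Definition cycle_table : seq (seq nat * seq nat) :=
  [:: ([:: 8; 9], [:: 0; 0; 2; 2; 0; 0; 0; 0; 0; 0; 1; 0; 0; 2; 2]);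
   ([:: 11; 14], [:: 0; 1; 0; 0; 0; 2; 0; 1; 2; 1; 1; 1; 1; 1; 0]);
   ([:: 3; 6], [:: 2; 0; 0; 2; 0; 0; 0; 0; 2; 1; 1; 0; 1; 0; 0]);
   ([:: 3; 15], [:: 0; 1; 0; 0; 0; 1; 0; 0; 2; 1; 1; 2; 1; 1; 0]);
   ([:: 14; 15], [:: 0; 1; 0; 0; 0; 1; 0; 0; 1; 2; 1; 0; 2; 2; 1]);
   ([:: 15; 16], [:: 0; 1; 0; 1; 0; 1; 0; 0; 0; 0; 0; 2; 0; 1; 0]);
   ([:: 7; 12], [:: 0; 0; 0; 1; 0; 0; 0; 0; 2; 0; 2; 0; 0; 1; 0]);
   ([:: 7; 16], [:: 0; 2; 0; 2; 0; 0; 0; 0; 1; 2; 0; 1; 2; 1; 1]);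
   ([:: 2; 13], [:: 0; 0; 0; 2; 0; 0; 0; 0; 0; 0; 2; 0; 2; 0; 0]);
   ([:: 3; 5], [:: 0; 1; 0; 2; 2; 0; 0; 0; 0; 0; 0; 2; 2; 0; 2]);
   ([:: 3; 14], [:: 0; 0; 0; 0; 0; 0; 0; 0; 2; 1; 0; 1; 1; 1; 1]);
   ([:: 7; 11], [:: 0; 2; 0; 0; 0; 2; 0; 1; 2; 1; 2; 1; 1; 1; 0]);
   ([:: 6; 15], [:: 2; 0; 0; 0; 0; 1; 0; 0; 0; 0; 0; 0; 1; 2; 1]);
   ([:: 10; 12], [:: 0; 1; 0; 1; 0; 0; 1; 0; 2; 0; 0; 2; 0; 1; 0]);
   ([:: 2; 8], [:: 0; 0; 0; 1; 0; 0; 0; 0; 0; 0; 2; 0; 1; 0; 2]);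
   ([:: 3; 9], [:: 0; 0; 1; 1; 0; 0; 0; 0; 1; 2; 2; 0; 2; 0; 0]);
   ([:: 2; 3], [:: 0; 0; 0; 0; 0; 0; 0; 0; 0; 0; 0; 0; 0; 0; 0]);
   ([:: 10; 16], [:: 0; 2; 0; 2; 0; 0; 2; 0; 0; 0; 0; 1; 0; 2; 0]);
   ([:: 2; 12], [:: 0; 1; 0; 2; 0; 0; 0; 0; 2; 0; 2; 2; 1; 1; 2]);
   ([:: 3; 4], [:: 0; 0; 0; 2; 0; 0; 0; 0; 0; 0; 1; 0; 1; 0; 0]);
   ([:: 9; 11], [:: 0; 2; 1; 1; 0; 2; 0; 1; 2; 1; 1; 1; 1; 2; 0]);
   ([:: 6; 14], [:: 2; 0; 0; 2; 0; 0; 0; 0; 0; 0; 1; 2; 0; 2; 2]);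
   ([:: 2; 7], [:: 0; 0; 0; 1; 0; 0; 0; 0; 0; 0; 2; 0; 1; 0; 0]);
   ([:: 2; 16], [:: 0; 0; 0; 1; 0; 0; 0; 0; 0; 0; 2; 0; 2; 2; 0]);
   ([:: 5; 8], [:: 0; 1; 0; 1; 1; 0; 0; 0; 2; 1; 2; 2; 2; 1; 0]);
   ([:: 9; 15], [:: 0; 2; 1; 1; 0; 2; 0; 0; 2; 1; 1; 1; 1; 2; 0]);
   ([:: 6; 9], [:: 2; 0; 1; 0; 0; 0; 0; 0; 0; 0; 0; 0; 0; 0; 0]);
   ([:: 5; 12], [:: 0; 0; 0; 1; 2; 0; 0; 0; 0; 1; 0; 0; 0; 0; 0]);
   ([:: 9; 10], [:: 0; 2; 2; 2; 0; 0; 2; 0; 0; 0; 0; 1; 0; 2; 0]);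
   ([:: 6; 13], [:: 1; 1; 0; 1; 0; 0; 0; 0; 2; 1; 2; 2; 1; 2; 2]);
   ([:: 5; 7], [:: 0; 1; 0; 1; 1; 0; 0; 0; 2; 1; 2; 2; 2; 1; 2]);
   ([:: 5; 16], [:: 0; 1; 0; 1; 1; 0; 0; 0; 2; 1; 2; 2; 1; 2; 2]);
   ([:: 9; 14], [:: 0; 0; 2; 2; 0; 0; 0; 0; 0; 0; 1; 2; 0; 2; 2]);
   ([:: 12; 15], [:: 0; 1; 0; 1; 0; 1; 0; 0; 2; 0; 0; 2; 0; 1; 0]);
   ([:: 13; 16], [:: 0; 1; 0; 1; 0; 0; 0; 0; 2; 1; 2; 2; 1; 2; 2]);
   ([:: 5; 11], [:: 0; 2; 0; 2; 2; 2; 0; 1; 1; 2; 1; 1; 1; 2; 0]);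
   ([:: 8; 13], [:: 0; 1; 0; 1; 0; 0; 0; 0; 2; 1; 2; 2; 2; 1; 0]);
   ([:: 4; 6], [:: 2; 2; 0; 2; 0; 0; 0; 0; 1; 2; 0; 1; 1; 1; 1]);
   ([:: 4; 15], [:: 0; 2; 0; 2; 0; 2; 0; 0; 1; 2; 0; 1; 0; 2; 0]);
   ([:: 5; 6], [:: 1; 2; 0; 2; 1; 0; 0; 0; 1; 2; 2; 1; 0; 0; 1]);
   ([:: 11; 13], [:: 0; 1; 0; 1; 0; 1; 0; 2; 2; 1; 2; 2; 2; 1; 0]);
   ([:: 12; 14], [:: 0; 1; 0; 1; 0; 0; 0; 0; 2; 0; 0; 0; 0; 1; 0]);
   ([:: 4; 10], [:: 0; 2; 0; 2; 0; 0; 2; 0; 0; 0; 0; 1; 0; 0; 0]);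
   ([:: 8; 12], [:: 0; 2; 0; 2; 0; 0; 0; 0; 1; 0; 0; 1; 0; 2; 0]);
   ([:: 4; 5], [:: 0; 2; 0; 2; 2; 0; 0; 0; 1; 2; 1; 1; 2; 2; 1]);
   ([:: 7; 15], [:: 0; 2; 0; 2; 0; 2; 0; 0; 1; 2; 0; 1; 1; 2; 0]);
   ([:: 8; 16], [:: 0; 0; 0; 0; 0; 0; 0; 0; 0; 0; 0; 0; 1; 2; 1]);
   ([:: 11; 12], [:: 0; 2; 0; 1; 0; 2; 0; 1; 1; 1; 1; 1; 1; 2; 0]);
   ([:: 3; 13], [:: 0; 0; 0; 1; 0; 0; 0; 0; 0; 0; 1; 0; 1; 0; 0]);
   ([:: 7; 10], [:: 0; 1; 0; 0; 0; 0; 1; 0; 0; 0; 1; 2; 0; 0; 0]);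
   ([:: 8; 11], [:: 0; 0; 0; 0; 0; 2; 0; 1; 0; 0; 0; 0; 0; 0; 0]);
   ([:: 3; 8], [:: 0; 2; 0; 0; 0; 0; 0; 0; 2; 1; 2; 1; 1; 1; 2]);
   ([:: 7; 14], [:: 0; 1; 0; 0; 0; 0; 0; 0; 0; 0; 1; 0; 0; 0; 0]);
   ([:: 10; 15], [:: 0; 0; 0; 0; 0; 2; 1; 0; 0; 0; 0; 0; 0; 0; 0]);
   ([:: 3; 12], [:: 0; 0; 0; 2; 0; 0; 0; 0; 0; 1; 1; 0; 1; 0; 0]);
   ([:: 7; 9], [:: 0; 0; 1; 1; 0; 0; 0; 0; 0; 0; 2; 0; 0; 1; 0]);
   ([:: 2; 6], [:: 2; 0; 0; 1; 0; 0; 0; 0; 0; 0; 2; 0; 2; 2; 0]);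
   ([:: 2; 15], [:: 0; 2; 0; 0; 0; 2; 0; 0; 1; 2; 2; 1; 2; 2; 0]);
   ([:: 3; 7], [:: 0; 1; 0; 0; 0; 0; 0; 0; 1; 2; 1; 2; 2; 2; 2]);
   ([:: 3; 16], [:: 0; 0; 0; 2; 0; 0; 0; 0; 2; 1; 1; 0; 1; 0; 0]);
   ([:: 14; 16], [:: 0; 0; 0; 2; 0; 0; 0; 0; 1; 2; 1; 1; 2; 1; 1]);
   ([:: 6; 8], [:: 1; 0; 0; 0; 0; 0; 0; 0; 0; 0; 0; 0; 2; 1; 2]);
   ([:: 10; 14], [:: 0; 0; 0; 0; 0; 0; 1; 0; 0; 0; 0; 2; 0; 0; 0]);
   ([:: 2; 10], [:: 0; 2; 0; 1; 0; 0; 2; 0; 0; 0; 1; 1; 1; 0; 0]);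
   ([:: 3; 11], [:: 0; 2; 0; 0; 0; 1; 0; 2; 2; 1; 2; 1; 1; 1; 2]);
   ([:: 6; 12], [:: 1; 1; 0; 1; 0; 0; 0; 0; 2; 0; 0; 2; 2; 2; 2]);
   ([:: 2; 5], [:: 0; 1; 0; 0; 2; 0; 0; 0; 2; 1; 2; 2; 1; 1; 2]);
   ([:: 2; 14], [:: 0; 0; 0; 1; 0; 0; 0; 0; 0; 0; 2; 2; 1; 0; 2]);
   ([:: 9; 13], [:: 0; 0; 1; 2; 0; 0; 0; 0; 1; 2; 0; 0; 0; 0; 0]);
   ([:: 6; 7], [:: 2; 2; 0; 2; 0; 0; 0; 0; 1; 2; 0; 1; 2; 1; 1]);
   ([:: 6; 16], [:: 1; 0; 0; 0; 0; 0; 0; 0; 0; 0; 0; 0; 0; 0; 0]);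
   ([:: 10; 13], [:: 0; 1; 0; 0; 0; 0; 1; 0; 0; 0; 0; 2; 0; 0; 0]);
   ([:: 2; 9], [:: 0; 0; 2; 1; 0; 0; 0; 0; 0; 0; 2; 0; 2; 2; 0]);
   ([:: 13; 15], [:: 0; 1; 0; 1; 0; 1; 0; 0; 2; 1; 2; 2; 2; 1; 0]);
   ([:: 2; 4], [:: 0; 0; 0; 1; 0; 0; 0; 0; 0; 0; 2; 0; 2; 0; 0]);
   ([:: 5; 14], [:: 0; 1; 0; 2; 2; 0; 0; 0; 2; 1; 0; 0; 0; 1; 0]);
   ([:: 9; 12], [:: 0; 0; 1; 0; 0; 0; 0; 0; 1; 0; 0; 0; 0; 0; 0]);
   ([:: 12; 13], [:: 0; 0; 0; 2; 0; 0; 0; 0; 0; 2; 0; 0; 0; 0; 0]);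
   ([:: 13; 14], [:: 0; 1; 0; 0; 0; 0; 0; 0; 0; 0; 0; 0; 0; 0; 0]);
   ([:: 9; 16], [:: 0; 0; 1; 0; 0; 0; 0; 0; 0; 0; 0; 0; 0; 0; 0]);
   ([:: 4; 13], [:: 0; 0; 0; 1; 0; 0; 0; 0; 0; 0; 0; 0; 0; 0; 0]);
   ([:: 5; 13], [:: 0; 0; 0; 0; 1; 0; 0; 0; 0; 0; 0; 0; 0; 0; 0]);
   ([:: 8; 15], [:: 0; 0; 0; 0; 0; 1; 0; 0; 0; 0; 0; 0; 0; 0; 0]);
   ([:: 4; 8], [:: 0; 0; 0; 0; 0; 0; 0; 0; 0; 0; 0; 0; 1; 0; 1]);
   ([:: 8; 10], [:: 0; 0; 0; 0; 0; 0; 1; 0; 0; 0; 0; 0; 0; 0; 0]);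
   ([:: 11; 15], [:: 0; 0; 0; 0; 0; 0; 0; 1; 0; 0; 0; 0; 0; 0; 0]);
   ([:: 12; 16], [:: 0; 0; 0; 0; 0; 0; 0; 0; 1; 0; 0; 0; 0; 0; 0]);
   ([:: 4; 12], [:: 0; 0; 0; 0; 0; 0; 0; 0; 0; 1; 0; 0; 0; 0; 0]);
   ([:: 7; 13], [:: 0; 0; 0; 0; 0; 0; 0; 0; 0; 0; 1; 0; 0; 0; 0]);
   ([:: 8; 14], [:: 0; 0; 0; 0; 0; 0; 0; 0; 0; 0; 0; 1; 0; 0; 0]);
   ([:: 4; 7], [:: 0; 0; 0; 0; 0; 0; 0; 0; 0; 0; 0; 0; 1; 0; 0]);
   ([:: 4; 16], [:: 0; 0; 0; 0; 0; 0; 0; 0; 0; 0; 0; 0; 0; 1; 0]);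
   ([:: 7; 8], [:: 0; 0; 0; 0; 0; 0; 0; 0; 0; 0; 0; 0; 0; 0; 1])].

Definition cycle_entry (s : seq nat) : seq nat :=
  nth [::] (unzip2 cycle_table) (index s (unzip1 cycle_table)).

Definition vector3 (u : seq nat) : 'rV['F_3]_15 := (\row_j (nth 0 u j)%:R)%R.

Definition cycle_vector (e : {set 'I_17}) : 'rV['F_3]_15 :=
  vector3 (cycle_entry (code e)).

Lemma code_simplex s : labels s -> sorted ltn s -> code (simplex s) = s.
Proof.
move=> ls ss; apply: (irr_sorted_eq ltn_trans ltnn) => //.
  have : sorted ltn (map val (enum 'I_17)) by rewrite val_enum_ord iota_ltn_sorted.
  rewrite /code !sorted_map; apply: subseq_sorted => [x y z|]; first exact: ltn_trans.
  have -> : enum (simplex s) = [seq x <- enum 'I_17 | x \in simplex s].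
    by rewrite /enum_mem -filter_predI; apply: eq_filter => x; rewrite /= andbT.
  by rewrite -?enumT; exact: filter_subseq.
move=> x; apply/mapP/idP => [[i]|xs].
  by rewrite mem_enum in_simplex // => is_ ->.
have xl : x < 17 by exact: (allP ls).
by exists (label x); rewrite ?val_label // mem_enum in_simplex // val_label.
Qed.

(** The signs of the twist are not recorded: any relation between the three vectors with nonzero
    coefficients will do. *)
Definition dependent3 (u v w : seq nat) : bool :=
  has (fun cd : nat * nat =>
    all (fun j => 3 %| nth 0 u j + cd.1 * nth 0 v j + cd.2 * nth 0 w j) (iota 0 15))
    [:: (1, 1); (1, 2); (2, 1); (2, 2)].

Definition triangle_dependent (t : seq nat) : bool :=
  if t is [:: a; b; c] then
    [&& a < b, b < c, c < 17 &
    dependent3 (cycle_entry [:: a; b]) (cycle_entry [:: a; c]) (cycle_entry [:: b; c])]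
  else false.

Lemma triangles_dependent : all triangle_dependent (triangles facets_ball).
Proof. by vm_compute. Qed.

Local Open Scope ring_scope.

Lemma dependent3P (u v w : seq nat) : dependent3 u v w ->
  exists c d : 'F_3, [/\ c != 0, d != 0 &
    vector3 u + c *: vector3 v + d *: vector3 w = 0].
Proof.
case/hasP => -[c d] cd /allP h; exists c%:R, d%:R.
have nz x : x \in [:: 1%N; 2%N] -> (x%:R : 'F_3) != 0.
  by rewrite !inE => /orP[] /eqP ->.
have [c12 d12] : c \in [:: 1%N; 2%N] /\ d \in [:: 1%N; 2%N].
  by move: cd; rewrite !inE => /or4P[] /eqP[-> ->].
split; [exact: nz | exact: nz |].
rewrite /vector3; apply/rowP => j; rewrite !mxE -!natrM -!natrD.
have /h /dvdnP[q ->] : (j : nat) \in iota 0 15 by rewrite mem_iota ltn_ord.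
by rewrite natrM (_ : 3%:R = 0 :> 'F_3) ?mulr0 //; apply/val_inj.
Qed.

Lemma relation3 (k : fieldType) (W : lmodType k) (u v w : W) (c d : k) :
  c != 0 -> d != 0 -> u + c *: v + d *: w = 0 ->
  [/\ exists x y, u = x *: v + y *: w, exists x y, v = x *: u + y *: w
    & exists x y, w = x *: u + y *: v].
Proof.
move=> c0 d0 /eqP rel; split.
- by exists (- c), (- d); move: rel; rewrite -addrA addr_eq0 opprD !scaleNr => /eqP.
- exists (- c^-1), (- (c^-1 * d)); apply: (scalerI c0).
  rewrite scalerDr !scalerA !mulrN mulrA divff // !scaleNr scale1r mul1r.
  by move: rel; rewrite addrAC addrC addr_eq0 opprD => /eqP.
- exists (- d^-1), (- (d^-1 * c)); apply: (scalerI d0).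
  rewrite scalerDr !scalerA !mulrN mulrA divff // !scaleNr scale1r mul1r.
  by move: rel; rewrite addrC addr_eq0 opprD => /eqP.
Qed.

Lemma tetrahedra_uniq F s : tetrahedra F -> s \in F -> uniq s.
Proof. by case/andP => /allP tF _ /tF /and3P[]. Qed.

Lemma triangle_closed_ball : triangle_closed cycle_vector B15_66.
Proof.
have span3 (e f g t : {set 'I_17}) : f \subset t -> g \subset t ->
    #|f| = 2%N -> #|g| = 2%N -> f != e -> g != e ->
    (exists c d : 'F_3, cycle_vector e = c *: cycle_vector f + d *: cycle_vector g) ->
    spanned_in cycle_vector t e.
  move=> ft gt f2 g2 fe ge [c [d eE]]; rewrite /spanned_in eE.
  have mem (h : {set 'I_17}) : h \subset t -> #|h| = 2%N -> h != e -> forall c, c *: cycle_vector h \in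
      (\sum_(e' : {set 'I_17} | [&& e' \subset t, #|e'| == 2%N & e' != e]) <[cycle_vector e']>)%VS.
    move=> ht h2 he c'; rewrite (bigD1 h) ?ht ?h2 ?eqxx ?he //=.
    by apply: (subvP (addvSl _ _)); rewrite memvZ ?memv_line.
  by apply: memvD; exact: mem.
move=> t e; rewrite B15_66_E in_cplx => /andP[_ /hasP[s sF ts]] t3 et e2.
have ls := allP labels_facets_ball _ sF.
have us := tetrahedra_uniq tetrahedra_ball sF.
have tE := sub_filter ls ts; set u := [seq x <- s | label x \in t] in tE.
have : u \in triangles facets_ball.
  rewrite mem_undup; apply/flatten_mapP; exists s => //.
  rewrite mem_filter filter_subseqs andbT -card_simplex ?tE ?t3 ?filter_uniq //.
  by apply: labels_subseq ls; exact: filter_subseq.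
move/(allP triangles_dependent); rewrite -{}tE {ts t3} in et *.
case: u et => [|a [|b [|c [|]]]] //= et /and4P[ab bc cl dep].
have bl : (b < 17)%N := ltn_trans bc cl.
have al : (a < 17)%N := ltn_trans ab bl.
have ac := ltn_trans ab bc.
set eab := simplex [:: a; b]; set eac := simplex [:: a; c]; set ebc := simplex [:: b; c].
set T := simplex [:: a; b; c] in et *.
have [cab cac cbc] : [/\ code eab = [:: a; b], code eac = [:: a; c] & code ebc = [:: b; c]].
  by split; apply: code_simplex; rewrite /= ?al ?bl ?cl ?ab ?ac ?bc.
have [nab nac nbc] : [/\ #|eab| = 2%N, #|eac| = 2%N & #|ebc| = 2%N].
  by split; rewrite card_simplex //= ?inE ?al ?bl ?cl // ltn_eqF.
have [sab sac sbc] : [/\ eab \subset T, eac \subset T & ebc \subset T].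
  by split; rewrite simplex_sub //= ?inE ?al ?bl ?cl ?eqxx ?orbT.
have [d1 d2 d3] : [/\ eab != eac, eab != ebc & eac != ebc].
  split; apply/eqP => /(congr1 code); rewrite ?cab ?cac ?cbc => -[].
  - by move=> e'; rewrite e' ltnn in bc.
  - by move=> e'; rewrite e' ltnn in ab.
  - by move=> e'; rewrite e' ltnn in ab.
have [d1' d2' d3'] : [/\ eac != eab, ebc != eab & ebc != eac].
  by rewrite eq_sym d1 eq_sym d2 eq_sym d3.
rewrite -cab -cac -cbc in dep.
have [c1 [c2 [c10 c20 rel]]] := dependent3P dep.
have : e \in [:: eab; eac; ebc].
  have le : labels [:: a; b; c] by rewrite /= al bl cl.
  have ue : uniq [:: a; b; c] by rewrite /= !inE !ltn_eqF.
  have eE := sub_filter le et.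
  have : size [seq x <- [:: a; b; c] | label x \in e] = 2%N.
    rewrite -card_simplex ?eE ?filter_uniq //.
    by apply: labels_subseq le; exact: filter_subseq.
  rewrite -[X in X \in _]eE /=.
  by case: ifP => _ /=; case: ifP => _ /=; case: ifP => _ //= _; rewrite !inE eqxx ?orbT.
have [r1 r2 r3] := relation3 c10 c20 rel.
rewrite !inE => /or3P[] /eqP ->.
- exact: (span3 _ _ _ _ sac sbc nac nbc d1' d2' r1).
- exact: (span3 _ _ _ _ sab sbc nab nbc d1 d3' r2).
- exact: (span3 _ _ _ _ sab sac nab nac d2 d3 r3).
Qed.

Definition unit_entry (j : nat) : seq nat := [seq nat_of_bool (i == j) | i <- iota 0 15].

(** The basis of the cocycles is chosen so that some edge has each vector of the standard basis;
    this makes the dimension of the span evident. *)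
Lemma unit_entries : all (fun j => has (fun p =>
    [&& p.2 == unit_entry j, has (sub p.1) facets_ball, labels p.1, sorted ltn p.1,
        size p.1 == 2%N & cycle_entry p.1 == p.2])
  cycle_table) (iota 0 15).
Proof. by vm_compute. Qed.

Lemma edge_span_full : edge_span cycle_vector B15_66 = fullv.
Proof.
apply/eqP; rewrite eqEsubv subvf; apply/subvP => v _.
rewrite [v]row_sum_delta; apply: memv_suml => j _; apply: memvZ.
have /(allP unit_entries) /hasP[[s r] _] : (j : nat) \in iota 0 15 by rewrite mem_iota ltn_ord.
move=> /andP[/eqP rE /and4P[sF ls ss /andP[/eqP s2 /eqP ce]]].
have {}sF : has (sub s) facets_ball := sF.
have {}ls : labels s := ls.
have {}s2 : size s = 2%N := s2.
have {}ce : cycle_entry s = unit_entry j := etrans ce rE.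
have -> : delta_mx 0 j = cycle_vector (simplex s).
  by apply/rowP => i; rewrite !mxE code_simplex // ce (nth_map 0%N) ?size_iota // nth_iota.
rewrite B15_66_E /edge_span (bigD1 (simplex s)) /=.
  by apply: (subvP (addvSl _ _)); exact: memv_line.
rewrite in_faces (in_cplx_simplex labels_facets_ball ls) sF /nilp s2.
rewrite card_simplex ?s2 //.
exact: sorted_uniq ltn_trans ltnn _ ss.
Qed.

Theorem not_collapsible_ball : ~ collapsible B15_66.
Proof.
move/(collapsible_edge_span (cplx_complex _) triangle_closed_ball).
by rewrite edge_span_full card_vertices_ball dimvf /dim /= mul1n ltnn.
Qed.

From mathcomp Require Import all_classical all_reals all_analysis.

Import Order.TTheory GRing.Theory Num.Theory.
Import numFieldNormedType.Exports.
Local Open Scope classical_set_scope.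
Local Open Scope ring_scope.

(** * Continuity *)

Lemma ctsc (T U : topologicalType) (c : U) : continuous (fun _ : T => c).
Proof. exact: cst_continuous. Qed.

Section Continuity.
Variables (R : realType) (T : topologicalType).
Implicit Types f g : T -> R.

Lemma ctsD f g : continuous f -> continuous g -> continuous (fun x => f x + g x).
Proof. by move=> cf cg x; apply: continuousD; [exact: cf | exact: cg]. Qed.

Lemma ctsN f : continuous f -> continuous (fun x => - f x).
Proof. by move=> cf x; apply: continuousN; exact: cf. Qed.

Lemma ctsB f g : continuous f -> continuous g -> continuous (fun x => f x - g x).
Proof. by move=> cf cg; apply: ctsD => //; exact: ctsN. Qed.

Lemma ctsM f g : continuous f -> continuous g -> continuous (fun x => f x * g x).
Proof. by move=> cf cg x; apply: continuousM; [exact: cf | exact: cg]. Qed.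

Lemma ctsV f : (forall x, f x != 0) -> continuous f -> continuous (fun x => (f x)^-1).
Proof. by move=> f0 cf x; apply: continuousV; [exact: f0 | exact: cf]. Qed.

Lemma cts_min f g : continuous f -> continuous g -> continuous (fun x => Num.min (f x) (g x)).
Proof. by move=> cf cg x; apply: (@continuous_min R T f g x); [exact: cf | exact: cg]. Qed.

Lemma cts_max f g : continuous f -> continuous g -> continuous (fun x => Num.max (f x) (g x)).
Proof. by move=> cf cg x; apply: (@continuous_max R T f g x); [exact: cf | exact: cg]. Qed.

Lemma cts_sqrt f : continuous f -> continuous (fun x => Num.sqrt (f x)).
Proof. by move=> cf x; apply: (continuous_comp (cf x)); exact: sqrt_continuous. Qed.

Lemma cts_norm f : continuous f -> continuous (fun x => `|f x|).
Proof. by move=> cf x; apply: (continuous_comp (cf x)); exact: norm_continuous. Qed.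

Lemma cts_sum (I : Type) (r : seq I) (P : pred I) (F : I -> T -> R) :
  (forall i, continuous (F i)) -> continuous (fun x => \sum_(i <- r | P i) F i x).
Proof.
move=> cF; elim: r => [|i r IH].
  by rewrite (_ : (fun _ => _) = fun=> 0); [exact: ctsc | apply/funext => x; rewrite big_nil].
rewrite (_ : (fun _ => _) = fun x => (if P i then F i x else 0) + \sum_(i <- r | P i) F i x).
  by apply: ctsD => //; case: (P i); [exact: cF | exact: ctsc].
by apply/funext => x; rewrite big_cons; case: (P i); rewrite ?add0r.
Qed.

Lemma cts_row n (F : T -> 'rV[R]_n) :
  (forall j, continuous (fun x => F x ord0 j)) -> continuous F.
Proof.
move=> cF x; apply/cvg_ballP => e e0.
have near_all : nbhs x [set y | forall j, ball (F x ord0 j) e (F y ord0 j)].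
  apply: (@filter_forall _ _ (fun j => [set y | ball (F x ord0 j) e (F y ord0 j)])) => j.
  have /cvg_ballP h := cF j x.
  exact: h e e0.
by apply: filterS near_all => y Fy; split=> // i j; rewrite ord1; exact: Fy.
Qed.

Lemma cts_coord n (F : T -> 'rV[R]_n) j :
  continuous F -> continuous (fun x => F x ord0 j).
Proof.
move=> cF x; apply: (@continuous_comp _ _ _ F (fun M : 'rV[R]_n => M ord0 j)); first exact: cF.
exact: coord_continuous.
Qed.

Lemma cts_scale n (f : T -> R) (F : T -> 'rV[R]_n) :
  continuous f -> continuous F -> continuous (fun x => f x *: F x).
Proof. by move=> cf cF x; apply: continuousZ; [exact: cf | exact: cF]. Qed.

Lemma cts_add n (F G : T -> 'rV[R]_n) :
  continuous F -> continuous G -> continuous (fun x => F x + G x).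
Proof. by move=> cF cG x; apply: continuousD; [exact: cF | exact: cG]. Qed.

Lemma cts_if (b : bool) (U : topologicalType) (f g : T -> U) : continuous f -> continuous g ->
  continuous (fun x => if b then f x else g x).
Proof. by case: b. Qed.
End Continuity.

Lemma cts_comp (T U V : topologicalType) (f : T -> U) (g : U -> V) :
  continuous f -> continuous g -> continuous (fun x => g (f x)).
Proof. by move=> cf cg x; apply: (continuous_comp (cf x)); exact: cg. Qed.

Lemma cts_id (T : topologicalType) : continuous (fun x : T => x).
Proof. by move=> x; exact: cvg_id. Qed.

Lemma cts_fst (T U : topologicalType) : continuous (fun p : T * U => p.1).
Proof. by move=> [x y]; exact: cvg_fst. Qed.

Lemma cts_snd (T U : topologicalType) : continuous (fun p : T * U => p.2).
Proof. by move=> [x y]; exact: cvg_snd. Qed.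

Lemma cts_pair (S T U : topologicalType) (f : S -> T) (g : S -> U) :
  continuous f -> continuous g -> continuous (fun x => (f x, g x)).
Proof. by move=> cf cg x; apply: cvg_pair; [exact: cf | exact: cg]. Qed.

(** * Homeomorphisms given by globally continuous maps *)

Section Homeo.
Variables (T U V : topologicalType).

(** Continuity on the whole space, rather than on A and B, lets such maps be composed and
    restricted without subspace topologies. *)
Definition mutually_inverse (A : set T) (B : set U) (f : T -> U) (g : U -> T) :=
  [/\ continuous f, continuous g,
      (forall x, A x -> B (f x)) /\ (forall y, B y -> A (g y)),
      (forall x, A x -> g (f x) = x) & (forall y, B y -> f (g y) = y)].

Lemma mutually_inverse_homeo A B f g :
  mutually_inverse A B f g -> homeomorphism A B f.
Proof.
by case=> cf cg AB fg gf; exists g; split=> //; exact: continuous_subspaceT.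
Qed.
End Homeo.

Lemma mutually_inverse_comp (T U V : topologicalType) (A : set T) (B : set U) (C : set V)
    f g f' g' :
  mutually_inverse A B f g -> mutually_inverse B C f' g' ->
  mutually_inverse A C (f' \o f) (g \o g').
Proof.
move=> [cf cg [AB BA] fg gf] [cf' cg' [BC CB] fg' gf']; split.
- exact: cts_comp.
- exact: cts_comp.
- by split=> x /=; [move/AB/BC | move/CB/BA].
- by move=> x Ax /=; rewrite fg' ?fg //; exact: AB.
- by move=> x Ax /=; rewrite gf ?gf' //; exact: CB.
Qed.

Lemma mutually_inverse_sym (T U : topologicalType) (A : set T) (B : set U) f g :
  mutually_inverse A B f g -> mutually_inverse B A g f.
Proof. by case=> cf cg [AB BA] fg gf; split. Qed.

Lemma mutually_inverse_id (T : topologicalType) (A : set T) : mutually_inverse A A id id.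
Proof. by split=> //; exact: cts_id. Qed.

(** * Isotopies *)

Section Isotopy.
Variable R : realType.
Notation space := 'rV[R]_3.
Implicit Types (K L : set space).

(** A variant of ambient isotopy with global continuity. It is transitive and symmetric by
    composing the maps, with no smoothing in time, as the time parameter only has to be
    continuous. *)
Definition isotopic K L : Prop :=
  exists H : R -> space -> space,
    [/\ continuous (fun p : R * space => H p.1 p.2),
        forall t, 0 <= t <= 1 -> exists g, mutually_inverse setT setT (H t) g,
        forall x, H 0 x = x
      & H 1 @` K = L].

Lemma isotopic_ambient K L : isotopic K L -> ambient_isotopic K L.
Proof.
case=> H [cH Hh H0 HK]; exists H; split=> //; first exact: continuous_subspaceT.
by move=> t /Hh[g] /mutually_inverse_homeo.
Qed.

Lemma isotopic_refl K : isotopic K K.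
Proof.
exists (fun _ x => x); split=> //; first exact: cts_snd.
  by move=> t _; exists id; exact: mutually_inverse_id.
by rewrite image_id.
Qed.

Lemma isotopic_trans L K (M : set space) : isotopic K L -> isotopic L M -> isotopic K M.
Proof.
case=> H [cH Hh H0 HK] [H' [cH' Hh' H0' HL]].
exists (fun t x => H' t (H t x)); split.
- apply: (@cts_comp _ _ _ (fun p : R * space => (p.1, H p.1 p.2))
    (fun p : R * space => H' p.1 p.2)) => //.
  by apply: cts_pair => //; exact: cts_fst.
- move=> t t01; have [g hg] := Hh t t01; have [g' hg'] := Hh' t t01.
  by exists (g \o g'); exact: mutually_inverse_comp hg hg'.
- by move=> x; rewrite H0 H0'.
- by rewrite -HL -HK image_comp.
Qed.

(** If H ends at h, the isotopy from L to K is H_(1-t) after the inverse of h. *)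
Lemma isotopic_sym K L : isotopic K L -> isotopic L K.
Proof.
case=> H [cH Hh H0 HK].
have [g hg] : exists g, mutually_inverse setT setT (H 1) g by apply: Hh; lra.
have [c1 cg _ gH Hg] := hg.
exists (fun t x => H (1 - t) (g x)); split.
- apply: (@cts_comp _ _ _ (fun p : R * space => (1 - p.1, g p.2))
    (fun p : R * space => H p.1 p.2)) => //.
  apply: cts_pair; first by apply: ctsB; [exact: ctsc | exact: cts_fst].
  by apply: cts_comp cg; exact: cts_snd.
- move=> t t01; have [g' hg'] : exists g, mutually_inverse setT setT (H (1 - t)) g.
    by apply: Hh; lra.
  exists (H 1 \o g'); exact: mutually_inverse_comp (mutually_inverse_sym hg) hg'.
- by move=> x; rewrite subr0 Hg.
- rewrite -HK; apply/seteqP; split=> [_ [_ [z Kz <-] <-]|x Kx] /=.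
    by rewrite subrr H0 gH.
  by exists (H 1 x); [exists x | rewrite subrr H0 gH].
Qed.

Lemma isotopic_translation K (w : space) : isotopic K ((fun x => x + w) @` K).
Proof.
have ct1 (s : R) : continuous (fun x : space => x + s *: w).
  by apply: cts_add; [exact: cts_id | exact: ctsc].
exists (fun t x => x + t *: w); split.
- apply: (@cts_add R _ 3 (fun p : R * space => p.2) (fun p => p.1 *: w)); first exact: cts_snd.
  apply: (@cts_scale R _ 3 (fun p : R * space => p.1) (fun=> w)); last exact: ctsc.
  exact: cts_fst.
- move=> t _; exists (fun x => x + (- t) *: w); split=> // x _.
    by rewrite scaleNr addrK.
  by rewrite scaleNr subrK.
- by move=> x; rewrite scale0r addr0.
- by congr (_ @` K); apply/funext => x; rewrite scale1r.
Qed.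

(** ** Vertex moves *)

Notation form := (space * R)%type.
Implicit Types (M : form) (g : seq form).

Definition ev (M : form) (x : space) : R := \sum_k M.1 ord0 k * x ord0 k + M.2.

Lemma ev_add M x s v : ev M (x + s *: v) = ev M x + s * (ev M v - M.2).
Proof.
rewrite /ev addrK mulr_sumr addrAC -big_split /=; congr (_ + _).
by apply: eq_bigr => k _; rewrite !mxE; ring.
Qed.

Lemma ev_seg M s p q : ev M ((1 - s) *: p + s *: q) = (1 - s) * ev M p + s * ev M q.
Proof.
rewrite ev_add [in LHS](_ : (1 - s) *: p = p + (- s) *: p); last first.
  by rewrite scalerBl scale1r scaleNr.
by rewrite ev_add; ring.
Qed.

Lemma cts_ev M : continuous (ev M).
Proof.
apply: ctsD; last exact: ctsc.
apply: cts_sum => k; apply: ctsM; first exact: ctsc.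
by apply: cts_coord; exact: cts_id.
Qed.

(** A lattice polynomial in the forms, truncated to values from 0 to 1: the maximum over the
    groups of the minimum over each group. *)
Definition lattice (F : form -> R) (G : seq (seq form)) : R :=
  foldr Num.max 0 [seq foldr Num.min 1 (map F g) | g <- G].

Definition same_side (c p q : R) := ((c <= p) = (c <= q)) /\ ((p <= c) = (q <= c)).

Lemma same_side_min c p q p' q' : same_side c p q -> same_side c p' q' ->
  same_side c (Num.min p p') (Num.min q q').
Proof. by move=> [h1 h2] [h3 h4]; split; rewrite ?le_min ?ge_min ?h1 ?h2 ?h3 ?h4. Qed.

Lemma same_side_max c p q p' q' : same_side c p q -> same_side c p' q' ->
  same_side c (Num.max p p') (Num.max q q').
Proof. by move=> [h1 h2] [h3 h4]; split; rewrite ?le_max ?ge_max ?h1 ?h2 ?h3 ?h4. Qed.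

(** The value c of the truncated polynomial does not change when its entries change without
    crossing c, because it is built from minima and maxima. This is how the inverse of a bump is
    verified without solving for it. *)
Lemma lattice_eq (F F' : form -> R) (G : seq (seq form)) c :
  (forall g M, g \in G -> M \in g -> same_side c (F M) (F' M)) ->
  lattice F G = c -> lattice F' G = c.
Proof.
move=> side.
have : same_side c (lattice F G) (lattice F' G).
  elim: G side => [|g G IH] side //=; apply: same_side_max.
    have : forall M, M \in g -> same_side c (F M) (F' M).
      by move=> M; apply: side; rewrite inE eqxx.
    elim: g {side} => //= M g IHg side; apply: same_side_min.
      by apply: side; rewrite inE eqxx.
    by apply: IHg => M' M'g; apply: side; rewrite inE M'g orbT.
  by apply: IH => h M hG; apply: side; rewrite inE hG orbT.
by move=> [h1 h2] e; apply/le_anti; rewrite -h1 -h2 e lexx.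
Qed.

Lemma lattice_le F (G : seq (seq form)) c : 0 <= c ->
  (forall g, g \in G -> exists2 M, M \in g & F M <= c) -> lattice F G <= c.
Proof.
move=> c0 h; rewrite /lattice; elim: G h => //= g G IH h; rewrite ge_max IH ?andbT.
  have [M Mg Mc] := h g (mem_head _ _).
  elim: g Mg {h} => //= N g IHg; rewrite inE ge_min => /orP[/eqP <-|/IHg ->].
    by rewrite Mc.
  by rewrite orbT.
by move=> g' g'G; apply: h; rewrite inE g'G orbT.
Qed.

Lemma lattice_ge0 F (G : seq (seq form)) : 0 <= lattice F G.
Proof. by rewrite /lattice; elim: G => //= g G IH; rewrite le_max IH orbT. Qed.

Lemma lattice_ge F (G : seq (seq form)) c g : c <= 1 -> g \in G -> (forall M, M \in g -> c <= F M) ->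
  c <= lattice F G.
Proof.
move=> c1; rewrite /lattice; elim: G => //= h G IH; rewrite inE le_max.
case/orP => [/eqP <- {h IH} gc|gG gc]; last by rewrite IH ?orbT.
apply/orP; left; elim: g gc => //= M g IH gc; rewrite le_min gc ?mem_head //=.
by apply: IH => N Ng; apply: gc; rewrite inE Ng orbT.
Qed.

Lemma cts_lattice (T : topologicalType) (F : T -> form -> R) (G : seq (seq form)) :
  (forall M, continuous (fun x => F x M)) -> continuous (fun x => lattice (F x) G).
Proof.
move=> cF; rewrite /lattice; elim: G => [|g G IH] /=; first exact: ctsc.
apply: cts_max => //; elim: g => [|M g IHg] /=; first exact: ctsc.
exact: cts_min.
Qed.

Variables (a b : space) (G : seq (seq form)).
Hypothesis Gab : forall g M, g \in G -> M \in g -> 0 < ev M a /\ 0 < ev M b.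

Let v := b - a.
(** Equal to 1 at a, affine on the two edges at a, and 0 on the rest of the polygon when the
    certificate is valid. The forms are normalized to be 1 at a. *)
Definition bump (x : space) : R := lattice (fun M => ev M x / ev M a) G.
Let slope M := (ev M v - M.2) / ev M a.
Let unbump t (y : space) : R := lattice (fun M => ev M y / ev M a / (1 + t * slope M)) G.

Let slope_gt g M t : 0 <= t <= 1 -> g \in G -> M \in g -> 0 < 1 + t * slope M.
Proof.
move=> t01 gG Mg; have [a0 b0] := Gab gG Mg.
have -> : 1 + t * slope M = ((1 - t) * ev M a + t * ev M b) / ev M a.
  have -> : ev M b = ev M a + 1 * (ev M v - M.2) by rewrite -ev_add scale1r addrC subrK.
  by rewrite /slope; field; rewrite gt_eqF.
rewrite divr_gt0 //; case/andP: t01 => t0 t1.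
have [->|tn0] := eqVneq t 0; first by lra.
have {t0 tn0} t0 : 0 < t by rewrite lt_neqAle eq_sym tn0.
by apply: ltr_wpDl; [apply: mulr_ge0; [lra | exact: ltW] | exact: mulr_gt0].
Qed.

Let ev_move M x s : ev M (x + s *: v) / ev M a = ev M x / ev M a + s * slope M.
Proof. by rewrite ev_add /slope; ring. Qed.

Let bump_side t c g M (x : space) : 0 <= t <= 1 -> g \in G -> M \in g ->
  same_side c (ev M x / ev M a) (ev M (x + (t * c) *: v) / ev M a / (1 + t * slope M)).
Proof.
move=> t01 gG Mg; have k0 := slope_gt t01 gG Mg; rewrite ev_move.
move: (slope M) (ev M x / ev M a) k0 => k X k0.
have e1 : (c * (1 + t * k) <= X + t * c * k) = (c <= X).
  by rewrite mulrDr mulr1 mulrA (mulrC c t) lerD2r.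
have e2 : (X + t * c * k <= c * (1 + t * k)) = (X <= c).
  by rewrite mulrDr mulr1 mulrA (mulrC c t) lerD2r.
by split; rewrite ?ler_pdivlMr // ?ler_pdivrMr // ?e1 ?e2.
Qed.

(** Along the line through x in the direction v, each normalized form has a slope greater than
    -1/t, as it is positive at b, so that x + t bump(x) v is injective; the inverse is again given
    by a lattice polynomial, of the forms rescaled by their slopes. *)
Lemma bump_isotopic K : isotopic K ((fun x => x + bump x *: (b - a)) @` K).
Proof.
have cb : continuous bump.
  apply: (@cts_lattice _ (fun x M => ev M x / ev M a)) => M.
  by apply: ctsM; [exact: cts_ev | exact: ctsc].
have cu t : continuous (unbump t).
  apply: (@cts_lattice _ (fun x M => ev M x / ev M a / (1 + t * slope M))) => M.
  by apply: ctsM; [apply: ctsM; [exact: cts_ev | exact: ctsc] | exact: ctsc].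
exists (fun t x => x + (t * bump x) *: v); split.
- apply: cts_add; first exact: cts_snd.
  apply: cts_scale; last exact: ctsc.
  by apply: ctsM; [exact: cts_fst | apply: (cts_comp _ cb); exact: cts_snd].
- move=> t t01; exists (fun y => y + (- (t * unbump t y)) *: v); split=> //.
  + apply: cts_add; first exact: cts_id.
    by apply: cts_scale; [apply: ctsM => //; exact: ctsc | exact: ctsc].
  + apply: cts_add; first exact: cts_id.
    by apply: cts_scale; [apply: ctsN; apply: ctsM => //; exact: ctsc | exact: ctsc].
  + move=> x _; have -> : unbump t (x + (t * bump x) *: v) = bump x.
      apply: (@lattice_eq (fun M => ev M x / ev M a)) => // g M gG Mg.
      exact: bump_side t01 gG Mg.
    by rewrite scaleNr addrK.
  + move=> y _; set c := unbump t y; rewrite scaleNr.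
    have -> : bump (y - (t * c) *: v) = c.
      apply: (@lattice_eq (fun M => ev M y / ev M a / (1 + t * slope M))) => // g M gG Mg.
      have := bump_side c (y - (t * c) *: v) t01 gG Mg.
      by rewrite subrK => -[e1 e2]; split.
    by rewrite subrK.
- by move=> x; rewrite mul0r scale0r addr0.
- by congr (_ @` K); apply/funext => x; rewrite mul1r.
Qed.

(** The bump is 0 at p but is not cut off on the segments from p to a: one group of forms is
    nonnegative at p. *)
Definition touches (p : space) : Prop :=
  (exists2 g, g \in G & forall M, M \in g -> 0 <= ev M p) /\
  (forall g, g \in G -> exists2 M, M \in g & ev M p <= 0).

(** On the segment from p to a each form of the good group is at least s, and every group has a
    form that is at most s, since normalized forms are affine with value 1 at a. *)
Lemma bump_seg p s : touches p -> 0 <= s <= 1 -> bump ((1 - s) *: p + s *: a) = s.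
Proof.
move=> [[g gG gp] pG] /andP[s0 s1]; apply/le_anti/andP; split.
  apply: lattice_le => // h hG; have [M Mh Mp] := pG h hG; exists M => //.
  have [a0 _] := Gab hG Mh; rewrite ler_pdivrMr // ev_seg gerDr.
  by rewrite mulr_ge0_le0 // subr_ge0.
apply: (lattice_ge s1 gG) => M Mg; have [a0 _] := Gab gG Mg.
by rewrite ler_pdivlMr // ev_seg lerDr mulr_ge0 ?gp // subr_ge0.
Qed.

Lemma vertex_move_segment p : touches p ->
  (fun x => x + bump x *: (b - a)) @` segment p a = segment p b.
Proof.
move=> tp; have e s : 0 <= s <= 1 ->
    (1 - s) *: p + s *: a + bump ((1 - s) *: p + s *: a) *: (b - a) = (1 - s) *: p + s *: b.
  by move=> s01; rewrite bump_seg // -addrA -scalerDr [a + _]addrC subrK.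
apply/seteqP; split=> [_ [_ [s s01 <-] <-]|_ [s s01 <-]].
  by exists s => //; rewrite e.
by exists ((1 - s) *: p + s *: a); [exists s | rewrite e].
Qed.

(** The bump is affine on the two segments at a, so these go to segments at b, and it vanishes on
    the rest. *)
Lemma vertex_move p q (rest : set space) : touches p -> touches q ->
  (forall x, rest x -> forall g, g \in G -> exists2 M, M \in g & ev M x <= 0) ->
  isotopic (segment p a `|` segment q a `|` rest) (segment p b `|` segment q b `|` rest).
Proof.
move=> tp tq out; have := bump_isotopic (segment p a `|` segment q a `|` rest).
rewrite !image_setU !vertex_move_segment //.
have fix_rest x : rest x -> x + bump x *: (b - a) = x.
  move=> rx; suff -> : bump x = 0 by rewrite scale0r addr0.
  apply/le_anti/andP; split; last first.
    exact: lattice_ge0.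
  apply: lattice_le => // g gG; have [M Mg Mx] := out x rx g gG; exists M => //.
  by have [a0 _] := Gab gG Mg; rewrite ler_pdivrMr // mul0r.
suff -> : (fun x => x + bump x *: (b - a)) @` rest = rest by [].
apply/seteqP; split=> [_ [x rx <-]|x rx]; first by rewrite fix_rest.
by exists x; rewrite ?fix_rest.
Qed.
End Isotopy.

(** * Polygons *)

Section Segments.
Variables (R : realType) (n : nat).
Notation space := 'rV[R]_n.
Implicit Types (p q r : space) (s : seq space).

Definition seg p q : set space := [set (1 - t) *: p + t *: q | t in `[0, 1]].

Lemma segP p q x :
  seg p q x <-> exists2 t : R, 0 <= t <= 1 & (1 - t) *: p + t *: q = x.
Proof. by split=> -[t /= t01 e]; exists t => //=; move: t01; rewrite in_itv. Qed.

Lemma seg_sym p q : seg p q = seg q p.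
Proof.
have H u v : seg u v `<=` seg v u.
  move=> x /segP[t /andP[t0 t1] <-]; apply/segP; exists (1 - t).
    by apply/andP; split; lra.
  by rewrite subKr addrC.
by apply/seteqP; split; exact: H.
Qed.

Lemma seg_left p q : seg p q p.
Proof.
by apply/segP; exists 0; rewrite ?lexx ?ler01 // subr0 scale1r scale0r addr0.
Qed.

Lemma seg_right p q : seg p q q.
Proof. by rewrite seg_sym; exact: seg_left. Qed.

Lemma seg_split p q r : seg p q r -> seg p q = seg p r `|` seg r q.
Proof.
case/segP => u /andP[u0 u1] ru; apply/seteqP; split.
- move=> x /segP[t /andP[t0 t1] <-].
  have [tu|ut] := leP t u.
    left; have [e|u_neq0] := eqVneq u 0.
      have -> : t = 0 by apply/le_anti; rewrite t0 -e tu.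
      by rewrite subr0 scale1r scale0r addr0; exact: seg_left.
    have u0' : 0 < u by rewrite lt_neqAle eq_sym u_neq0.
    apply/segP; exists (t / u).
      by rewrite divr_ge0 //= ler_pdivrMr ?mul1r.
    rewrite -ru scalerDr !scalerA addrA -scalerDl; congr (_ *: _ + _ *: _); by field.
  right; have u1' : 0 < 1 - u by lra.
  apply/segP; exists ((t - u) / (1 - u)).
    by rewrite divr_ge0 ?subr_ge0 ?(ltW ut) //= ler_pdivrMr ?mul1r //; lra.
  rewrite -ru scalerDr !scalerA -addrA -scalerDl.
  by congr (_ *: _ + _ *: _); field; rewrite gt_eqF.
- move=> x [] /segP[t /andP[t0 t1] <-]; apply/segP.
    exists (t * u); first by rewrite mulr_ge0 //= mulr_ile1.
    rewrite -ru scalerDr !scalerA addrA -scalerDl; congr (_ *: _ + _ *: _); ring.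
  exists (u + t * (1 - u)); first by apply/andP; split; nra.
  rewrite -ru scalerDr !scalerA -addrA -scalerDl; congr (_ *: _ + _ *: _); ring.
Qed.

Fixpoint chain p s : set space :=
  if s is q :: s' then seg p q `|` chain q s' else set0.

Definition polygon s : set space :=
  \bigcup_(pq in [set` zip s (rot 1 s)]) seg pq.1 pq.2.

Lemma bigcup_seq (T U : eqType) (s : seq T) (F : T -> set U) x :
  (\bigcup_(i in [set` s]) F i) x <-> exists2 i, i \in s & F i x.
Proof. by split=> -[i]; exists i. Qed.

Lemma polygon_cons p s : polygon (p :: s) = chain p (rcons s p).
Proof.
have H q t r : chain q (rcons t r) =
    \bigcup_(pq in [set` zip (q :: t) (rcons t r)]) seg pq.1 pq.2.
  elim: t q => [|u t IH] q /=.
    by rewrite setU0; apply/seteqP; split=> [x qx|x [pq /=]]; [exists (q, r) => //=; rewrite inE | rewrite inE => /eqP ->].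
  rewrite IH; apply/seteqP; split=> [x [qx|[pq /= pq_ x_]]|x [pq /=]].
  - by exists (q, u) => //=; rewrite inE eqxx.
  - by exists pq => //=; rewrite inE pq_ orbT.
  - by rewrite inE => /orP[/eqP -> ?|pq_ x_]; [left | right; exists pq].
by rewrite /polygon rot1_cons H.
Qed.

Lemma chain_cat p s q t : chain p (s ++ q :: t) = chain p (rcons s q) `|` chain q t.
Proof. by elim: s p => [|r s IH] p /=; rewrite ?setU0 // IH setUA. Qed.

Lemma polygon_rot k s : polygon (rot k s) = polygon s.
Proof.
have rot1_polygon u : polygon (rot 1 u) = polygon u.
  case: u => [|x [|y u]] //; rewrite rot1_cons /= !polygon_cons /=.
  by rewrite -cats1 cat_rcons chain_cat /= setU0 setUC.
elim: k => [|k IH]; first by rewrite rot0.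
have [lt|le] := ltnP k (size s); first by rewrite rotS // rot1_polygon.
by rewrite rot_oversize // ltnW.
Qed.

Lemma chain_last p s x : s != [::] -> x = last p s -> chain p s x.
Proof.
elim: s p => // q s IH p _ /= e; have [s0|s0] := eqVneq s [::].
  by left; rewrite e s0 /=; exact: seg_right.
by right; exact: IH.
Qed.

Lemma chain_head p s : s != [::] -> chain p s p.
Proof. by case: s => // q s _; left; exact: seg_left. Qed.

End Segments.

Section AffineImages.
Variables (R : realType) (m n : nat).

Definition affine_on (f : 'rV[R]_m -> 'rV[R]_n) p q :=
  forall t, 0 <= t <= 1 -> f ((1 - t) *: p + t *: q) = (1 - t) *: f p + t *: f q.

Lemma image_seg f p q : affine_on f p q -> f @` seg p q = seg (f p) (f q).
Proof.
move=> af; apply/seteqP; split=> [_ [x /segP[t t01 <-] <-]|x /segP[t t01 <-]].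
  by apply/segP; exists t => //; rewrite af.
by exists ((1 - t) *: p + t *: q); [apply/segP; exists t | rewrite af].
Qed.

End AffineImages.

(** * Integral homogeneous coordinates *)

Section Homogeneous.
Variable R : realType.

Definition zr (z : Z) : R := (int_of_Z z)%:~R.

Lemma zrD x y : zr (Z.add x y) = zr x + zr y.
Proof. by rewrite /zr -intrD; congr (_%:~R); lia. Qed.

Lemma zrM x y : zr (Z.mul x y) = zr x * zr y.
Proof. by rewrite /zr -intrM; congr (_%:~R); lia. Qed.

Lemma zrN x : zr (Z.opp x) = - zr x.
Proof. by rewrite /zr -intrN; congr (_%:~R); lia. Qed.

Lemma zrB x y : zr (Z.sub x y) = zr x - zr y.
Proof. by rewrite /zr -intrB; congr (_%:~R); lia. Qed.

Lemma zr_le x y : Z.leb x y = (zr x <= zr y).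
Proof. by rewrite /zr ler_int; lia. Qed.

Lemma zr_lt x y : Z.ltb x y = (zr x < zr y).
Proof. by rewrite /zr ltr_int; lia. Qed.

Lemma zr0 : zr Z0 = 0. Proof. by []. Qed.

Definition coordinate (v : seq Z) (i : nat) : Z := nth Z0 v i.

(** The last entry of the list is the weight; all the points that occur are rational, so that
    equalities and signs are decided by integer arithmetic. *)
Definition hpoint n (v : seq Z) : 'rV[R]_n :=
  \row_(i < n) (zr (coordinate v i) / zr (coordinate v n)).

Definition proper n (v : seq Z) : bool := Z.ltb Z0 (coordinate v n).

Lemma proper_gt0 n v : proper n v -> 0 < zr (coordinate v n).
Proof. by rewrite /proper zr_lt. Qed.

Definition hadd (u v : seq Z) : seq Z := [seq Z.add p.1 p.2 | p <- zip u v].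

Definition hscale (c : Z) (u : seq Z) : seq Z := [seq Z.mul c x | x <- u].

Lemma coordinate_hadd u v i : size u = size v ->
  coordinate (hadd u v) i = Z.add (coordinate u i) (coordinate v i).
Proof.
move=> e; rewrite /coordinate /hadd; have [lt|ge] := ltnP i (size u).
  by rewrite (nth_map (Z0, Z0)) ?size_zip -?e ?minnn // nth_zip.
by rewrite !nth_default ?size_map ?size_zip -?e ?minnn.
Qed.

Lemma coordinate_hscale c u i : coordinate (hscale c u) i = Z.mul c (coordinate u i).
Proof.
rewrite /coordinate /hscale; have [lt|ge] := ltnP i (size u).
  by rewrite (nth_map Z0).
by rewrite !nth_default ?size_map // ; lia.
Qed.

Lemma hadd_seg n u v : size u = size v -> proper n u -> proper n v ->
  seg (hpoint n u) (hpoint n v) (hpoint n (hadd u v)).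
Proof.
move=> e /proper_gt0 u0 /proper_gt0 v0; apply/segP.
set U := zr (coordinate u n) in u0 *; set V := zr (coordinate v n) in v0 *.
have UV : 0 < U + V by exact: addr_gt0.
exists (V / (U + V)).
  by rewrite divr_ge0 ?(ltW v0) ?(ltW UV) //= ler_pdivrMr // mul1r lerDr ltW.
apply/rowP => i; rewrite !mxE !coordinate_hadd // !zrD -/U -/V.
by field; rewrite !gt_eqF.
Qed.

Lemma proper_hadd n u v : size u = size v -> proper n u -> proper n v -> proper n (hadd u v).
Proof.
by move=> e; rewrite /proper !zr_lt coordinate_hadd // zrD; exact: addr_gt0.
Qed.

Lemma hpoint_hscale n c u : Z.ltb Z0 c -> hpoint n (hscale c u) = hpoint n u.
Proof.
rewrite zr_lt => c0; apply/rowP => i; rewrite !mxE !coordinate_hscale !zrM.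
by rewrite -mulf_div divff ?mul1r // gt_eqF.
Qed.

Definition hpolygon n (P : seq (seq Z)) : set 'rV[R]_n := polygon (map (hpoint n) P).
Arguments hpolygon : clear implicits.

Definition hchain n p (P : seq (seq Z)) : set 'rV[R]_n :=
  chain (hpoint n p) (map (hpoint n) P).
Arguments hchain : clear implicits.

Lemma hpolygon_cons n p P : hpolygon n (p :: P) = hchain n p (rcons P p).
Proof. by rewrite /hpolygon /= polygon_cons -map_rcons. Qed.

Lemma hpolygon_rot n k P : hpolygon n (rot k P) = hpolygon n P.
Proof. by rewrite /hpolygon map_rot polygon_rot. Qed.

Definition hform (M : seq Z) : 'rV[R]_3 * R :=
  (\row_(i < 3) zr (coordinate M i), zr (coordinate M 3)).

Definition hev (M v : seq Z) : Z :=
  Z.add (Z.add (Z.mul (coordinate M 0) (coordinate v 0)) (Z.mul (coordinate M 1) (coordinate v 1)))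
        (Z.add (Z.mul (coordinate M 2) (coordinate v 2)) (Z.mul (coordinate M 3) (coordinate v 3))).

Lemma hev_ev M v : proper 3 v ->
  zr (hev M v) = zr (coordinate v 3) * ev (hform M) (hpoint 3 v).
Proof.
move=> /proper_gt0 v0; rewrite /ev /hev !zrD !zrM 3!big_ord_recl big_ord0 !mxE /= /bump /=.
by field; rewrite gt_eqF.
Qed.

Lemma hev_gt0 M v : proper 3 v -> Z.ltb Z0 (hev M v) = (0 < ev (hform M) (hpoint 3 v)).
Proof. by move=> pv; rewrite zr_lt hev_ev // zr0 pmulr_rgt0 // proper_gt0. Qed.

Lemma hev_ge0 M v : proper 3 v -> Z.leb Z0 (hev M v) = (0 <= ev (hform M) (hpoint 3 v)).
Proof. by move=> pv; rewrite zr_le hev_ev // zr0 pmulr_rge0 // proper_gt0. Qed.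

Lemma hev_le0 M v : proper 3 v -> Z.leb (hev M v) Z0 = (ev (hform M) (hpoint 3 v) <= 0).
Proof. by move=> pv; rewrite zr_le hev_ev // zr0 pmulr_rle0 // proper_gt0. Qed.

(** * Scripts of vertex moves *)

(** Groups of affine forms on space, each form given by its four coefficients. *)
Definition certificate := seq (seq (seq Z)).

Definition touches_check (G : certificate) (p : seq Z) : bool :=
  has (all (fun M => Z.leb Z0 (hev M p))) G && all (has (fun M => Z.leb (hev M p) Z0)) G.

Definition avoids_check (G : certificate) (r s : seq Z) : bool :=
  all (has (fun M => Z.leb (hev M r) Z0 && Z.leb (hev M s) Z0)) G.

Fixpoint chain_check (G : certificate) (r : seq Z) (P : seq (seq Z)) : bool :=
  if P is s :: P' then avoids_check G r s && chain_check G s P' else true.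

(** The hypotheses of the vertex move, for the polygon with consecutive vertices p, a, q. *)
Definition move_check (p a q : seq Z) (t : seq (seq Z)) (b : seq Z) (G : certificate) : bool :=
  [&& all (all (fun M => Z.ltb Z0 (hev M a) && Z.ltb Z0 (hev M b))) G,
      touches_check G p, touches_check G q & chain_check G q (rcons t p)].

Definition wf (P : seq (seq Z)) : bool := all (fun v => (size v == 4) && proper 3 v) P.

Lemma touches_checkP G p : proper 3 p -> touches_check G p ->
  touches (map (map hform) G) (hpoint 3 p).
Proof.
move=> pp /andP[/hasP[g gG /allP gp] /allP h]; split.
  exists (map hform g); first exact: map_f.
  by move=> _ /mapP[M Mg ->]; rewrite -hev_ge0 // gp.
move=> _ /mapP[g' g'G ->]; have /hasP[M Mg' Mp] := h _ g'G.
by exists (hform M); [exact: map_f | rewrite -hev_le0].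
Qed.

Lemma chain_checkP G q P : proper 3 q -> wf P -> chain_check G q P ->
  forall x, hchain 3 q P x -> forall g, g \in map (map hform) G ->
  exists2 M, M \in g & ev M x <= 0.
Proof.
elim: P q => [|r P IH] q //= pq /andP[/andP[_ pr] wP] /andP[qr rP] x.
move=> [/segP[t /andP[t0 t1] <-]|]; last exact: IH.
move=> _ /mapP[g gG ->]; have /hasP[M Mg /andP[Mq Mr]] := allP qr _ gG.
exists (hform M); first exact: map_f.
rewrite !hev_le0 // in Mq Mr; rewrite ev_seg.
by rewrite -oppr_ge0 opprD -!mulrN addr_ge0 // mulr_ge0 ?oppr_ge0 ?subr_ge0.
Qed.

Lemma move_checkP p a q t b G : wf [:: p, a, q & t] -> proper 3 b ->
  move_check p a q t b G ->
  isotopic (hpolygon 3 [:: p, a, q & t]) (hpolygon 3 [:: p, b, q & t]).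
Proof.
move=> /= /and4P[/andP[sp pp] /andP[_ pa] /andP[_ pq] wt] pb /and4P[/allP Gab Tp Tq ch].
have E c : hpolygon 3 [:: p, c, q & t] =
    seg (hpoint 3 p) (hpoint 3 c) `|` seg (hpoint 3 q) (hpoint 3 c) `|` hchain 3 q (rcons t p).
  by rewrite hpolygon_cons /hchain /= (seg_sym (hpoint 3 c)) setUA.
rewrite !E; apply: (vertex_move (G := map (map hform) G)).
- move=> _ M /mapP[g gG ->] /mapP[N Ng ->].
  by have /andP[] := allP (Gab _ gG) _ Ng; rewrite !hev_gt0.
- exact: touches_checkP.
- exact: touches_checkP.
- by apply: chain_checkP => //; rewrite /wf all_rcons sp pp.
Qed.

(** A step rotates the polygon until the vertex to be treated is the second one, then moves
    it to a new position, or pushes it onto the segment of its neighbours and drops it. *)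
Definition step := (nat * option (seq Z) * certificate)%type.

Definition run_step (P : seq (seq Z)) (m : step) : option (seq (seq Z)) :=
  let: (k, b, G) := m in
  if rot k P is [:: p, a, q & t] then
    if b is Some b' then
      if [&& size b' == 4, proper 3 b' & move_check p a q t b' G]
      then Some [:: p, b', q & t] else None
    else if move_check p a q t (hadd p q) G then Some [:: p, q & t] else None
  else None.

Fixpoint run_steps P ms :=
  if ms is m :: ms' then obind (fun P' => run_steps P' ms') (run_step P m) else Some P.

Lemma run_stepP P m P' : wf P -> run_step P m = Some P' ->
  wf P' /\ isotopic (hpolygon 3 P) (hpolygon 3 P').
Proof.
case: m => [[k b] G] wP /=; rewrite -(hpolygon_rot 3 k P).
have : wf (rot k P) by rewrite /wf (eq_all_r (mem_rot k P)).
case: (rot k P) => [|p [|a [|q t]]] // w; have := w.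
move=> /= /and4P[/andP[/eqP sp pp] /andP[sa pa] /andP[/eqP sq pq] wt].
case: b => [b|].
  case: ifP => // /and3P[sb pb mc] [<-]; split; last exact: move_checkP w pb mc.
  by rewrite /= sp sq pp pq sb pb !eqxx.
case: ifP => // mc [<-]; split; first by rewrite /= sp sq pp pq !eqxx.
have spq : size p = size q by rewrite sp sq.
apply: isotopic_trans (move_checkP w (proper_hadd spq pp pq) mc) _.
suff -> : hpolygon 3 [:: p, hadd p q, q & t] = hpolygon 3 [:: p, q & t].
  exact: isotopic_refl.
rewrite !hpolygon_cons /hchain /= setUA.
by rewrite -(seg_split (hadd_seg spq pp pq)).
Qed.

Lemma run_stepsP P ms P' : wf P -> run_steps P ms = Some P' ->
  wf P' /\ isotopic (hpolygon 3 P) (hpolygon 3 P').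
Proof.
elim: ms P => [|m ms IH] P wP /=; first by move=> [<-]; split=> //; exact: isotopic_refl.
case E: (run_step P m) => [Q|] //= run; have [wQ iQ] := run_stepP wP E.
have [wP' iP'] := IH _ wQ run; split=> //; exact: isotopic_trans iQ iP'.
Qed.
End Homogeneous.
Arguments hpolygon : clear implicits.
Arguments hchain : clear implicits.
Arguments hpoint : clear implicits.

(** * Stellar exchanges *)

Definition exchange_face (s t : seq nat) (i : nat) : seq nat :=
  [seq x <- iota 0 17 | ((x \in s) || (x \in t)) && (x != i)].

(** The conditions make sure that the star of s is the join of s, of the boundary of t, and of a
    link, and that t is not yet a face. The case where t is a new vertex is a stellar subdivision,
    and the opposite case a weld. *)
Definition exchange (F : seq (seq nat)) (m : seq nat * seq nat) : option (seq (seq nat)) :=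
  let: (s, t) := m in
  let star := [seq u <- F | sub s u] in
  if [&& s != [::], t != [::], labels s, labels t, uniq s, uniq t,
      all (fun x => x \notin t) s, all (fun u => ~~ sub t u) F &
      all (fun u => all (fun j => has (sub (exchange_face u t j)) F) t) star]
  then Some ([seq u <- F | ~~ sub s u]
          ++ undup [seq exchange_face u t i | u <- star, i <- s])
  else None.

Fixpoint exchanges F ms :=
  if ms is m :: ms' then obind (fun F' => exchanges F' ms') (exchange F m) else Some F.

Lemma sub_trans s t u : sub s t -> sub t u -> sub s u.
Proof. by move=> /allP st /allP tu; apply/allP => x /st /tu. Qed.

Section Exchange.
Variable R : realType.
Notation space := 'rV[R]_17.

Definition at_label (x : space) (i : nat) : R := x ord0 (label i).

Definition lowest (s : seq nat) (x : space) : R :=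
  foldr (fun i m => Num.min (at_label x i) m) (at_label x (head 0%N s)) s.

(** On a face that contains s, the point is first pushed away from s until one of its coordinates
    there vanishes; the mass lost is given to t in equal shares. The factor keeps the sum of the
    coordinates. *)
Definition psi (m : seq nat * seq nat) (x : space) : space :=
  \row_i (x ord0 i - (val i \in m.1)%:R * lowest m.1 x
          + (val i \in m.2)%:R * ((size m.1)%:R / (size m.2)%:R) * lowest m.1 x).

Definition psis (ms : seq (seq nat * seq nat)) (x : space) : space :=
  foldl (fun y m => psi m y) x ms.

Definition swap (m : seq nat * seq nat) := (m.2, m.1).

Definition psis_inv (ms : seq (seq nat * seq nat)) (x : space) : space :=
  foldr (fun m y => psi (swap m) y) x ms.

Lemma lowest_le s x i : i \in s -> lowest s x <= at_label x i.
Proof.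
rewrite /lowest; move: (at_label x _) => c.
by elim: s => //= j s IH; rewrite inE ge_min => /orP[/eqP -> | /IH ->]; rewrite ?lexx ?orbT.
Qed.

Lemma lowest_attained s x : s != [::] -> exists2 i, i \in s & lowest s x = at_label x i.
Proof.
case: s => // j s _; rewrite /lowest /=.
have : exists2 i, i \in j :: s &
    foldr (fun i m => Num.min (at_label x i) m) (at_label x j) s = at_label x i.
  elim: s => [|k s [i ijs e]] /=; first by exists j; rewrite ?mem_head.
  rewrite {}e; case: (leP (at_label x k) (at_label x i)) => _.
    by exists k; rewrite // !inE eqxx orbT.
  by exists i => //; move: ijs; rewrite !inE => /orP[->|->] //; rewrite !orbT.
move=> [i ijs ->]; case: (leP (at_label x j) (at_label x i)) => _.
  by exists j; rewrite ?mem_head.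
by exists i.
Qed.

Lemma lowest_uniq s x c i : i \in s -> at_label x i = c ->
  (forall j, j \in s -> c <= at_label x j) -> lowest s x = c.
Proof.
move=> is_ xi h; apply/le_anti; rewrite -{1}xi lowest_le //=.
have s0 : s != [::] by case: (s) is_.
by have [j js ->] := lowest_attained x s0; exact: h.
Qed.

Lemma at_psi m x i : (i < 17)%N -> at_label (psi m x) i =
  at_label x i - (i \in m.1)%:R * lowest m.1 x
  + (i \in m.2)%:R * ((size m.1)%:R / (size m.2)%:R) * lowest m.1 x.
Proof. by move=> lti; rewrite /at_label mxE val_label. Qed.

Lemma cts_psi m : continuous (psi m).
Proof.
have cl s : continuous (lowest s).
  rewrite /lowest; move: (head _ _) => h; elim: s => [|i s IH] /=.
    by apply: cts_coord; exact: cts_id.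
  by apply: cts_min => //; apply: cts_coord; exact: cts_id.
apply: cts_row => j.
rewrite (_ : (fun _ => _) = fun x : space => x ord0 j - (val j \in m.1)%:R * lowest m.1 x
          + (val j \in m.2)%:R * ((size m.1)%:R / (size m.2)%:R) * lowest m.1 x); last first.
  by apply/funext => x; rewrite mxE.
apply: ctsD; last by apply: ctsM; [exact: ctsc | exact: cl].
apply: ctsB; first by apply: cts_coord; exact: cts_id.
by apply: ctsM; [exact: ctsc | exact: cl].
Qed.

Lemma realizationP F (x : space) : all labels F ->
  realization (cplx F) x <->
  [/\ forall i, (i < 17)%N -> 0 <= at_label x i, \sum_i x ord0 i = 1
    & exists2 s, s \in F & forall i, (i < 17)%N -> i \notin s -> at_label x i = 0].
Proof.
move=> lF; split=> -[x0 x1].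
  rewrite in_cplx => /andP[_ /hasP[s sF ss]]; split=> //; first by move=> i _; exact: x0.
  exists s => // i lti ns; apply/eqP; rewrite -[_ == _]negbK; apply: contra ns => xi.
  have := fintype.subsetP ss (label i); rewrite in_simplex ?(allP lF _ sF) // val_label //.
  by apply; rewrite inE.
move=> [s sF ss]; have xlab i : at_label x (val i) = x ord0 i by rewrite /at_label label_val.
split=> //; first by move=> i; rewrite -xlab; apply: x0; exact: ltn_ord.
rewrite in_cplx; apply/andP; split.
  apply/eqP => /setP e; have /eqP := x1.
  rewrite big1 => [|i _]; first by rewrite eq_sym oner_eq0.
  by apply/eqP; have := e i; rewrite !inE => /negbFE.
apply/hasP; exists s => //; apply/fintype.subsetP => i; rewrite inE => xi.
rewrite in_simplex ?(allP lF _ sF) //; apply: contraNT xi => ns.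
by rewrite -xlab; apply/eqP/ss => //; exact: ltn_ord.
Qed.

Lemma sum_psi m x : labels m.1 -> labels m.2 -> uniq m.1 -> uniq m.2 -> m.2 != [::] ->
  \sum_i psi m x ord0 i = \sum_i x ord0 i.
Proof.
move=> l1 l2 u1 u2 n2.
have count s : labels s -> uniq s -> \sum_(i < 17) (val i \in s)%:R = (size s)%:R :> R.
  move=> ls us; rewrite -natr_sum -card_simplex // -sum1_card; congr (_%:R).
  rewrite [RHS]big_mkcond /=; apply: eq_bigr => i _.
  by rewrite in_simplex //; case: (_ \in _).
under eq_bigr => i _ do rewrite mxE.
rewrite big_split sumrB /= -!mulr_suml !count //.
have : (size m.2)%:R != 0 :> R by rewrite pnatr_eq0 size_eq0.
by move=> n0; field.
Qed.

(** What the map of an exchange needs of the two complexes; the exchange in the opposite direction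
    has the same property, which makes the inverse map come for free. *)
Definition half_exchange (F F' : seq (seq nat)) (s t : seq nat) : Prop :=
  forall u, u \in F -> ~~ sub t u /\
    if sub s u then forall i, i \in s -> exists2 v, v \in F' & sub (exchange_face u t i) v
    else exists2 v, v \in F' & sub u v.

(** A face does not contain t, so some coordinate on t is 0 before the move; hence the minimum on
    t afterwards is exactly the share that each label of t received, and the map of the opposite
    exchange returns it to s. *)
Lemma psi_half F F' s t x : all labels F -> all labels F' ->
  labels s -> labels t -> uniq s -> uniq t -> s != [::] -> t != [::] ->
  (forall i, i \in s -> i \notin t) -> half_exchange F F' s t ->
  realization (cplx F) x ->
  realization (cplx F') (psi (s, t) x) /\ psi (t, s) (psi (s, t) x) = x.
Proof.
move=> lF lF' ls lt us ut s0 t0 st half /realizationP -/(_ lF)[x0 x1 [u uF xu]].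
have [tu uF'] := half u uF.
set y := psi (s, t) x; set m := lowest s x; set c : R := (size s)%:R / (size t)%:R.
have ts i : i \in t -> i \notin s by apply: contraL => /st.
have yE i : (i < 17)%N -> at_label y i =
    at_label x i - (i \in s)%:R * m + (i \in t)%:R * c * m by exact: at_psi.
have m0 : 0 <= m.
  by have [i is_ mi] := lowest_attained x s0; rewrite /m mi; apply: x0; exact: (allP ls).
have c0 : 0 < c by rewrite divr_gt0 // ltr0n lt0n size_eq0.
have ys i : i \in s -> at_label y i = at_label x i - m.
  by move=> is_; rewrite yE ?(allP ls) // is_ (negbTE (st i is_)) mul1r !mul0r addr0.
have yt i : i \in t -> at_label y i = at_label x i + c * m.
  by move=> it; rewrite yE ?(allP lt) // it (negbTE (ts i it)) mul0r subr0 mul1r.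
have yo i : (i < 17)%N -> i \notin s -> i \notin t -> at_label y i = at_label x i.
  by move=> il ns nt; rewrite yE // (negbTE ns) (negbTE nt) !mul0r subr0 addr0.
have y0 i : (i < 17)%N -> 0 <= at_label y i.
  move=> il; case: (boolP (i \in s)) => [is_|ns].
    by rewrite ys // subr_ge0 lowest_le.
  case: (boolP (i \in t)) => [it|nt]; last by rewrite yo ?x0.
  by rewrite yt // addr_ge0 ?x0 // mulr_ge0 // ltW.
split.
  apply/realizationP => //; split=> //; first by rewrite sum_psi.
  move: uF'; case: ifP => [su uF'|/negbT nsu [v vF' uv]].
    have [i is_ mi] := lowest_attained x s0; have [v vF' sv] := uF' i is_.
    exists v => // j jl jv.
    have : j \notin exchange_face u t i by apply: contra jv => /(allP sv).
    rewrite mem_filter mem_iota /= jl andbT negb_and negb_or negbK.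
    case/orP => [/andP[ju jt]|/eqP ->]; last by rewrite ys // /m mi subrr.
    case: (boolP (j \in s)) => [js|js]; last by rewrite yo // xu.
    by move/allP: su => /(_ j js); rewrite (negbTE ju).
  exists v => // j jl jv.
  have ju : j \notin u by apply: contra jv => /(allP uv).
  have {jv}mz : m = 0.
    have [k ks ku] := allPn nsu; apply/le_anti; rewrite m0 andbT.
    by have := lowest_le x ks; rewrite (xu k (allP ls _ ks) ku).
  by rewrite yE // mz !mulr0 subr0 addr0 xu.
have mt : lowest t y = c * m.
  have [j jt ju] := allPn tu; apply: (lowest_uniq jt).
    by rewrite yt // xu ?add0r // (allP lt).
  by move=> i it; rewrite yt // lerDr x0 // (allP lt).
apply/rowP => i; rewrite -[X in psi _ _ _ X]label_val -[RHS]/(x ord0 i).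
rewrite -[LHS]/(at_label _ (val i)) at_psi ?ltn_ord //= mt.
have -> : x ord0 i = at_label x (val i) by rewrite /at_label label_val.
have sz (r : seq nat) : r != [::] -> (size r)%:R != 0 :> R by rewrite pnatr_eq0 size_eq0.
case: (boolP (val i \in s)) => [is_|ns].
  rewrite (negbTE (st _ is_)) ys // mul0r subr0 mul1r /c.
  by field; rewrite !sz.
case: (boolP (val i \in t)) => [it|nt].
  by rewrite yt // mul1r !mul0r addr0 addrK.
by rewrite yo ?ltn_ord // !mul0r subr0 addr0.
Qed.

Lemma exchange_face_labels u t i : labels (exchange_face u t i).
Proof. by apply/allP => x; rewrite mem_filter mem_iota => /and3P[]. Qed.

Lemma exchangeP F m F' : all labels F -> exchange F m = Some F' ->
  all labels F' /\
  mutually_inverse (realization (R := R) (cplx F)) (realization (cplx F')) (psi m) (psi (swap m)).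
Proof.
case: m => s t lF /=; case: ifP => // /and5P[s0 t0 ls lt /and5P[us ut /allP st /allP tF /allP sF]].
set F1 := [seq u <- F | ~~ sub s u]; set new := undup _; case=> <-.
have inF1 u : u \in F1 -> u \in F /\ ~~ sub s u by rewrite mem_filter => /andP[].
have lF' : all labels (F1 ++ new).
  rewrite all_cat; apply/andP; split; apply/allP => u.
    by move/inF1 => [/(allP lF)].
  by rewrite mem_undup => /allpairsP[p [_ _ ->]]; exact: exchange_face_labels.
split=> //.
have ts i : i \in t -> i \notin s by apply: contraL => /st.
have refl u : sub u u by apply/allP.
have h1 : half_exchange F (F1 ++ new) s t.
  move=> u uF; split; first exact: tF.
  case: ifP => [su i is_|/negbT nsu].
    exists (exchange_face u t i) => //; rewrite mem_cat mem_undup; apply/orP; right.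
    by apply/allpairsP; exists (u, i); rewrite mem_filter su.
  by exists u; rewrite // mem_cat mem_filter nsu uF.
have h2 : half_exchange (F1 ++ new) F t s.
  move=> u; rewrite mem_cat => /orP[/inF1[uF nsu]|].
    by split=> //; rewrite (negbTE (tF u uF)); exists u.
  rewrite mem_undup => /allpairsP[[w i] /= [+ is_ ->]].
  rewrite mem_filter => /andP[sw wF].
  have lw := allP lF _ wF.
  split.
    apply/allPn; exists i => //; by rewrite mem_filter eqxx andbF.
  have -> : sub t (exchange_face w t i).
    apply/allP => j jt; rewrite mem_filter mem_iota jt orbT /= (allP lt) // andbT.
    by apply: contraNneq (st i is_) => <-.
  move=> j jt; have /hasP[v vF jv] : has (sub (exchange_face w t j)) F.
    by have := sF w; rewrite mem_filter sw wF => /(_ isT) /allP /(_ j jt).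
  exists v => //; apply: sub_trans jv; apply/allP => k.
  rewrite !mem_filter mem_iota => /andP[/andP[h kj] kl]; rewrite kj kl !andbT.
  case/orP: h => [/andP[/andP[-> //]]|ks].
  by rewrite (allP sw).
split; try exact: cts_psi.
- split=> x Kx; first by have [] := psi_half lF lF' ls lt us ut s0 t0 st h1 Kx.
  by have [] := psi_half lF' lF lt ls ut us t0 s0 ts h2 Kx.
- by move=> x Kx; have [] := psi_half lF lF' ls lt us ut s0 t0 st h1 Kx.
- by move=> x Kx; have [] := psi_half lF' lF lt ls ut us t0 s0 ts h2 Kx.
Qed.

Lemma exchangesP F ms F' : all labels F -> exchanges F ms = Some F' ->
  all labels F' /\
  mutually_inverse (realization (R := R) (cplx F)) (realization (cplx F')) (psis ms) (psis_inv ms).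
Proof.
elim: ms F => [|m ms IH] F lF /=; first by move=> [<-]; split=> //; exact: mutually_inverse_id.
case E: (exchange F m) => [F1|] //= run; have [lF1 h1] := exchangeP lF E.
have [lF' h2] := IH _ lF1 run; split=> //.
exact: mutually_inverse_comp h1 h2.
Qed.
End Exchange.

(** * Tracking polygons through exchanges *)

Definition hlowest (s : seq nat) (v : seq Z) : Z :=
  foldr (fun i m => Z.min (coordinate v i) m) (coordinate v (head 0%N s)) s.

(** The map of an exchange on homogeneous coordinates. Points with a zero coordinate on s are
    fixed; leaving them as they are keeps the integers small. *)
Definition hpsi (m : seq nat * seq nat) (v : seq Z) : seq Z :=
  let low := hlowest m.1 v in
  if Z.eqb low Z0 then v else
  let a := Z.of_nat (size m.1) in let b := Z.of_nat (size m.2) in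
  rcons [seq (if i \in m.1 then Z.mul b (Z.sub (coordinate v i) low)
       else if i \in m.2 then Z.add (Z.mul b (coordinate v i)) (Z.mul a low)
       else Z.mul b (coordinate v i)) | i <- iota 0 17] (Z.mul b (coordinate v 17)).

(** Then the map of the exchange is affine on the segment from u to v, since one label attains the
    minimum over s at both ends. *)
Definition same_lowest (s : seq nat) (u v : seq Z) : bool :=
  has (fun i => all (fun j => Z.leb (coordinate u i) (coordinate u j)
                           && Z.leb (coordinate v i) (coordinate v j)) s) s.

(** Starting at u, the minimum over s is attained at a label i that is the lowest at v among the
    candidates. It is overtaken first by the label j with the smallest ratio of the gap dp at u to
    the loss dq; the point that splits the segment at that ratio is dq u + dp v. The subdivision
    that results is verified by linear_chain. *)
Definition crossing (s : seq nat) (u v : seq Z) : option (Z * Z) :=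
  let low := hlowest s u in
  let c := [seq i <- s | Z.eqb (coordinate u i) low] in
  let vi := hlowest c v in
  foldr (fun j r =>
    let dp := Z.sub (coordinate u j) low in let dq := Z.sub vi (coordinate v j) in
    if Z.ltb Z0 dq && Z.ltb Z0 dp then
      if r is Some (ep, eq) then
        if Z.ltb (Z.mul dp eq) (Z.mul ep dq) then Some (dp, dq) else r
      else Some (dp, dq)
    else r) None s.

(** As the minimum over s is concave and piecewise linear along a segment, with at most one piece
    for each label, the size of s is enough fuel. *)
Fixpoint refine (k : nat) (s : seq nat) (u v : seq Z) : seq (seq Z) :=
  if k is k'.+1 then
    if same_lowest s u v then [:: v] else
    if crossing s u v is Some (dp, dq) then
      if Z.ltb Z0 dq && Z.ltb Z0 dp then
        let w := hadd (hscale dq u) (hscale dp v) in w :: refine k' s w v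
      else [:: v]
    else [:: v]
  else [:: v].

Fixpoint refine_chain (s : seq nat) (u : seq Z) (P : seq (seq Z)) : seq (seq Z) :=
  if P is v :: P' then refine (size s) s u v ++ refine_chain s v P' else [::].

Fixpoint linear_chain (s : seq nat) (u : seq Z) (P : seq (seq Z)) : bool :=
  if P is v :: P' then same_lowest s u v && linear_chain s v P' else true.

Definition track_step (m : seq nat * seq nat) (c : seq Z * seq (seq Z)) :=
  let: (u, P) := c in
  let P' := refine_chain m.1 u P in
  if [&& m.1 != [::], m.2 != [::], labels m.1, labels m.2 & linear_chain m.1 u P']
  then Some (hpsi m u, map (hpsi m) P') else None.

Fixpoint track ms c :=
  if ms is m :: ms' then obind (track ms') (track_step m c) else Some c.

Section Track.
Variable R : realType.
Notation space := 'rV[R]_17.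
Notation pt := (hpoint R 17).

Definition wf17 (v : seq Z) : bool := (size v == 18) && proper 17 v.

Lemma at_hpoint v i : (i < 17)%N ->
  at_label (pt v) i = zr R (coordinate v i) / zr R (coordinate v 17).
Proof. by move=> il; rewrite /at_label mxE val_label. Qed.

Lemma hlowest_le s v i : i \in s -> Z.leb (hlowest s v) (coordinate v i).
Proof.
rewrite /hlowest; move: (coordinate v (head _ _)) => c.
elim: s => //= j s IH; rewrite inE => /orP[/eqP <-|/IH]; lia.
Qed.

Lemma hlowest_attained s v : s != [::] -> exists2 i, i \in s & hlowest s v = coordinate v i.
Proof.
case: s => // j s _; rewrite /hlowest /=.
have [i ijs ->] : exists2 i, i \in j :: s &
    foldr (fun i m => Z.min (coordinate v i) m) (coordinate v j) s = coordinate v i.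
  elim: s => [|k s [i ijs e]] /=; first by exists j; rewrite ?mem_head.
  rewrite {}e; case: (Z.min_spec (coordinate v k) (coordinate v i)) => -[_ ->].
    by exists k; rewrite // !inE eqxx orbT.
  by exists i => //; move: ijs; rewrite !inE => /orP[->|->] //; rewrite !orbT.
case: (Z.min_spec (coordinate v j) (coordinate v i)) => -[_ ->].
  by exists j; rewrite ?mem_head.
by exists i.
Qed.

Lemma lowest_hpoint s v : labels s -> s != [::] -> proper 17 v ->
  lowest s (pt v) = zr R (hlowest s v) / zr R (coordinate v 17).
Proof.
move=> ls s0 pv; have w0 := proper_gt0 R pv.
have [i is_ e] := hlowest_attained v s0.
apply: (lowest_uniq is_); first by rewrite at_hpoint ?e // (allP ls).
move=> j js; rewrite at_hpoint ?(allP ls) // ler_pM2r ?invr_gt0 //.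
by rewrite -zr_le hlowest_le.
Qed.

Lemma wf17_hpsi m v : m.2 != [::] -> wf17 v -> wf17 (hpsi m v).
Proof.
move=> t0 /andP[sv pv]; rewrite /wf17 /hpsi; case: ifP => _; first by rewrite sv.
rewrite size_rcons size_map size_iota eqxx /proper /coordinate nth_rcons size_map size_iota ltnn eqxx.
have b0 : Z.ltb Z0 (Z.of_nat (size m.2)) by case: (m.2) t0 => //= *; lia.
by move: pv b0; rewrite /proper !(zr_lt R) zrM zr0 => *; exact: mulr_gt0.
Qed.

Lemma psi_hpoint m v : labels m.1 -> labels m.2 -> m.1 != [::] -> m.2 != [::] ->
  (forall i, i \in m.1 -> i \notin m.2) -> wf17 v ->
  psi m (pt v) = pt (hpsi m v).
Proof.
move=> l1 l2 n1 n2 dis /andP[_ pv]; have w0 := proper_gt0 R pv.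
apply/rowP => j; rewrite 2!mxE lowest_hpoint // /hpsi.
case: ifP => [/eqP low0|_].
  have -> : hlowest m.1 v = Z0 by lia.
  by rewrite mxE zr0 mul0r !mulr0 subr0 addr0.
rewrite [RHS]mxE; set low := hlowest _ _.
have zn k : zr R (Z.of_nat k) = k%:R by rewrite /zr (_ : int_of_Z _ = k) //; lia.
have c17 (f : nat -> Z) (x : Z) : coordinate (rcons [seq f i | i <- iota 0 17] x) 17 = x.
  by rewrite /coordinate nth_rcons size_map size_iota ltnn eqxx.
have cj (f : nat -> Z) (x : Z) : coordinate (rcons [seq f i | i <- iota 0 17] x) j = f j.
  by rewrite /coordinate nth_rcons size_map size_iota ltn_ord (nth_map 0%N) ?size_iota // nth_iota.
rewrite c17 cj zrM zn.
have t0 : (size m.2)%:R != 0 :> R by rewrite pnatr_eq0 size_eq0.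
have w0' : zr R (coordinate v 17) != 0 by rewrite gt_eqF.
case: (boolP (val j \in m.1)) => [j1|j1].
  rewrite (negbTE (dis _ j1)) zrM zn zrB !mul0r addr0 mul1r; field; by rewrite w0' t0.
case: (boolP (val j \in m.2)) => [j2|j2].
  rewrite zrD !zrM !zn mul0r mul1r subr0; field; by rewrite w0' t0.
rewrite zrM zn !mul0r subr0 addr0; field; by rewrite w0' t0.
Qed.

Lemma affine_psi m (p q : space) i : labels m.1 -> i \in m.1 ->
  (forall j, j \in m.1 -> at_label p i <= at_label p j /\ at_label q i <= at_label q j) ->
  affine_on (psi m) p q.
Proof.
move=> l1 i1 h t /andP[t0 t1].
have low x : (forall j, j \in m.1 -> at_label x i <= at_label x j) ->
    lowest m.1 x = at_label x i by move=> hx; exact: (lowest_uniq i1).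
apply/rowP => k; rewrite !mxE !low => [|j /h[]//|j /h[]//|j /h[pj qj]].
  by rewrite /at_label !mxE; ring.
rewrite /at_label !mxE; apply: lerD; apply: ler_wpM2l => //; by rewrite subr_ge0.
Qed.

Lemma wf17_crossing u v dp dq : wf17 u -> wf17 v -> Z.ltb Z0 dp -> Z.ltb Z0 dq ->
  wf17 (hadd (hscale dq u) (hscale dp v)) /\
  seg (pt u) (pt v) (pt (hadd (hscale dq u) (hscale dp v))).
Proof.
move=> /andP[/eqP su pu] /andP[/eqP sv pv] p0 q0.
have ss : size (hscale dq u) = size (hscale dp v) by rewrite !size_map su sv.
have pp c w : proper 17 w -> Z.ltb Z0 c -> proper 17 (hscale c w).
  by rewrite /proper coordinate_hscale; lia.
split; first by rewrite /wf17 (proper_hadd R) ?pp // size_map size_zip !size_map su sv.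
by rewrite -(hpoint_hscale R 17 u q0) -(hpoint_hscale R 17 v p0); apply: hadd_seg; rewrite ?pp.
Qed.

Lemma refineP k s u v : wf17 u -> wf17 v ->
  [/\ all wf17 (refine k s u v), last u (refine k s u v) = v
    & hchain R 17 u (refine k s u v) = seg (pt u) (pt v)].
Proof.
elim: k u => [|k IH] u wu wv /=; first by rewrite wv /hchain /= setU0.
have triv : [/\ all wf17 [:: v], last u [:: v] = v & hchain R 17 u [:: v] = seg (pt u) (pt v)].
  by rewrite /= wv /hchain /= setU0.
case: ifP => // _; case: (crossing s u v) => [[dp dq]|] //.
case: ifP => // /andP[q0 p0].
have [ww sw] := wf17_crossing wu wv p0 q0; have [h1 h2 h3] := IH _ ww wv.
split=> //=; first by rewrite ww.
by rewrite (seg_split sw) -h3.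
Qed.

Lemma refine_chainP s u P : wf17 u -> all wf17 P ->
  [/\ all wf17 (refine_chain s u P), last u (refine_chain s u P) = last u P
    & hchain R 17 u (refine_chain s u P) = hchain R 17 u P].
Proof.
elim: P u => [|v P IH] u wu //= /andP[wv wP].
have [h1 h2 h3] := refineP (size s) s wu wv; have [h4 h5 h6] := IH v wv wP.
split; first by rewrite all_cat h1 h4.
  by rewrite last_cat h2.
rewrite /hchain map_cat; have h7 : hchain R 17 u (v :: P) = seg (pt u) (pt v) `|` hchain R 17 v P by [].
rewrite -/(hchain R 17 u (v :: P)) h7 -h3 -h6.
have : refine (size s) s u v != [::] by case: (size s) => //= n; do 3?case: ifP => //; case: (crossing s u v) => // -[? ?]; case: ifP.
case/lastP: (refine _ _ _ _) h2 => // r w; rewrite last_rcons => -> _.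
by rewrite -cats1 !map_cat /= -catA /= chain_cat /hchain -map_rcons -cats1 map_cat.
Qed.

Lemma track_stepP m u P u' P' : (forall i, i \in m.1 -> i \notin m.2) ->
  wf17 u -> all wf17 P -> track_step m (u, P) = Some (u', P') ->
  [/\ wf17 u', all wf17 P' & psi m @` hchain R 17 u P = hchain R 17 u' P'].
Proof.
move=> dis wu wP /=; case: ifP => // /and5P[n1 n2 l1 l2 lin] [<- <-].
have [h1 _ <-] := refine_chainP m.1 wu wP; split; first exact: wf17_hpsi.
  rewrite all_map; apply: sub_all h1 => v; exact: wf17_hpsi.
have ph v : wf17 v -> psi m (pt v) = pt (hpsi m v) by exact: psi_hpoint.
move: (refine_chain _ _ _) h1 lin => Q.
elim: Q u wu {wP} => [|v Q IH] u wu /=; first by rewrite /hchain /= image_set0.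
move=> /andP[wv wQ] /andP[sl lin]; rewrite /hchain /= image_setU.
rewrite -[chain (pt v) _]/(hchain R 17 v Q) (IH v wv wQ lin) image_seg ?ph //.
have /hasP[i i1 /allP hi] := sl; apply: (affine_psi l1 i1) => j j1.
have /andP[] := hi j j1; rewrite !(zr_le R) => a b.
case/andP: wu => _ /(proper_gt0 R) u0; case/andP: wv => _ /(proper_gt0 R) v0.
by rewrite !at_hpoint ?(allP l1) // !ler_pM2r ?invr_gt0.
Qed.

(** On each segment of the subdivided path the map of an exchange is affine, so that it acts on
    the path vertex by vertex. *)
Lemma trackP (ms : seq (seq nat * seq nat)) u P u' P' :
  all (fun m : seq nat * seq nat => all (fun i => i \notin m.2) m.1) ms ->
  wf17 u -> all wf17 P -> track ms (u, P) = Some (u', P') ->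
  [/\ wf17 u', all wf17 P' & psis ms @` hchain R 17 u P = hchain R 17 u' P'].
Proof.
elim: ms u P => [|m ms IH] u P; first by move=> _ wu wP [<- <-]; rewrite image_id.
move=> /= /andP[/allP dm dms] wu wP.
rewrite -[X in X = Some _]/(obind (track ms) (track_step m (u, P))).
case E: (track_step m (u, P)) => [[v Q]|] // run.
have [wv wQ e] := track_stepP dm wu wP E; have [h1 h2 h3] := IH _ _ dms wv wQ run.
split=> //; rewrite -h3 -e image_comp; reflexivity.
Qed.
End Track.

(** * From a simplex to the round ball *)

Section Norm.
Variables (R : realType) (d : nat).
Implicit Types u : 'rV[R]_d.

Definition norm2 u : R := Num.sqrt (sqnorm u).

Lemma sqnorm_ge0 u : 0 <= sqnorm u.
Proof. by apply: sumr_ge0 => i _; exact: sqr_ge0. Qed.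

Lemma norm2_ge0 u : 0 <= norm2 u. Proof. exact: sqrtr_ge0. Qed.

Lemma norm2_sqr u : norm2 u ^+ 2 = sqnorm u.
Proof. by rewrite sqr_sqrtr // sqnorm_ge0. Qed.

Lemma sqnormZ c u : sqnorm (c *: u) = c ^+ 2 * sqnorm u.
Proof. by rewrite /sqnorm mulr_sumr; apply: eq_bigr => i _; rewrite mxE exprMn. Qed.

Lemma norm2Z c u : 0 <= c -> norm2 (c *: u) = c * norm2 u.
Proof. by move=> c0; rewrite /norm2 sqnormZ sqrtrM ?sqr_ge0 // sqrtr_sqr ger0_norm. Qed.

Lemma coord_norm2 u i : `|u ord0 i| <= norm2 u.
Proof.
rewrite -sqrtr_sqr ler_wsqrtr // /sqnorm (bigD1 i) //= lerDl.
by apply: sumr_ge0 => j _; exact: sqr_ge0.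
Qed.

Lemma norm2_gt0 u : (0 < norm2 u) = (u != 0).
Proof.
apply/idP/idP => [|u0].
  by apply: contraTneq => ->; rewrite /norm2 /sqnorm big1 ?sqrtr0 ?ltxx // => i _; rewrite mxE expr0n.
rewrite lt_neqAle norm2_ge0 andbT eq_sym; apply: contra u0 => /eqP u0.
apply/eqP/rowP => i; rewrite mxE; apply/eqP; rewrite -normr_le0.
by rewrite -u0 coord_norm2.
Qed.

Lemma cts_norm2 : continuous norm2.
Proof.
apply: cts_sqrt; apply: cts_sum => i.
rewrite (_ : (fun _ => _) = fun u : 'rV[R]_d => u ord0 i * u ord0 i).
  by apply: ctsM; apply: cts_coord; exact: cts_id.
by apply/funext => u; rewrite expr2.
Qed.
End Norm.

Lemma squeeze0 (R : realType) (T : topologicalType) (f g : T -> R) x :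
  (forall y, `|f y| <= g y) -> g x = 0 -> {for x, continuous g} -> {for x, continuous f}.
Proof.
move=> fg gx cg; have fx : f x = 0 by apply/eqP; rewrite -normr_le0 -gx.
apply/cvg_ballP => e e0; have /cvg_ballP /(_ e e0) := cg.
rewrite fx gx; apply: filterS => y; rewrite /ball /= !sub0r !normrN => gy.
exact: le_lt_trans (fg y) (le_lt_trans (ler_norm _) gy).
Qed.

Lemma continuous_quotient_scale (R : realType) (T : topologicalType) (f g h : T -> R) x :
  continuous f -> continuous g -> continuous h -> g x != 0 ->
  {for x, continuous (fun y => f y / g y * h y)}.
Proof.
move=> cf cg ch g0; apply: (@continuousM _ _ (fun y => f y / g y) h); last exact: ch.
apply: (@continuousM _ _ f (fun y => (g y)^-1)); first exact: cf.
by apply: continuousV => //; exact: cg.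
Qed.

Section Gauge.
Variables (R : realType) (V : 'I_4 -> 'rV[R]_3) (beta : 'I_4 -> 'rV[R]_3).
Notation space := 'rV[R]_3.

Definition dual (i : 'I_4) (u : space) : R := \sum_k beta i ord0 k * u ord0 k.

Hypothesis dual_sum : forall u, \sum_i dual i u = 0.
Hypothesis dual_span : forall u, \sum_i dual i u *: V i = u.
Hypothesis dual_vertex : forall i j, dual i (V j) = (i == j)%:R - 4^-1.

Definition min4 (x : 'I_4 -> R) : R := \big[Num.min/x ord0]_i x i.

Lemma min4_le x i : min4 x <= x i.
Proof. exact: bigmin_le. Qed.

Lemma min4_attained x : exists i, min4 x = x i.
Proof.
rewrite /min4; apply: (big_ind (fun m => exists i, m = x i)).
- by exists ord0.
- by move=> a b [i ->] [j ->]; case: (leP (x i) (x j)) => _; [exists i | exists j].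
- by move=> i _; exists i.
Qed.

Lemma dualZ i c u : dual i (c *: u) = c * dual i u.
Proof. by rewrite /dual mulr_sumr; apply: eq_bigr => k _; rewrite mxE; ring. Qed.

Lemma cts_dual i : continuous (dual i).
Proof.
apply: cts_sum => k; apply: ctsM; first exact: ctsc.
by apply: cts_coord; exact: cts_id.
Qed.

(** The gauge of the tetrahedron spanned by the V i: it is 1 on its boundary, see
    gauge_vertices. The forms dual to the vertices, with sum 0, are minus a quarter at worst on
    the tetrahedron. *)
Definition gauge (u : space) : R := - 4 * min4 (fun i => dual i u).

Lemma gauge_ge i u : - 4 * dual i u <= gauge u.
Proof. by rewrite /gauge !mulNr lerN2 ler_pM2l // min4_le. Qed.

Lemma gauge_ge0 u : 0 <= gauge u.
Proof.
have : \sum_(i < 4) (- 4 * dual i u) <= \sum_(i < 4) gauge u.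
  by apply: ler_sum => i _; exact: gauge_ge.
rewrite -mulr_sumr dual_sum mulr0 sumr_const card_ord => h.
by rewrite -(@pmulrn_lge0 _ _ 4).
Qed.

Lemma gaugeZ c u : 0 <= c -> gauge (c *: u) = c * gauge u.
Proof.
move=> c0; rewrite /gauge mulrCA; congr (_ * _).
apply/le_anti/andP; split.
  by have [i ->] := min4_attained (fun i => dual i u); rewrite -dualZ min4_le.
have [i ->] := min4_attained (fun i => dual i (c *: u)).
by rewrite dualZ ler_wpM2l // min4_le.
Qed.

Lemma cts_gauge : continuous gauge.
Proof.
apply: ctsM; first exact: ctsc.
rewrite /min4; move: (index_enum _) (ord0 : 'I_4) => s j.
elim: s => [|i s IH].
  by rewrite (_ : (fun _ => _) = dual j); [exact: cts_dual | apply/funext => u; rewrite big_nil].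
rewrite (_ : (fun _ => _) = fun u => Num.min (dual i u) (\big[Num.min/dual j u]_(i <- s) dual i u)).
  by apply: cts_min => //; exact: cts_dual.
by apply/funext => u; rewrite big_cons.
Qed.

Lemma dual_le_gauge i u : `|dual i u| <= gauge u.
Proof.
rewrite ler_norml; apply/andP; split.
  have := gauge_ge i u; have := gauge_ge0 u; lra.
have := dual_sum u; rewrite (bigD1 i) //= => e.
have : - \sum_(j | j != i) dual j u <= \sum_(j | j != i) (4^-1 * gauge u).
  by rewrite -sumrN; apply: ler_sum => j _; have := gauge_ge j u; lra.
rewrite sumr_const (cardC1 i) card_ord /= -mulr_natl => h.
have := gauge_ge0 u; lra.
Qed.

Let A : R := 1 + \sum_i \sum_k `|V i ord0 k|.

Let A1 : 1 <= A.
Proof.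
rewrite /A lerDl; apply: sumr_ge0 => i _; apply: sumr_ge0 => k _; exact: normr_ge0.
Qed.

(** Used for the continuity of the inverse radial maps at 0, where the gauge appears in the
    denominator. *)
Lemma coord_gauge (u : space) k : `|u ord0 k| <= A * gauge u.
Proof.
rewrite -{1}(dual_span u) summxE.
apply: le_trans (ler_norm_sum _ _ _) _.
have : \sum_(i < 4) `|(dual i u *: V i) ord0 k| <= \sum_(i < 4) (\sum_k `|V i ord0 k|) * gauge u.
  apply: ler_sum => i _; rewrite mxE normrM mulrC ler_pM ?normr_ge0 ?dual_le_gauge //.
  by rewrite (bigD1 k) //= lerDl; apply: sumr_ge0 => j _; exact: normr_ge0.
rewrite -mulr_suml => h; apply: le_trans h _.
by rewrite ler_wpM2r ?gauge_ge0 // /A lerDr.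
Qed.

Lemma gauge_gt0 u : u != 0 -> 0 < gauge u.
Proof.
move=> u0; rewrite lt_neqAle gauge_ge0 andbT eq_sym; apply: contra u0 => /eqP g0.
apply/eqP/rowP => k; rewrite mxE; apply/eqP; rewrite -normr_le0.
by have := coord_gauge u k; rewrite g0 mulr0.
Qed.

(** Radial isotopy from the identity to the map that turns the gauge into the norm. *)
Definition radial (t : R) (u : space) : space := ((1 - t) + t * (gauge u / norm2 u)) *: u.

Definition radial_inv (t : R) (z : space) : space :=
  (norm2 z / ((1 - t) * norm2 z + t * gauge z)) *: z.

Lemma radial_norm u : norm2 (radial 1 u) = gauge u.
Proof.
rewrite /radial subrr add0r mul1r norm2Z ?divr_ge0 ?gauge_ge0 ?norm2_ge0 //.
have [->|u0] := eqVneq u 0; last by rewrite mulrVK // unitfE gt_eqF // norm2_gt0.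
have g0 : gauge 0 = 0 by rewrite -(scale0r (0 : space)) gaugeZ ?mul0r.
by rewrite g0 !mul0r.
Qed.

Lemma radialE t u : radial t u = (1 - t) *: u + t *: radial 1 u.
Proof. by rewrite /radial scalerDl subrr add0r mul1r scalerA. Qed.

Lemma cts_radial1 : continuous (radial 1).
Proof.
apply: cts_row => k u; have [->|u0] := eqVneq u 0.
  apply: (@squeeze0 _ _ _ gauge) => [y||]; last exact: cts_gauge.
    by rewrite -radial_norm coord_norm2.
  by rewrite -(scale0r (0 : space)) gaugeZ ?mul0r.
rewrite (_ : (fun _ => _) = fun y => gauge y / norm2 y * y ord0 k); last first.
  by apply/funext => y; rewrite mxE subrr add0r mul1r.
apply: continuous_quotient_scale; [exact: cts_gauge | exact: cts_norm2 | |].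
  by apply: cts_coord; exact: cts_id.
by rewrite gt_eqF // norm2_gt0.
Qed.

Lemma cts_radial : continuous (fun p : R * space => radial p.1 p.2).
Proof.
rewrite (_ : (fun _ => _) = fun p : R * space => (1 - p.1) *: p.2 + p.1 *: radial 1 p.2); last first.
  by apply/funext => p; exact: radialE.
apply: cts_add; apply: cts_scale.
- by apply: ctsB; [exact: ctsc | exact: cts_fst].
- exact: cts_snd.
- exact: cts_fst.
- by apply: (cts_comp _ cts_radial1); exact: cts_snd.
Qed.

Let den_gt0 t z : 0 <= t <= 1 -> z != 0 -> 0 < (1 - t) * norm2 z + t * gauge z.
Proof.
move=> /andP[t0 t1] z0; have n0 : 0 < norm2 z by rewrite norm2_gt0.
have g0 := gauge_gt0 z0.
have [->|tn0] := eqVneq t 0; first by lra.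
have {t0 tn0} t0 : 0 < t by rewrite lt_neqAle eq_sym tn0.
by apply: ltr_wpDl; [apply: mulr_ge0; [lra | exact: ltW] | exact: mulr_gt0].
Qed.

Lemma cts_radial_inv t : 0 <= t <= 1 -> continuous (radial_inv t).
Proof.
move=> t01; apply: cts_row => k z; have [->|z0] := eqVneq z 0.
  apply: (@squeeze0 _ _ _ (fun z => A * norm2 z)) => [y||]; last first.
  - by apply: ctsM; [exact: ctsc | exact: cts_norm2].
  - by rewrite /norm2 /sqnorm big1 ?sqrtr0 ?mulr0 // => i _; rewrite mxE expr0n.
  have [->|y0] := eqVneq y 0.
    by rewrite /radial_inv scaler0 mxE normr0 mulr_ge0 ?norm2_ge0 // (le_trans ler01 A1).
  have d0 := den_gt0 t01 y0.
  rewrite mxE normrM normrM normfV (ger0_norm (norm2_ge0 y)) (gtr0_norm d0).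
  move: d0; set den := _ + _ => d0.
  have -> : A * norm2 y = norm2 y / den * (A * den) by field; rewrite gt_eqF.
  rewrite ler_wpM2l ?divr_ge0 ?norm2_ge0 ?(ltW d0) //.
  case/andP: t01 => t0 t1; have h2 := coord_gauge y k.
  have h3 : `|y ord0 k| <= A * norm2 y.
    by apply: le_trans (coord_norm2 y k) _; rewrite ler_peMl ?norm2_ge0 ?A1.
  have -> : `|y ord0 k| = (1 - t) * `|y ord0 k| + t * `|y ord0 k| by ring.
  by rewrite /den mulrDr (mulrCA A (1 - t)) (mulrCA A t) lerD // ler_wpM2l ?subr_ge0.
have -> : (fun y => radial_inv t y ord0 k) =
    fun y => norm2 y / ((1 - t) * norm2 y + t * gauge y) * y ord0 k.
  by apply/funext => y; rewrite mxE.
apply: (@continuous_quotient_scale R _ (@norm2 R 3)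
    (fun y => (1 - t) * norm2 y + t * gauge y)); first exact: cts_norm2.
- by apply: ctsD; apply: ctsM; try exact: ctsc; [exact: cts_norm2 | exact: cts_gauge].
- by apply: cts_coord; exact: cts_id.
- by rewrite gt_eqF // den_gt0.
Qed.

Lemma radialK t : 0 <= t <= 1 -> mutually_inverse setT setT (radial t) (radial_inv t).
Proof.
move=> t01; pose den z := (1 - t) * norm2 z + t * gauge z.
have denZ c z : 0 <= c -> den (c *: z) = c * den z.
  by move=> c0; rewrite /den norm2Z ?gaugeZ //; ring.
have fwd u : u != 0 -> radial t u = (den u / norm2 u) *: u.
  rewrite -norm2_gt0 => n0; congr (_ *: _); rewrite /den; field; by rewrite gt_eqF.
have inv_scale c u : u != 0 -> 0 < c -> c * (norm2 u / den u) = 1 ->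
    radial_inv t (c *: u) = u /\ radial t ((c^-1) *: u) = u.
  move=> u0 c0 e; have n0 : 0 < norm2 u by rewrite norm2_gt0.
  have d0 : 0 < den u := den_gt0 t01 u0.
  have nc : norm2 u / den u = c^-1 by apply: (mulfI (lt0r_neq0 c0)); rewrite e divff ?gt_eqF.
  have dc : den u / norm2 u = c by rewrite -[c]invrK -nc invf_div.
  split.
    rewrite /radial_inv -/(den (c *: u)) denZ ?(ltW c0) // norm2Z ?(ltW c0) //.
    rewrite -mulf_div divff ?gt_eqF // mul1r nc scalerA mulVf ?scale1r // gt_eqF //.
  have c0' : 0 < c^-1 by rewrite invr_gt0.
  rewrite fwd ?scaler_eq0 ?negb_or ?u0 ?gt_eqF // denZ ?(ltW c0') // norm2Z ?(ltW c0') //.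
  by rewrite -mulf_div divff ?gt_eqF // mul1r dc scalerA divff ?scale1r // gt_eqF.
split=> //.
- apply: (@cts_comp _ _ _ (fun u => (t, u)) (fun p : R * space => radial p.1 p.2)).
    by apply: cts_pair; [exact: ctsc | exact: cts_id].
  exact: cts_radial.
- exact: cts_radial_inv.
- move=> u _; have [->|u0] := eqVneq u 0; first by rewrite /radial_inv /radial !scaler0.
  have n0 : 0 < norm2 u by rewrite norm2_gt0.
  have d0 : 0 < den u := den_gt0 t01 u0.
  have e : den u / norm2 u * (norm2 u / den u) = 1 by field; rewrite !gt_eqF.
  by rewrite fwd //; have [] := inv_scale _ u u0 (divr_gt0 d0 n0) e.
- move=> z _; have [->|z0] := eqVneq z 0; first by rewrite /radial_inv /radial !scaler0.
  have n0 : 0 < norm2 z by rewrite norm2_gt0.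
  have d0 : 0 < den z := den_gt0 t01 z0.
  have e : den z / norm2 z * (norm2 z / den z) = 1 by field; rewrite !gt_eqF.
  by have [_] := inv_scale _ z z0 (divr_gt0 d0 n0) e; rewrite invf_div.
Qed.

Lemma radial_isotopic (K : set space) : isotopic K (radial 1 @` K).
Proof.
exists radial; split=> //; first exact: cts_radial.
- by move=> t t01; exists (radial_inv t); exact: radialK.
- by move=> u; rewrite /radial subr0 mul0r addr0 scale1r.
Qed.

(** The i-th dual form takes the combination to x_i minus the mean of x. *)
Lemma gauge_vertices (x : 'I_4 -> R) :
  gauge (\sum_i x i *: V i) = \sum_i x i - 4 * min4 x /\
  forall i, dual i (\sum_i x i *: V i) = x i - 4^-1 * \sum_i x i.
Proof.
have d i : dual i (\sum_i x i *: V i) = x i - 4^-1 * \sum_i x i.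
  rewrite /dual; under eq_bigr => k _ do rewrite summxE mulr_sumr.
  rewrite exchange_big /=.
  have e j : \sum_k beta i ord0 k * (x j *: V j) ord0 k = x j * dual i (V j).
    by rewrite /dual mulr_sumr; apply: eq_bigr => k _; rewrite mxE; ring.
  under eq_bigr => j _ do rewrite e dual_vertex mulrBr.
  rewrite sumrB -mulr_suml mulrC; congr (_ - _).
  rewrite (bigD1 i) //= eqxx mulr1 big1 ?addr0 // => j ji.
  by rewrite eq_sym (negbTE ji) mulr0.
split=> //; rewrite /gauge.
have -> : min4 (fun i => dual i (\sum_i x i *: V i)) = min4 x - 4^-1 * \sum_i x i.
  have [i e] := min4_attained (fun i => dual i (\sum_i x i *: V i)).
  have [j e'] := min4_attained x.
  apply/le_anti/andP; split; first by rewrite e' -d min4_le.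
  by rewrite e d lerD2r min4_le.
by field.
Qed.
End Gauge.

(** * Models of the ball and of the sphere *)

Section Models.
Variables (R : realType) (V beta : 'I_4 -> 'rV[R]_3) (T : 4.-tuple nat) (b : nat).
Notation space := 'rV[R]_17.
Hypothesis dual_sum : forall u, \sum_i dual beta i u = 0.
Hypothesis dual_span : forall u, \sum_i dual beta i u *: V i = u.
Hypothesis dual_vertex : forall i j, dual beta i (V j) = (i == j)%:R - 4^-1.
Hypothesis labT : labels T.
Hypothesis uniqT : uniq T.
Hypothesis bT : b \notin T.
Hypothesis lab_b : (b < 17)%N.

Local Notation level := (gauge beta).
Notation radial := (radial beta).
Notation radial_inv := (radial_inv beta).

Definition onT (x : space) (i : 'I_4) : R := at_label x (tnth T i).

(** The affine map that puts the vertices of T at the V i and, as the V i have sum 0, the apex b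
    at the origin. *)
Definition combine (x : space) : 'rV[R]_3 := \sum_i onT x i *: V i.

Definition spread (c : R) (y : 'I_4 -> R) : space :=
  \row_j (\sum_i (val j == tnth T i)%:R * y i + (val j == b)%:R * c).

Let T_lt i : (tnth T i < 17)%N.
Proof. exact: (allP labT) (mem_tnth i T). Qed.

Let T_inj i j : (tnth T i == tnth T j) = (i == j).
Proof.
by rewrite !(tnth_nth 0%N) nth_uniq ?size_tuple ?ltn_ord.
Qed.

Let Tb i : (tnth T i == b) = false.
Proof. by apply/negbTE; apply: contra bT => /eqP <-; exact: mem_tnth. Qed.

Lemma onT_spread c y i : onT (spread c y) i = y i.
Proof.
rewrite /onT /at_label mxE val_label ?T_lt // Tb mul0r addr0 (bigD1 i) //= eqxx mul1r.
by rewrite big1 ?addr0 // => j ji; rewrite T_inj eq_sym (negbTE ji) mul0r.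
Qed.

Lemma b_spread c y : at_label (spread c y) b = c.
Proof.
rewrite /at_label mxE val_label // eqxx mul1r big1 ?add0r // => i _.
by rewrite eq_sym Tb mul0r.
Qed.

Lemma off_spread c y j : (j < 17)%N -> j \notin T -> j != b -> at_label (spread c y) j = 0.
Proof.
move=> jl jT jb; rewrite /at_label mxE val_label // (negbTE jb) mul0r addr0 big1 // => i _.
have -> : (j == tnth T i) = false by apply: contraNF jT => /eqP ->; exact: mem_tnth.
by rewrite mul0r.
Qed.

Lemma sum_spread c y : \sum_j (spread c y) ord0 j = \sum_i y i + c.
Proof.
under eq_bigr => j _ do rewrite mxE.
have one k : (k < 17)%N -> \sum_(j < 17) (val j == k)%:R = 1 :> R.
  move=> kl; rewrite (bigD1 (Ordinal kl)) //= eqxx big1 ?addr0 // => j.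
  by rewrite -val_eqE /= => /negbTE ->.
rewrite big_split /= -mulr_suml one // mul1r exchange_big /=; congr (_ + _).
by apply: eq_bigr => i _; rewrite -mulr_suml one // mul1r.
Qed.

Lemma spreadE (x : space) : (forall j, (j < 17)%N -> j \notin T -> j != b -> at_label x j = 0) ->
  spread (at_label x b) (onT x) = x.
Proof.
move=> x0; apply/rowP => j; have xj : x ord0 j = at_label x (val j) by rewrite /at_label label_val.
have sj : (spread (at_label x b) (onT x)) ord0 j = at_label (spread (at_label x b) (onT x)) (val j).
  by rewrite /at_label label_val.
rewrite xj sj; have [/tnthP[i ->]|jT] := boolP (val j \in T); first exact: onT_spread.
have [->|jb] := eqVneq (val j) b; first by rewrite b_spread.
by rewrite off_spread ?ltn_ord // x0 ?ltn_ord.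
Qed.

Lemma sum_onT (x : space) : (forall j, (j < 17)%N -> j \notin T -> j != b -> at_label x j = 0) ->
  \sum_j x ord0 j = \sum_i onT x i + at_label x b.
Proof. by move=> x0; rewrite -{1}(spreadE x0) sum_spread. Qed.

Lemma cts_at_label j : continuous (fun x : space => at_label x j).
Proof. by apply: cts_coord; exact: cts_id. Qed.

Lemma cts_combine : continuous combine.
Proof.
apply: cts_row => k.
have -> : (fun x => combine x ord0 k) = fun x => \sum_i onT x i * V i ord0 k.
  by apply/funext => x; rewrite summxE; apply: eq_bigr => i _; rewrite mxE.
by apply: cts_sum => i; apply: ctsM; [exact: cts_at_label | exact: ctsc].
Qed.

Lemma cts_spread (U : topologicalType) (c : U -> R) (y : U -> 'I_4 -> R) :
  continuous c -> (forall i, continuous (fun u => y u i)) ->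
  continuous (fun u => spread (c u) (y u)).
Proof.
move=> cc cy; apply: cts_row => j.
have -> : (fun u => spread (c u) (y u) ord0 j) =
    fun u => \sum_i (val j == tnth T i)%:R * y u i + (val j == b)%:R * c u.
  by apply/funext => u; rewrite mxE.
apply: ctsD; last by apply: ctsM => //; exact: ctsc.
by apply: cts_sum => i; apply: ctsM => //; exact: ctsc.
Qed.

Let sumV : \sum_i V i = 0.
Proof.
rewrite -[LHS](dual_span (\sum_i V i)) big1 // => i _.
rewrite /dual; under eq_bigr => k _ do rewrite summxE mulr_sumr.
rewrite exchange_big /=; have -> : \sum_j \sum_k beta i ord0 k * V j ord0 k = 0.
  transitivity (\sum_j ((i == j)%:R - 4^-1 : R)); first by apply: eq_bigr => j _; rewrite -dual_vertex.
  have -> : \sum_(j < 4) ((i == j)%:R - 4^-1) = \sum_(j < 4) (i == j)%:R - \sum_(j < 4) 4^-1 :> R.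
    by rewrite -sumrB.
  have -> : \sum_(j < 4) (i == j)%:R = 1 :> R.
    by rewrite (bigD1 i) //= eqxx big1 ?addr0 // => j ji; rewrite eq_sym (negbTE ji).
  by rewrite sumr_const card_ord; lra.
by rewrite scale0r.
Qed.

Lemma combine_spread c d u : combine (spread c (fun i => dual beta i u + d)) = u.
Proof.
rewrite /combine; under eq_bigr => i _ do rewrite onT_spread scalerDl.
by rewrite big_split /= dual_span -scaler_sumr sumV scaler0 addr0.
Qed.

Lemma gauge_combine (x : space) : level (combine x) = \sum_i onT x i - 4 * min4 (onT x).
Proof. exact: (gauge_vertices dual_vertex _).1. Qed.

Lemma dual_combine (x : space) i : dual beta i (combine x) = onT x i - 4^-1 * \sum_j onT x j.
Proof. exact: (gauge_vertices dual_vertex _).2. Qed.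

Lemma unit_ballE (u : 'rV[R]_3) : unit_ball u <-> norm2 u <= 1.
Proof.
rewrite /unit_ball /= -norm2_sqr; split => h; last by rewrite expr_le1 // norm2_ge0.
by rewrite -(@expr_le1 _ 2) // norm2_ge0.
Qed.

Let onezero : ((0 : R) <= (1 : R)) && ((1 : R) <= 1). Proof. by rewrite ler01 lexx. Qed.

Let radial_of z : radial 1 (radial_inv 1 z) = z.
Proof. by have [_ _ _ _] := radialK dual_sum dual_span onezero; exact. Qed.

Let inv_radial u : radial_inv 1 (radial 1 u) = u.
Proof. by have [_ _ _ + _] := radialK dual_sum dual_span onezero; exact. Qed.

Lemma gauge_inv z : level (radial_inv 1 z) = norm2 z.
Proof. by rewrite -{2}(radial_of z) (radial_norm dual_sum). Qed.

Let cts_inv1 : continuous (radial_inv 1).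
Proof. exact: (cts_radial_inv dual_sum dual_span onezero). Qed.

Definition ball_of (x : space) : 'rV[R]_3 := radial 1 (combine x).

Lemma cts_ball_of : continuous ball_of.
Proof. by apply: (cts_comp cts_combine); exact: cts_radial1 dual_sum. Qed.

Definition simplex_of (z : 'rV[R]_3) : space :=
  spread 0 (fun i => dual beta i (radial_inv 1 z) + 4^-1).

Lemma sum_dual_shift u d : \sum_i (dual beta i u + d) = 4 * d.
Proof. by rewrite big_split /= dual_sum add0r sumr_const card_ord; ring. Qed.

(** The gauge of the image of a point is 1 - 4 min, where min is the least of its barycentric
    coordinates, hence at most 1; the dual forms recover the coordinates. *)
Lemma simplex_ball :
  mutually_inverse (realization (cplx [:: val T])) (@unit_ball R 3) ball_of simplex_of.
Proof.
have lT : all labels [:: val T] by rewrite /= andbT.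
have inT (x : space) : realization (cplx [:: val T]) x ->
    [/\ forall i, 0 <= onT x i, \sum_i onT x i = 1, at_label x b = 0 &
     forall j, (j < 17)%N -> j \notin T -> at_label x j = 0].
  move=> /(realizationP _ lT)[x0 x1 [s]]; rewrite inE => /eqP -> xs.
  have xb : at_label x b = 0 by exact: xs.
  split=> //; first by move=> i; apply: x0.
  by rewrite -x1 sum_onT ?xb ?addr0 // => j jl jT _; exact: xs.
split; first exact: cts_ball_of.
- apply: cts_spread; first exact: ctsc.
  move=> i; apply: ctsD; last exact: ctsc.
  by apply: (cts_comp cts_inv1); exact: cts_dual.
- split=> [x /inT[x0 x1 _ _]|z /unit_ballE z1].
    apply/unit_ballE; rewrite (radial_norm dual_sum) gauge_combine x1.
    have [i ->] := min4_attained (onT x); have := x0 i; lra.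
  apply/(realizationP _ lT); split.
  + move=> j jl; have [/tnthP[i ->]|jT] := boolP (j \in val T).
      rewrite -[at_label _ _]/(onT _ i) onT_spread.
      have := gauge_ge beta i (radial_inv 1 z); rewrite gauge_inv; lra.
    have [->|jb] := eqVneq j b; first by rewrite b_spread.
    by rewrite off_spread.
  + by rewrite sum_spread sum_dual_shift addr0 divff // pnatr_eq0.
  + exists (val T); first by rewrite inE.
    move=> j jl jT; have [->|jb] := eqVneq j b; first by rewrite b_spread.
    by rewrite off_spread.
- move=> x /inT[x0 x1 xb xo]; rewrite /simplex_of /ball_of inv_radial.
  rewrite -[RHS]spreadE ?xb; last by move=> j jl jT _; exact: xo.
  by congr spread; apply/funext => i; rewrite dual_combine x1 mulr1 subrK.
- by move=> z _; rewrite /ball_of /simplex_of combine_spread radial_of.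
Qed.

(** ** The boundary of a 4-simplex, with and without a facet *)

(** The facets of the cone with apex b over the boundary of T. Under combine it subdivides the
    tetrahedron at the origin. *)
Definition starred : seq (seq nat) := [seq b :: [seq x <- val T | x != y] | y <- val T].

Let labS : all labels (val T :: starred).
Proof.
rewrite /= labT /=; apply/allP => s /mapP[y _ ->] /=; rewrite lab_b.
by apply/allP => x; rewrite mem_filter => /andP[_]; exact: (allP labT).
Qed.

Let in_starred (x : space) : realization (cplx starred) x <->
  [/\ forall i, 0 <= onT x i, 0 <= at_label x b, \sum_i onT x i + at_label x b = 1,
      min4 (onT x) = 0 & forall j, (j < 17)%N -> j \notin T -> j != b -> at_label x j = 0].
Proof.
have lS : all labels starred by case/andP: labS.
split.
  move=> /(realizationP _ lS)[x0 x1 [s /mapP[y yT ->] xs]].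
  have xo j : (j < 17)%N -> j \notin T -> j != b -> at_label x j = 0.
    move=> jl jT jb; apply: xs => //; rewrite inE (negbTE jb) /= mem_filter negb_and.
    by rewrite jT orbT.
  have /tnthP[i yi] := yT.
  have xi : onT x i = 0.
    apply: xs => //; rewrite inE Tb /= mem_filter yi eqxx //.
  split=> //; [by move=> k; apply: x0 | by apply: x0 | by rewrite -sum_onT |].
  apply/le_anti/andP; split; first by rewrite -xi min4_le.
  by have [k ->] := min4_attained (onT x); apply: x0.
move=> [x0 xb x1 m0 xo]; apply/(realizationP _ lS); split.
- move=> j jl; have [/tnthP[i ->]|jT] := boolP (j \in val T); first exact: x0.
  by have [->//|jb] := eqVneq j b; rewrite xo.
- by rewrite sum_onT.
- have [i e] := min4_attained (onT x).
  exists (b :: [seq x <- val T | x != tnth T i]); first by apply/map_f/mem_tnth.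
  move=> j jl; rewrite inE negb_or mem_filter negb_and negbK => /andP[jb /orP[/eqP ->|jT]].
    by rewrite -[LHS]/(onT x i) -e m0.
  by rewrite xo.
Qed.

Definition starred_of (z : 'rV[R]_3) : space :=
  spread (1 - norm2 z) (fun i => dual beta i (radial_inv 1 z) + 4^-1 * norm2 z).

Lemma min4_dual u d : level u = 4 * d -> min4 (fun i => dual beta i u + d) = 0.
Proof.
move=> gd; apply/le_anti/andP; split.
  have [i e] := min4_attained (fun i => dual beta i u).
  apply: le_trans (min4_le _ i) _; rewrite -e.
  by move: gd; rewrite /gauge; lra.
by have [i ->] := min4_attained (fun i => dual beta i u + d); have := gauge_ge beta i u; lra.
Qed.

(** On the star of b some coordinate on T is 0, so that the gauge of the image is 1 - x_b, which
    recovers x_b and then, by the dual forms, the other coordinates. *)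
Lemma starred_ball :
  mutually_inverse (realization (cplx starred)) (@unit_ball R 3) ball_of starred_of.
Proof.
split; first exact: cts_ball_of.
- apply: cts_spread; first by apply: ctsB; [exact: ctsc | exact: cts_norm2].
  move=> i; apply: ctsD; last by apply: ctsM; [exact: ctsc | exact: cts_norm2].
  by apply: (cts_comp cts_inv1); exact: cts_dual.
- split=> [x /in_starred[x0 xb x1 m0 _]|z /unit_ballE z1].
    by apply/unit_ballE; rewrite (radial_norm dual_sum) gauge_combine m0; lra.
  have onE : onT (starred_of z) = fun i => dual beta i (radial_inv 1 z) + 4^-1 * norm2 z.
    by apply/funext => i; exact: onT_spread.
  have m0 : min4 (onT (starred_of z)) = 0.
    by rewrite onE min4_dual // gauge_inv; field.
  apply/in_starred; split=> //.
  + by move=> i; rewrite -m0 min4_le.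
  + by rewrite b_spread subr_ge0.
  + by rewrite b_spread onE sum_dual_shift; field.
  + by move=> j jl jT jb; rewrite off_spread.
- move=> x /in_starred[x0 xb x1 m0 xo]; rewrite /starred_of /ball_of inv_radial.
  rewrite (radial_norm dual_sum) gauge_combine m0 mulr0 subr0 -[RHS]spreadE //.
  congr spread; first by lra.
  by apply/funext => i; rewrite dual_combine subrK.
- by move=> z _; rewrite /ball_of /starred_of combine_spread radial_of.
Qed.

Definition sphere_facets : seq (seq nat) := val T :: starred.

Let in_sphere (x : space) : realization (cplx sphere_facets) x <->
  [/\ forall i, 0 <= onT x i, 0 <= at_label x b, \sum_i onT x i + at_label x b = 1,
      min4 (onT x) = 0 \/ at_label x b = 0
    & forall j, (j < 17)%N -> j \notin T -> j != b -> at_label x j = 0].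
Proof.
have lS : all labels starred by case/andP: labS.
split.
  move=> h; have [x0 x1 [s + xs]] := (realizationP _ labS).1 h; rewrite inE => /orP[/eqP es|sS].
    rewrite {s}es in xs.
    split=> //; [by move=> i; apply: x0 | by apply: x0 | | by right; apply: xs |].
      by rewrite -sum_onT // => j jl jT _; exact: xs.
    by move=> j jl jT _; exact: xs.
  have /in_starred[? ? ? ? ?] : realization (cplx starred) x.
    by apply/(realizationP _ lS); split=> //; exists s.
  by split=> //; left.
move=> [x0 xb x1 [m0|b0] xo].
  have /(realizationP _ lS)[h1 h2 [s sS xs]] : realization (cplx starred) x by apply/in_starred.
  by apply/(realizationP _ labS); split=> //; exists s; rewrite // inE sS orbT.
apply/(realizationP _ labS); split.
- move=> j jl; have [/tnthP[i ->]|jT] := boolP (j \in val T); first exact: x0.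
  by have [->//|jb] := eqVneq j b; rewrite xo.
- by rewrite sum_onT.
- exists (val T); first by rewrite inE eqxx.
  by move=> j jl jT; have [->|jb] := eqVneq j b; rewrite ?b0 // xo.
Qed.

(** Zero exactly on the boundary of T, negative on the star of b and positive inside T. The
    quadratic forms are those that make the point of the sphere have norm 1, for the radial part
    has norm 1 - x_b on the star of b and 1 - 4 min on T. *)
Definition height (x : space) : R :=
  (1 - (1 - 4 * min4 (onT x)) ^+ 2) - (1 - (1 - at_label x b) ^+ 2).

(** The star of the apex goes to the lower hemisphere, the facet opposite to it to the upper
    one; stereographic projections from the opposite poles take both onto the same ball. *)
Definition sphere_of (x : space) : 'rV[R]_4 :=
  \row_k ((if (k < 3)%N then 2 * ball_of x ord0 (inord k) else height x)
          / (1 + sqnorm (ball_of x))).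

(** The last coordinate w tells the hemisphere. Stereographic projection from the opposite pole
    gives Z, and the coordinate at b, which is 0 on the upper hemisphere, is 1 minus the norm of Z
    on the lower one. *)
Definition sphere_inv (y : 'rV[R]_4) : space :=
  let w := y ord0 ord_max in
  let Z := \row_i (y ord0 (widen_ord (leqnSn 3) i) / (1 + `|w|)) : 'rV[R]_3 in
  let m := Num.max 0 (- w) in
  let c := 1 - Num.sqrt ((1 - m) / (1 + m)) in
  spread c (fun i => dual beta i (radial_inv 1 Z) + 4^-1 * (1 - c)).

Let sqn_pos (z : 'rV[R]_3) : 0 < 1 + sqnorm z.
Proof. by have := sqnorm_ge0 z; lra. Qed.

Lemma sphere_of_low x i :
  sphere_of x ord0 (widen_ord (leqnSn 3) i) = 2 * ball_of x ord0 i / (1 + sqnorm (ball_of x)).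
Proof. by rewrite mxE /= ltn_ord; congr (2 * ball_of x ord0 _ / _); apply/val_inj; rewrite /= inordK. Qed.

Lemma sphere_of_max x : sphere_of x ord0 ord_max = height x / (1 + sqnorm (ball_of x)).
Proof. by rewrite mxE. Qed.

Lemma sqnorm4 (y : 'rV[R]_4) : sqnorm y =
  \sum_(i < 3) y ord0 (widen_ord (leqnSn 3) i) ^+ 2 + y ord0 ord_max ^+ 2.
Proof. by rewrite /sqnorm big_ord_recr. Qed.

Let cts_min4 : continuous (fun x : space => min4 (onT x)).
Proof.
rewrite /min4; move: (index_enum _) (ord0 : 'I_4) => s j.
elim: s => [|i s IH].
  have -> : (fun x => \big[Num.min/onT x j]_(i <- [::]) onT x i) = fun x => onT x j.
    by apply/funext => u; rewrite big_nil.
  exact: cts_at_label.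
have -> : (fun x => \big[Num.min/onT x j]_(i0 <- (i :: s)) onT x i0) =
    fun x => Num.min (onT x i) (\big[Num.min/onT x j]_(i <- s) onT x i).
  by apply/funext => u; rewrite big_cons.
by apply: cts_min => //; exact: cts_at_label.
Qed.

Lemma cts_sphere_of : continuous sphere_of.
Proof.
have cq : continuous (fun x => sqnorm (ball_of x)).
  have -> : (fun x => sqnorm (ball_of x)) = fun x => norm2 (ball_of x) * norm2 (ball_of x).
    by apply/funext => x; rewrite -norm2_sqr expr2.
  by apply: ctsM; apply: (cts_comp cts_ball_of); exact: cts_norm2.
have csq (f : space -> R) : continuous f -> continuous (fun x => 1 - (1 - f x) ^+ 2).
  move=> cf; have -> : (fun x => 1 - (1 - f x) ^+ 2) = fun x => 1 - (1 - f x) * (1 - f x).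
    by apply/funext => x; rewrite expr2.
  by apply: ctsB; [exact: ctsc | apply: ctsM; apply: ctsB => //; exact: ctsc].
apply: cts_row => k.
have -> : (fun x => sphere_of x ord0 k) = fun x =>
    (if (k < 3)%N then 2 * ball_of x ord0 (inord k) else height x) * (1 + sqnorm (ball_of x))^-1.
  by apply/funext => x; rewrite mxE.
apply: ctsM; last first.
  apply: ctsV => [x|]; first by rewrite gt_eqF.
  by apply: ctsD => //; exact: ctsc.
apply: cts_if.
  by apply: ctsM; [exact: ctsc | apply: cts_coord; exact: cts_ball_of].
apply: ctsB; apply: csq; last exact: cts_at_label.
by apply: ctsM => //; exact: ctsc.
Qed.

Lemma cts_sphere_inv : continuous sphere_inv.
Proof.
have cw : continuous (fun y : 'rV[R]_4 => y ord0 ord_max) by apply: cts_coord; exact: cts_id.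
have cn : continuous (fun y : 'rV[R]_4 => (1 + `|y ord0 ord_max|)^-1).
  apply: ctsV => [y|]; first by rewrite gt_eqF // ltr_pwDl.
  by apply: ctsD; [exact: ctsc | exact: cts_norm].
have cZ : continuous (fun y : 'rV[R]_4 =>
    (\row_i (y ord0 (widen_ord (leqnSn 3) i) / (1 + `|y ord0 ord_max|)) : 'rV[R]_3)).
  apply: cts_row => k.
  have -> : (fun y : 'rV[R]_4 => (\row_i (y ord0 (widen_ord (leqnSn 3) i) / (1 + `|y ord0 ord_max|)) : 'rV[R]_3) ord0 k)
      = fun y => y ord0 (widen_ord (leqnSn 3) k) * (1 + `|y ord0 ord_max|)^-1.
    by apply/funext => y; rewrite mxE.
  by apply: ctsM => //; apply: cts_coord; exact: cts_id.
have cm : continuous (fun y : 'rV[R]_4 => Num.max 0 (- y ord0 ord_max)).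
  by apply: cts_max; [exact: ctsc | exact: ctsN].
have cc : continuous (fun y : 'rV[R]_4 => 1 - Num.sqrt ((1 - Num.max 0 (- y ord0 ord_max)) / (1 + Num.max 0 (- y ord0 ord_max)))).
  apply: ctsB; first exact: ctsc.
  apply: cts_sqrt; apply: ctsM; first by apply: ctsB => //; exact: ctsc.
  apply: ctsV => [y|]; last by apply: ctsD => //; exact: ctsc.
  by rewrite gt_eqF // ltr_pwDl // le_max lexx.
apply: cts_spread => // i; apply: ctsD; last first.
  by apply: ctsM; [exact: ctsc | apply: ctsB => //; exact: ctsc].
by apply: (cts_comp (cts_comp cZ cts_inv1)); exact: cts_dual.
Qed.

Let sqnorm_ball (x : space) : sqnorm (ball_of x) = (\sum_i onT x i - 4 * min4 (onT x)) ^+ 2.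
Proof. by rewrite -norm2_sqr (radial_norm dual_sum) gauge_combine. Qed.

Let height_cases (x : space) : realization (cplx sphere_facets) x ->
  let q := sqnorm (ball_of x) in q <= 1 /\
  (min4 (onT x) = 0 /\ height x = q - 1 /\ norm2 (ball_of x) = 1 - at_label x b
   \/ at_label x b = 0 /\ height x = 1 - q).
Proof.
move=> /in_sphere[x0 xb x1 alt _] q.
have mn : 0 <= min4 (onT x) by have [i ->] := min4_attained (onT x); exact: x0.
have qE : q = (\sum_i onT x i - 4 * min4 (onT x)) ^+ 2 := sqnorm_ball x.
have nE : norm2 (ball_of x) = \sum_i onT x i - 4 * min4 (onT x).
  by rewrite (radial_norm dual_sum) gauge_combine.
have n0 : 0 <= norm2 (ball_of x) := norm2_ge0 _.
have sE : \sum_i onT x i = 1 - at_label x b by lra.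
split.
  by rewrite qE -nE expr_le1 //; rewrite nE sE; lra.
case: alt => [m0|b0]; [left | right]; split=> //.
  split; last by rewrite nE m0 sE; lra.
  by rewrite qE /height m0 sE; ring.
by rewrite qE /height b0 sE b0; ring.
Qed.

Let inv_cases (y : 'rV[R]_4) : unit_sphere y ->
  let w := y ord0 ord_max in
  let Z := \row_i (y ord0 (widen_ord (leqnSn 3) i) / (1 + `|w|)) : 'rV[R]_3 in
  let x := sphere_inv y in
  [/\ norm2 Z <= 1, sqnorm Z = (1 - `|w|) / (1 + `|w|), combine x = radial_inv 1 Z &
   w <= 0 /\ x = spread (1 - norm2 Z) (fun i => dual beta i (radial_inv 1 Z) + 4^-1 * norm2 Z)
   \/ 0 <= w /\ x = spread 0 (fun i => dual beta i (radial_inv 1 Z) + 4^-1)].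
Proof.
rewrite /unit_sphere /= sqnorm4 => y1 /=.
set w := y ord0 ord_max in y1 *; set Z := \row_i _.
have n0 : 0 <= `|w| := normr_ge0 w.
have n1 : `|w| <= 1.
  rewrite -(@expr_le1 _ 2) // real_normK ?num_real // -y1 lerDr.
  by apply: sumr_ge0 => i _; exact: sqr_ge0.
have qE : sqnorm Z = (1 - `|w|) / (1 + `|w|).
  have -> : sqnorm Z = (1 - w ^+ 2) / (1 + `|w|) ^+ 2.
    have -> : 1 - w ^+ 2 = \sum_(i < 3) y ord0 (widen_ord (leqnSn 3) i) ^+ 2 by lra.
    rewrite /sqnorm mulr_suml; apply: eq_bigr => i _.
    by rewrite mxE expr_div_n.
  rewrite -(real_normK (num_real w)).
  by field; rewrite gt_eqF //; lra.
have rE : norm2 Z = Num.sqrt ((1 - `|w|) / (1 + `|w|)) by rewrite -qE.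
have r1 : norm2 Z <= 1.
  rewrite -(@expr_le1 _ 2) ?norm2_ge0 // norm2_sqr qE ler_pdivrMr; lra.
have cE c : combine (spread c (fun i => dual beta i (radial_inv 1 Z) + 4^-1 * (1 - c))) = radial_inv 1 Z.
  exact: combine_spread.
split=> //; first exact: cE.
have [w0|w0] := leP w 0; [left | right].
  split=> //; rewrite /sphere_inv -/w -/Z.
  have -> : Num.max 0 (- w) = `|w| by rewrite ler0_norm //; apply/max_idPr; lra.
  by rewrite -rE subKr.
split; first exact: ltW.
rewrite /sphere_inv -/w -/Z.
have -> : Num.max 0 (- w) = 0 by apply/max_idPl; lra.
by rewrite subr0 addr0 divr1 sqrtr1 subrr subr0 mulr1.
Qed.

Lemma sphere_model :
  mutually_inverse (realization (cplx sphere_facets)) (@unit_sphere R 3) sphere_of sphere_inv.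
Proof.
split; [exact: cts_sphere_of | exact: cts_sphere_inv | split | |].
- move=> x /height_cases[q1 h]; rewrite /unit_sphere /= sqnorm4 sphere_of_max.
  set q := sqnorm (ball_of x) in q1 h *; have qp : 0 < 1 + q := sqn_pos _.
  have -> : \sum_(i < 3) sphere_of x ord0 (widen_ord (leqnSn 3) i) ^+ 2 = (2 / (1 + q)) ^+ 2 * q.
    rewrite {2}/q /sqnorm mulr_sumr; apply: eq_bigr => i _.
    by rewrite sphere_of_low -/q; ring.
  have [-> |->] : height x = q - 1 \/ height x = 1 - q by case: h => [[_ [? _]]|[_ ?]]; [left|right].
    by field; rewrite gt_eqF.
  by field; rewrite gt_eqF.
- move=> y /inv_cases; set w := y _ _ => /=; set Z := \row_i _; case=> r1 qE cE alt.
  set u := radial_inv 1 Z in cE alt *; have gu : level u = norm2 Z by exact: gauge_inv.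
  have n0 := norm2_ge0 Z.
  case: alt => -[w0 xE]; rewrite {}xE; apply/in_sphere.
    have onE : onT (spread (1 - norm2 Z) (fun i => dual beta i u + 4^-1 * norm2 Z)) =
        fun i => dual beta i u + 4^-1 * norm2 Z by apply/funext => i; exact: onT_spread.
    have m0 : min4 (fun i => dual beta i u + 4^-1 * norm2 Z) = 0.
      by rewrite min4_dual // gu; field.
    rewrite onE b_spread m0 sum_dual_shift; split.
    + by move=> i; have := min4_le (fun i => dual beta i u + 4^-1 * norm2 Z) i; rewrite m0.
    + by rewrite subr_ge0.
    + by field.
    + by left.
    + by move=> j jl jT jb; rewrite off_spread.
  have onE : onT (spread 0 (fun i => dual beta i u + 4^-1)) =
      fun i => dual beta i u + 4^-1 by apply/funext => i; exact: onT_spread.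
  rewrite onE b_spread sum_dual_shift; split.
  + by move=> i; have := gauge_ge beta i u; rewrite gu; lra.
  + exact: lexx.
  + by field.
  + by right.
  + by move=> j jl jT jb; rewrite off_spread.
- move=> x Kx; have [q1 h] := height_cases Kx; have [_ _ x1 _ xo] := (in_sphere x).1 Kx.
  set q := sqnorm (ball_of x) in q1 h *; have qp : 0 < 1 + q := sqn_pos _.
  have q0 : 0 <= q := sqnorm_ge0 _.
  have nw : `|height x / (1 + q)| = (1 - q) / (1 + q).
    rewrite normrM normfV (gtr0_norm qp); congr (_ / _).
    by case: h => [[_ [-> _]]|[_ ->]]; [rewrite distrC|]; rewrite ger0_norm // subr_ge0.
  rewrite /sphere_inv sphere_of_max -/q nw.
  have -> : (\row_i (sphere_of x ord0 (widen_ord (leqnSn 3) i) / (1 + (1 - q) / (1 + q))) : 'rV[R]_3) = ball_of x.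
    apply/rowP => i; rewrite mxE sphere_of_low -/q; field.
    by rewrite !gt_eqF //=; lra.
  have -> : radial_inv 1 (ball_of x) = combine x by exact: inv_radial.
  have -> : 1 - Num.sqrt ((1 - Num.max 0 (- (height x / (1 + q)))) / (1 + Num.max 0 (- (height x / (1 + q)))))
      = at_label x b.
    case: h => [[m0 [hE nE]]|[b0 hE]].
      have -> : Num.max 0 (- (height x / (1 + q))) = (1 - q) / (1 + q).
        have -> : - (height x / (1 + q)) = (1 - q) / (1 + q) by rewrite hE; field; rewrite gt_eqF.
        by apply/max_idPr; rewrite divr_ge0 ?subr_ge0 // ltW.
      have -> : (1 - (1 - q) / (1 + q)) / (1 + (1 - q) / (1 + q)) = q.
        by field; rewrite !gt_eqF //=; lra.
      by rewrite -[Num.sqrt q]/(norm2 (ball_of x)) nE subKr.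
    have -> : Num.max 0 (- (height x / (1 + q))) = 0.
      apply/max_idPl; rewrite hE oppr_le0 divr_ge0 ?subr_ge0 // ltW //.
    by rewrite b0 subr0 addr0 divr1 sqrtr1 subrr.
  rewrite -[RHS]spreadE //; congr spread; apply/funext => i.
  by rewrite dual_combine; have -> : \sum_j onT x j = 1 - at_label x b; [lra | rewrite subrK].
- move=> y Sy; have := inv_cases Sy; set w := y _ _ => /=; set Z := \row_i _; case=> r1 qE cE alt.
  set x := sphere_inv y in cE alt *; set u := radial_inv 1 Z in cE alt *.
  have bE : ball_of x = Z by rewrite /ball_of cE radial_of.
  have gu : level u = norm2 Z by exact: gauge_inv.
  have n0 : 0 <= `|w| := normr_ge0 w.
  have hE : height x / (1 + sqnorm Z) = w.
    have -> : height x = if w <= 0 then sqnorm Z - 1 else 1 - sqnorm Z.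
      have g4 : level (combine x) = norm2 Z by rewrite cE.
      rewrite gauge_combine in g4.
      case: alt => -[w0 xE].
        have xb : at_label x b = 1 - norm2 Z by rewrite xE b_spread.
        have m0 : min4 (onT x) = 0.
          have -> : onT x = fun i => dual beta i u + 4^-1 * norm2 Z.
            by apply/funext => i; rewrite xE onT_spread.
          by rewrite min4_dual // gu; field.
        by rewrite w0 /height xb m0 -norm2_sqr; ring.
      have xb : at_label x b = 0 by rewrite xE b_spread.
      have sE : \sum_i onT x i = 1.
        by rewrite xE; under eq_bigr => i _ do rewrite onT_spread; rewrite sum_dual_shift; field.
      have mE : 4 * min4 (onT x) = 1 - norm2 Z by lra.
      have -> : height x = 1 - sqnorm Z by rewrite /height xb mE -norm2_sqr; ring.
      case: ifP => // w0'; have w00 : w = 0 by apply/le_anti; rewrite w0' w0.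
      by rewrite qE w00 normr0; field.
    rewrite qE; case: ifP => [w0|/negbT]; [rewrite ler0_norm // | rewrite -ltNge => w0; rewrite gtr0_norm //];
      field; rewrite !gt_eqF //=; lra.
  apply/rowP => k; have [k3|k3] := ltnP k 3.
    have -> : k = widen_ord (leqnSn 3) (Ordinal k3) by apply/val_inj.
    rewrite sphere_of_low bE qE mxE -/w; field.
    by rewrite !gt_eqF //=; lra.
  have -> : k = ord_max by apply/val_inj/anti_leq; rewrite /= k3 -ltnS ltn_ord.
  by rewrite sphere_of_max bE.
Qed.

(** On the star of b the map to the sphere is the inverse of the stereographic projection, so that
    knots there look the same in the ball and in the sphere. *)
Lemma stereographic_sphere x : realization (cplx starred) x ->
  sphere_of x ord0 ord_max <> 1 /\ stereographic (sphere_of x) = ball_of x.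
Proof.
move=> /in_starred[x0 xb x1 m0 _].
have q := sqnorm_ball x; have qp := sqn_pos (ball_of x).
have hE : height x = sqnorm (ball_of x) - 1.
  by rewrite q /height m0; have -> : \sum_i onT x i = 1 - at_label x b; [lra | ring].
split; first by rewrite sphere_of_max hE => e; have := mulfVK (lt0r_neq0 qp) (sqnorm (ball_of x) - 1); rewrite e; lra.
apply/rowP => i; rewrite mxE sphere_of_low sphere_of_max hE; field.
by rewrite !gt_eqF //=; lra.
Qed.
End Models.

(** * Paths of edges, and the circle *)

Definition hvertex (i : nat) : seq Z :=
  rcons [seq (if k == i then Z.pos xH else Z0) | k <- iota 0 17] (Z.pos xH).

Fixpoint edge_list (u : nat) (P : seq nat) : seq (seq nat) :=
  if P is v :: P' then [:: u; v] :: edge_list v P' else [::].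

Section Paths.
Variable R : realType.
Notation space := 'rV[R]_17.

Lemma coordinate_hvertex i k : (k < 17)%N -> coordinate (hvertex i) k = if k == i then Z.pos xH else Z0.
Proof.
by move=> kl; rewrite /coordinate nth_rcons size_map size_iota kl (nth_map 0%N) ?size_iota // nth_iota.
Qed.

Lemma coordinate_hvertex17 i : coordinate (hvertex i) 17 = Z.pos xH.
Proof. by rewrite /coordinate nth_rcons size_map size_iota ltnn eqxx. Qed.

Lemma wf17_hvertex i : wf17 (hvertex i).
Proof. by rewrite /wf17 size_rcons size_map size_iota /proper coordinate_hvertex17. Qed.

Lemma at_hvertex i k : (k < 17)%N -> at_label (hpoint R 17 (hvertex i)) k = (k == i)%:R.
Proof.
move=> kl; rewrite at_hpoint // coordinate_hvertex17 coordinate_hvertex //.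
by case: (k == i); rewrite /zr /= ?mul0r ?divr1.
Qed.

Lemma realization_cat F G : all labels F -> all labels G ->
  realization (R := R) (cplx (F ++ G)) = realization (cplx F) `|` realization (cplx G).
Proof.
move=> lF lG; have lFG : all labels (F ++ G) by rewrite all_cat lF.
apply/seteqP; split=> x.
  move=> /(realizationP _ lFG)[x0 x1 [s + xs]]; rewrite mem_cat => /orP[sF|sG].
    by left; apply/(realizationP _ lF); split=> //; exists s.
  by right; apply/(realizationP _ lG); split=> //; exists s.
case=> [/(realizationP _ lF)|/(realizationP _ lG)] [x0 x1 [s sF xs]];
  by apply/(realizationP _ lFG); split=> //; exists s; rewrite // mem_cat sF ?orbT.
Qed.

Lemma at_label_eq (x y : space) :
  (forall k, (k < 17)%N -> at_label x k = at_label y k) -> x = y.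
Proof.
move=> e; apply/rowP => k; have := e (val k) (ltn_ord k).
by rewrite /at_label label_val.
Qed.

Lemma at_labelD a b (x y : space) k :
  at_label (a *: x + b *: y) k = a * at_label x k + b * at_label y k.
Proof. by rewrite /at_label !mxE. Qed.

Lemma sum_at_label (x : space) : \sum_j x ord0 j = \sum_(j < 17) at_label x j.
Proof. by apply: eq_bigr => j _; rewrite /at_label label_val. Qed.

Lemma realization_edge i j : (i < 17)%N -> (j < 17)%N -> i != j ->
  realization (cplx [:: [:: i; j]]) = seg (hpoint R 17 (hvertex i)) (hpoint R 17 (hvertex j)).
Proof.
move=> il jl ij; have lF : all labels [:: [:: i; j]] by rewrite /= il jl.
have two (f : 'I_17 -> R) : (forall k : 'I_17, val k != i -> val k != j -> f k = 0) ->
    \sum_k f k = f (label i) + f (label j).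
  move=> f0; rewrite (bigD1 (label i)) //= (bigD1 (label j)) /=; last first.
    by rewrite -val_eqE !val_label // eq_sym.
  rewrite big1 ?addr0 // => k /andP[ki kj].
  apply: f0; [apply: contra ki | apply: contra kj] => /eqP e;
    by apply/eqP/val_inj; rewrite val_label.
apply/seteqP; split=> x.
  move=> /(realizationP _ lF)[x0 x1 [s]]; rewrite inE => /eqP -> xs.
  have sum1 : at_label x i + at_label x j = 1.
    rewrite -x1 sum_at_label (two (fun k => at_label x k)) ?val_label //.
    by move=> k ki kj; apply: xs; rewrite ?ltn_ord // !inE negb_or ki.
  have xi := x0 i il; have xj := x0 j jl.
  apply/segP; exists (at_label x j); first by apply/andP; split; lra.
  apply: at_label_eq => k kl; rewrite at_labelD !at_hvertex //.
  have [->|ki] := eqVneq k i; first by rewrite (negbTE ij) mulr0 addr0 mulr1; lra.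
  have [->|kj] := eqVneq k j; first by rewrite mulr0 add0r mulr1.
  by rewrite !mulr0 addr0 xs // !inE negb_or ki.
move=> /segP[t /andP[t0 t1] <-]; set y := _ + _.
have yE k : (k < 17)%N -> at_label y k = (1 - t) * (k == i)%:R + t * (k == j)%:R.
  by move=> kl; rewrite at_labelD !at_hvertex.
apply/(realizationP _ lF); split.
- by move=> k kl; rewrite yE // addr_ge0 // mulr_ge0 // subr_ge0.
- rewrite sum_at_label (two (fun k => at_label y k)) ?val_label ?yE //.
    by rewrite !eqxx [j == i]eq_sym (negbTE ij) /= !mulr1 !mulr0 addr0 add0r subrK.
  by move=> k ki kj; rewrite yE ?ltn_ord // (negbTE ki) (negbTE kj) !mulr0 addr0.
- exists [:: i; j]; first by rewrite inE.
  move=> k kl; rewrite !inE negb_or => /andP[ki kj].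
  by rewrite yE // (negbTE ki) (negbTE kj) !mulr0 addr0.
Qed.

Lemma labels_edge_list u P : labels (u :: P) -> all labels (edge_list u P).
Proof.
by elim: P u => //= v P IH u /and3P[ul vl Pl]; rewrite ul vl IH //= vl.
Qed.

Lemma realization_path u P : labels (u :: P) -> all (fun e => if e is [:: i; j] then i != j else true) (edge_list u P) ->
  realization (cplx (edge_list u P)) = hchain R 17 (hvertex u) (map hvertex P).
Proof.
elim: P u => [|v P IH] u lP.
  move=> _; apply/seteqP; split=> // x xF.
  by have [_ _ [s]] := (realizationP x (isT : all labels [::])).1 xF.
move=> /= /andP[uv dP]; have /and3P[ul vl Pl] := lP.
rewrite -cat1s realization_cat ?labels_edge_list //=; try by rewrite ?ul ?vl.
by rewrite realization_edge // IH //= vl.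
Qed.

(** The circle: squares of the positive and negative parts of the two coordinates are the
    barycentric coordinates on a cycle of four edges. *)
Definition square_cycle : seq (seq nat) := [:: [:: 1; 2]; [:: 2; 0]; [:: 0; 3]; [:: 3; 1]].

Definition to_circle (x : space) : 'rV[R]_2 :=
  \row_k (if k == ord0 then Num.sqrt (at_label x 1) - Num.sqrt (at_label x 0)
          else Num.sqrt (at_label x 2) - Num.sqrt (at_label x 3)).

Definition pos_part (s : R) : R := Num.max 0 s.

Definition from_circle (y : 'rV[R]_2) : space :=
  let s := y ord0 ord0 in let t := y ord0 ord_max in
  \row_j ((val j == 1)%:R * pos_part s ^+ 2 + (val j == 0)%:R * pos_part (- s) ^+ 2
        + (val j == 2)%:R * pos_part t ^+ 2 + (val j == 3)%:R * pos_part (- t) ^+ 2).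

Lemma cts_from_circle : continuous from_circle.
Proof.
have cpp (f : 'rV[R]_2 -> R) : continuous f -> continuous (fun y => pos_part (f y) ^+ 2).
  move=> cf; have -> : (fun y => pos_part (f y) ^+ 2) = fun y => pos_part (f y) * pos_part (f y).
    by apply/funext => y; rewrite expr2.
  by apply: ctsM; apply: cts_max => //; exact: ctsc.
have cy i : continuous (fun y : 'rV[R]_2 => y ord0 i) by apply: cts_coord; exact: cts_id.
apply: cts_row => j.
have -> : (fun y => from_circle y ord0 j) = fun y : 'rV[R]_2 =>
   (val j == 1)%:R * pos_part (y ord0 ord0) ^+ 2 + (val j == 0)%:R * pos_part (- y ord0 ord0) ^+ 2
        + (val j == 2)%:R * pos_part (y ord0 ord_max) ^+ 2 + (val j == 3)%:R * pos_part (- y ord0 ord_max) ^+ 2.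
  by apply/funext => y; rewrite mxE.
do 3?[apply: ctsD]; apply: ctsM; (try exact: ctsc); apply: cpp; (try exact: cy); apply: ctsN; exact: cy.
Qed.

Lemma cts_to_circle : continuous to_circle.
Proof.
apply: cts_row => k.
have -> : (fun x => to_circle x ord0 k) = fun x =>
    if k == ord0 then Num.sqrt (at_label x 1) - Num.sqrt (at_label x 0)
          else Num.sqrt (at_label x 2) - Num.sqrt (at_label x 3).
  by apply/funext => x; rewrite mxE.
by apply: cts_if; apply: ctsB; apply: cts_sqrt; apply: cts_coord; exact: cts_id.
Qed.

(** On an edge of the cycle one coordinate of each pair of opposite vertices is 0, so that the
    differences of square roots recover both. *)
Lemma circle_model :
  mutually_inverse (@unit_sphere R 1) (realization (cplx square_cycle)) from_circle to_circle.
Proof.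
have lF : all labels square_cycle by [].
have pp (s : R) : pos_part s ^+ 2 + pos_part (- s) ^+ 2 = s ^+ 2.
  rewrite /pos_part; case: (leP 0 s) => s0; case: (leP 0 (- s)) => s1; try ring; nra.
have pn (s : R) : pos_part s = 0 \/ pos_part (- s) = 0.
  by rewrite /pos_part; case: (leP 0 s) => s0; [right; apply/max_idPl; lra | left].
have pm (s : R) : pos_part s - pos_part (- s) = s.
  by rewrite /pos_part; case: (leP 0 s) => s0; case: (leP 0 (- s)) => s1; lra.
have p0 (s : R) : 0 <= pos_part s by rewrite le_max lexx.
have atE y k : (k < 17)%N -> at_label (from_circle y) k =
   (k == 1%N)%:R * pos_part (y ord0 ord0) ^+ 2 + (k == 0%N)%:R * pos_part (- y ord0 ord0) ^+ 2
   + (k == 2)%:R * pos_part (y ord0 ord_max) ^+ 2 + (k == 3)%:R * pos_part (- y ord0 ord_max) ^+ 2.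
  by move=> kl; rewrite /at_label mxE val_label.
have far y k : (3 < k)%N -> (k < 17)%N -> at_label (from_circle y) k = 0.
  move=> k3 kl; rewrite atE //.
  have [-> -> -> ->] : [/\ (k == 1%N) = false, (k == 0%N) = false, (k == 2) = false & (k == 3) = false].
    by split; lia.
  by rewrite !mulr0n !mul0r !addr0.
have [y1 y0 y2 y3] : [/\ forall y, at_label (from_circle y) 1 = pos_part (y ord0 ord0) ^+ 2,
   forall y, at_label (from_circle y) 0 = pos_part (- y ord0 ord0) ^+ 2,
   forall y, at_label (from_circle y) 2 = pos_part (y ord0 ord_max) ^+ 2 &
   forall y, at_label (from_circle y) 3 = pos_part (- y ord0 ord_max) ^+ 2].
  by split=> y; rewrite atE //= !mul0r ?mul1r ?addr0 ?add0r.
have four (f : 'I_17 -> R) : (forall k : 'I_17, (3 < val k)%N -> f k = 0) ->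
    \sum_k f k = f (label 0) + f (label 1) + f (label 2) + f (label 3).
  move=> f0; rewrite (bigD1 (label 0)) // (bigD1 (label 1)) /=; last first.
    by rewrite -val_eqE !val_label.
  rewrite (bigD1 (label 2)) /=; last by rewrite -!val_eqE !val_label.
  rewrite (bigD1 (label 3)) /=; last by rewrite -!val_eqE !val_label.
  rewrite big1 ?addr0 ?addrA // => k /andP[/andP[/andP[k0 k1] k2] k3]; apply: f0.
  move: k0 k1 k2 k3; rewrite -!val_eqE !val_label //.
  by case: (val k) => [|[|[|[|n]]]].
have sq (y : 'rV[R]_2) : sqnorm y = y ord0 ord0 ^+ 2 + y ord0 ord_max ^+ 2.
  rewrite /sqnorm big_ord_recr big_ord1 /=; congr (y _ _ ^+ 2 + _).
  exact: val_inj.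
have facts (x : space) : realization (cplx square_cycle) x ->
    [/\ forall k, (k < 17)%N -> 0 <= at_label x k,
        at_label x 0 + at_label x 1 + at_label x 2 + at_label x 3 = 1,
        forall k, (3 < k)%N -> (k < 17)%N -> at_label x k = 0,
        at_label x 0 = 0 \/ at_label x 1 = 0 & at_label x 2 = 0 \/ at_label x 3 = 0].
  move=> /(realizationP _ lF)[x0 x1 [s sF xs]].
  have big k : (3 < k)%N -> (k < 17)%N -> at_label x k = 0.
    move=> k3 kl; apply: xs => //.
    by move: sF; rewrite !inE => /or4P[] /eqP ->; case: k k3 kl => [|[|[|[|k]]]].
  split=> //.
  - have := x1; rewrite sum_at_label (four (fun k => at_label x k)) ?val_label //.
    by move=> k k3; apply: big; rewrite ?ltn_ord.
  - by move: sF; rewrite !inE => /or4P[] /eqP es; [left | right | right | left]; apply: xs; rewrite // es.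
  - by move: sF; rewrite !inE => /or4P[] /eqP es; [right | right | left | left]; apply: xs; rewrite // es.
have roots (x : space) : realization (cplx square_cycle) x ->
    [/\ pos_part (to_circle x ord0 ord0) = Num.sqrt (at_label x 1),
        pos_part (- to_circle x ord0 ord0) = Num.sqrt (at_label x 0),
        pos_part (to_circle x ord0 ord_max) = Num.sqrt (at_label x 2) &
        pos_part (- to_circle x ord0 ord_max) = Num.sqrt (at_label x 3)].
  move=> /facts[x0 _ _ x01 x23].
  have r0 k := sqrtr_ge0 (at_label x k).
  have [e0 e1] : to_circle x ord0 ord0 = Num.sqrt (at_label x 1) - Num.sqrt (at_label x 0) /\
         to_circle x ord0 ord_max = Num.sqrt (at_label x 2) - Num.sqrt (at_label x 3).
    by split; rewrite mxE.
  have pp0 (s : R) : 0 <= s -> pos_part s = s by move=> s0; apply/max_idPr.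
  have pn0 (s : R) : s <= 0 -> pos_part s = 0 by move=> s0; apply/max_idPl.
  rewrite e0 e1; have z0 (a b : R) : 0 <= a -> 0 <= b -> a = 0 \/ b = 0 ->
      pos_part (a - b) = a /\ pos_part (- (a - b)) = b.
    move=> a0 b0 [->|->]; first by rewrite sub0r opprK (pn0 (- b)) ?pp0 ?oppr_le0.
    by rewrite subr0 (pn0 (- a)) ?pp0 ?oppr_le0.
  have s0 (a b : R) : a = 0 \/ b = 0 -> Num.sqrt a = 0 \/ Num.sqrt b = 0.
    by case=> ->; rewrite sqrtr0; [left | right].
  have [] := z0 _ _ (r0 1%N) (r0 0%N).
    by case: (s0 _ _ x01) => ->; [right | left].
  have [] := z0 _ _ (r0 2%N) (r0 3%N); first exact: s0 x23.
  by move=> -> -> -> ->.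
split; [exact: cts_from_circle | exact: cts_to_circle | split | |].
- move=> y; rewrite /unit_sphere /= sq => y1'; apply/(realizationP _ lF); split.
  + by move=> k kl; rewrite atE // !addr_ge0 // mulr_ge0 // sqr_ge0.
  + rewrite sum_at_label (four (fun k => at_label (from_circle y) k)).
      by rewrite !val_label // y0 y1 y2 y3 -(pp (y ord0 ord0)) -(pp (y ord0 ord_max)) in y1' *; lra.
    by move=> k k3; rewrite far ?ltn_ord.
  + have z (s : R) : s <= 0 -> pos_part s = 0 by move=> s0; apply/max_idPl.
    rewrite /square_cycle; case: (boolP (y ord0 ord0 <= 0)) => s0;
      case: (boolP (y ord0 ord_max <= 0)) => t0;
      [exists [:: 0; 3]%N | exists [:: 2; 0]%N | exists [:: 3; 1]%N | exists [:: 1; 2]%N] => //;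
      case=> [|[|[|[|k]]]] kl // _; rewrite ?y0 ?y1 ?y2 ?y3 ?z ?expr0n //;
      first [exact: far | by rewrite oppr_le0 ltW // ltNge].
- move=> x xF; have [x0 x1 _ _ _] := facts x xF; have [r1 r0 r2 r3] := roots x xF.
  rewrite /unit_sphere /= sq -(pp (to_circle x ord0 ord0)) -(pp (to_circle x ord0 ord_max)) r0 r1 r2 r3 !sqr_sqrtr ?x0 //; lra.
- move=> y y1'; apply/rowP => k; rewrite mxE.
  have pE s : Num.sqrt (pos_part s ^+ 2) = pos_part s by rewrite sqrtr_sqr ger0_norm.
  rewrite y0 y1 y2 y3 !pE !pm; have [->|] := eqVneq k ord0; first by [].
  by case: k => [[|[|k]] kl] // _; congr (y _ _); apply: val_inj.
- move=> x xF; have [x0 _ big _ _] := facts x xF; have [r1 r0 r2 r3] := roots x xF.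
  apply: at_label_eq => k kl; have := big k.
  case: k kl => [|[|[|[|k]]]] kl => [_|_|_|_|-> //].
  + by rewrite y0 r0 sqr_sqrtr ?x0.
  + by rewrite y1 r1 sqr_sqrtr ?x0.
  + by rewrite y2 r2 sqr_sqrtr ?x0.
  + by rewrite y3 r3 sqr_sqrtr ?x0.
  + by rewrite far.
Qed.
End Paths.

(** * The exchanges that simplify the sphere *)

(** Found by a randomized search that also kept the tracked knot short. *)
Definition simplification : seq (seq nat * seq nat) :=
  ([::
   ([:: 12; 16], [:: 3; 10]); ([:: 2; 3], [:: 4; 13; 15]); ([:: 6; 9], [:: 2; 3]); ([:: 3; 4],
   [:: 12; 13; 15]); ([:: 3; 10], [:: 12; 16]); ([:: 2; 15], [:: 4; 7; 13]); ([:: 3; 13], [:: 9;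
   12; 15]); ([:: 7; 15], [:: 4; 6; 13]); ([:: 2; 13], [:: 4; 7; 10]); ([:: 4; 15], [:: 6; 12;
   13]); ([:: 2; 10], [:: 4; 9]); ([:: 7; 16], [:: 3; 13]); ([:: 6; 7], [:: 3; 4]); ([:: 7; 12],
   [:: 10; 11]); ([:: 2; 7], [:: 4; 8; 9]); ([:: 6; 15], [:: 8; 12; 13]); ([:: 5; 7], [:: 3; 4;
   8]); ([:: 6; 14], [:: 2; 3; 5]); ([:: 9; 13], [:: 11; 12; 15]); ([:: 10; 13], [:: 4; 14]);
   ([:: 7; 13], [:: 3; 4; 14]); ([:: 5; 14], [:: 2; 11]); ([:: 13; 15], [:: 8; 11; 12]); ([:: 3;
   12], [:: 9; 15; 16]); ([:: 10; 11], [:: 7; 12]); ([:: 2; 4], [:: 8; 9; 16]); ([:: 3; 13], [::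
   6; 14]); ([:: 5; 6], [:: 2; 4]); ([:: 9; 11], [:: 7; 15]); ([:: 2; 11], [:: 5; 14]); ([:: 9;
   10], [:: 7; 16]); ([:: 9; 12], [:: 7; 15; 16]); ([:: 12; 16], [:: 7; 10; 15]); ([:: 12; 15],
   [:: 10; 11]); ([:: 11; 14], [:: 3; 12]); ([:: 5; 11], [:: 3; 13]); ([:: 10; 11], [:: 12;
   15]); ([:: 5; 14], [:: 2; 3; 12]); ([:: 6; 8], [:: 2; 13]); ([:: 11; 13], [:: 3; 8; 12]);
   ([:: 7; 16], [:: 9; 10]); ([:: 3; 13], [:: 5; 8; 12]); ([:: 2; 4], [:: 5; 6]); ([:: 10; 16],
   [:: 4; 15]); ([:: 9; 10], [:: 4; 7; 15]); ([:: 6; 12], [:: 2; 4]); ([:: 2; 5], [:: 6; 12]);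
   ([:: 6; 16], [:: 3; 13]); ([:: 3; 15], [:: 9; 14; 16]); ([:: 2; 14], [:: 9; 12]); ([:: 7;
   11], [:: 3; 15]); ([:: 11; 12], [:: 3; 8; 15]); ([:: 6; 12], [:: 2; 5]); ([:: 5; 13], [:: 12;
   16]); ([:: 6; 14], [:: 3; 4; 13]); ([:: 12; 15], [:: 3; 10]); ([:: 8; 14], [:: 9; 10]); ([::
   2; 4], [:: 6; 12]); ([:: 8; 13], [:: 2; 12; 16]); ([:: 7; 12], [:: 3; 10; 14]); ([:: 10; 12],
   [:: 8; 14]); ([:: 5; 6], [:: 2; 4]); ([:: 12; 14], [:: 3; 8; 9]); ([:: 3; 16], [:: 9; 13]);
   ([:: 3; 6], [:: 2; 4; 13]); ([:: 2; 8], [:: 9; 12; 16]); ([:: 8; 14], [:: 3; 9; 10]); ([:: 7;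
   14], [:: 3; 4; 10]); ([:: 9; 10], [:: 8; 14]); ([:: 5; 8], [:: 3; 16]); ([:: 6; 13], [:: 2;
   4; 12]); ([:: 8; 15], [:: 10; 11]); ([:: 4; 14], [:: 10; 13]); ([:: 4; 12], [:: 6; 13]); ([::
   11], [:: 8; 15]); ([:: 8; 14], [:: 9; 10]); ([:: 3; 14], [:: 9; 10; 13]); ([:: 12; 13], [::
   6; 16]); ([:: 14; 16], [:: 13; 15]); ([:: 6; 16], [:: 12; 13]); ([:: 7; 10], [:: 3; 4; 15]);
   ([:: 3; 16], [:: 4; 12]); ([:: 2; 16], [:: 9; 12; 13]); ([:: 8; 12], [:: 3; 16]); ([:: 3; 5],
   [:: 2; 4; 12]); ([:: 3; 16], [:: 8; 12]); ([:: 3; 12], [:: 2; 8]); ([:: 9; 12], [:: 8; 13]);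
   ([:: 5], [:: 2; 16]); ([:: 13; 15], [:: 14; 16]); ([:: 15; 16], [:: 4; 14]); ([:: 2; 9], [::
   3; 8; 13]); ([:: 13; 14], [:: 10; 16]); ([:: 4; 12], [:: 2; 8; 16]); ([:: 6], [:: 4; 12]);
   ([:: 3; 9], [:: 8; 10; 13]); ([:: 10; 16], [:: 13; 14]); ([:: 2; 3], [:: 4; 8; 13]); ([:: 3;
   13], [:: 4; 8; 10]); ([:: 7; 8], [:: 3; 9]); ([:: 3; 10], [:: 4; 8; 15]); ([:: 3; 9], [:: 7;
   8]); ([:: 4; 10], [:: 13; 15]); ([:: 3; 4], [:: 7; 8; 15]); ([:: 2; 13], [:: 4; 8; 12]); ([::
   2], [:: 4; 12; 16]); ([:: 4; 14], [:: 15; 16]); ([:: 12], [:: 4; 13; 16]); ([:: 13; 15], [::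
   4; 10]); ([:: 13], [:: 10; 16]); ([:: 7; 8; 15], [:: 3; 4]); ([:: 4; 9], [:: 7; 16]); ([::
   3], [:: 7; 8; 15]); ([:: 8], [:: 7; 10]); ([:: 4], [:: 10; 15; 16]); ([:: 7], [:: 9; 10;
   15]); ([:: 16], [:: 10; 14; 15])])%N.

(** * Tracked knots *)

(** The positions in space of the five vertices that survive, times 50. Vertex 10 is the centroid
    of 1, 9, 14 and 15, and the plane x_0 = 0 separates the two trefoils of the knot once
    superfluous vertices are deleted. *)
Definition place (i : nat) : seq Z :=
  nth [:: Z0; Z0; Z0; Z.pos 50] (
    [:: [:: Z.neg 1389; Z.neg 600; Z.neg 775; Z.pos 50];
        [:: Z.neg 489; Z.pos 400; Z.neg 150; Z.pos 50];
        [:: Z.neg 114; Z.neg 100; Z.neg 150; Z.pos 50];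
        [:: Z.pos 1386; Z.neg 100; Z.neg 150; Z.pos 50];
        [:: Z.pos 36; Z.neg 100; Z.pos 475; Z.pos 50]]) (index i [:: 1; 9; 10; 14; 15]%N).

Definition hflat (W : seq nat) (v : seq Z) : seq Z :=
  let coord k := foldr (fun i s => Z.add (Z.mul (coordinate (place i) k) (coordinate v i)) s) Z0 W in
  [:: coord 0%N; coord 1%N; coord 2%N; Z.mul (Z.pos 50) (coordinate v 17)].

Definition same_point (u v : seq Z) : bool :=
  [&& size u == 4%N, size v == 4%N, proper 3 u, proper 3 v &
      all (fun k => Z.eqb (Z.mul (coordinate u k) (coordinate v 3)) (Z.mul (coordinate v k) (coordinate u 3)))
        (iota 0 3)].

(** Divides by the common factor and then brings the weight close to 2^40. With comparable
    weights, the sum of two homogeneous vectors is near the middle of their segment, which is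
    where the certificates of deletions expect it. *)
Definition renorm (v : seq Z) : seq Z :=
  let g := foldr Z.gcd Z0 v in
  let u := [seq Z.div x g | x <- v] in
  let w := hscale (Z.div (Z.pow 2 40) (coordinate u 3)) u in
  if same_point v w then w else v.

(** The path is closed: its last point repeats the first and is dropped. *)
Definition track_knot (W : seq nat) (u : nat) (P : seq nat) : option (seq (seq Z)) :=
  if track simplification (hvertex u, map hvertex P) is Some (u', P') then
    if (last u' P' == u') && (P' != [::]) then
      Some [seq renorm (hflat W v) | v <- belast u' P']
    else None
  else None.

Local Open Scope Z_scope.

(** Removes the vertices that tracking leaves in the interior of straight edges. *)
Definition straighten_S : seq step :=
  [::
   (0%N, None, [:: [:: [:: 100; 0; 0; 203]; [:: 0; 0; 1718118; -3984121]; [:: 0; 1; -1; 4]; [::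
   1; 2; 0; 3]; [:: -1; 0; 1; -2]; [:: -1; -1; 0; -1]]]); (1%N, None, [:: [:: [:: 0; 0;
   -1718118; 3984121]; [:: -2522475; 0; 2522475; -1331018]; [:: -1; -1; 1; -1]; [:: 1; 0; -1;
   3]; [:: 0; -1; 0; -1]; [:: -1; 0; 0; 0]; [:: 0; 1; 0; 2]]]); (4%N, None, [:: [:: [:: 15425;
   0; 0; 169]; [:: -2550; 0; 0; 8141]; [:: -1; 1; -1; 0]; [:: 1; 1; -1; -2]; [:: 0; 1; -1;
   -3]]]); (0%N, None, [:: [:: [:: 15425; 0; 0; 169]; [:: 0; 0; -2772; -4441]; [:: 0; 2; -2;
   -7]]]); (1%N, None, [:: [:: [:: 0; 0; 2772; 4441]; [:: 0; 0; -1206; 5207]; [:: 0; 1; 0; 0];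
   [:: 1; 2; 1; -2]; [:: 1; 0; 1; 0]]]); (9%N, None, [:: [:: [:: 0; 0; -344574; 2542903]; [:: 0;
   0; 17658; -94001]; [:: -7; 14; 7; -15]; [:: -1; -1; 0; -1]]]); (3%N, None, [:: [:: [:: -6075;
   -6075; 0; -8701]; [:: 4811400; -4811400; 4811400; -19557683]; [:: -1; 1; 2; 0]]]); (2%N,
   None, [:: [:: [:: -1494450; 1494450; -1494450; 5247179]; [:: 145800; 0; 145800; 15749]; [::
   -1; 0; 1; -3]; [:: -1; 1; 1; -1]; [:: 2; -1; -2; 7]; [:: -1; -2; 0; -3]]]); (2%N, None, [::
   [:: [:: 0; 0; -1250964; 1880183]; [:: 0; 0; 1810836; -2154631]; [:: -1; 1; 1; -1]; [:: 1; 0;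
   -1; 4]; [:: -2; 2; 0; -1]; [:: -1; -1; -1; 0]]]); (1%N, None, [:: [:: [:: 0; 0; -1810836;
   2154631]; [:: 50683725; 0; 50683725; 87568793]; [:: -1; 0; 1; -2]; [:: -1; 1; 1; -1]; [:: 1;
   0; -1; 4]; [:: -2; 2; 0; -1]; [:: 0; 0; 1; 0]; [:: -1; -1; -1; 0]]]); (2%N, None, [:: [:: [::
   0; 0; -12885804; 4685993]; [:: 0; 0; 39779343; 2780929]; [:: -1; -1; 0; -1]; [:: -1; 2; 1;
   1]; [:: 1; 0; -1; 4]; [:: -1; 1; 0; -1]]]); (6%N, None, [:: [:: [:: 242246700; 0; 0;
   264024851]; [:: -5321700; 0; 0; 6058949]; [:: 0; -3; 0; -2]; [:: 0; 0; 2; 1]; [:: 3; 12; 0;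
   13]; [:: 0; 0; -3; 1]; [:: 0; 1; 0; 2]]]); (5%N, None, [:: [:: [:: -22817700; 0; -22817700;
   93014719]; [:: 279450; 0; 0; -983029]; [:: 0; 2; -1; 5]; [:: 0; -3; -3; -4]]]); (19%N, None,
   [:: [:: [:: 13725; 0; -13725; 12893]; [:: -5775; 0; 5775; 2033]; [:: 0; -1; 1; -2]; [:: 0; 1;
   1; 0]; [:: 1; 1; 0; 0]; [:: 0; -1; 0; 0]]]); (3%N, None, [:: [:: [:: 20700; 20700; -20700;
   -22079]; [:: 0; 603; 0; -844]; [:: 1; 1; 1; 2]; [:: 0; -1; 1; 5]; [:: -1; -1; 1; 3]; [:: -1;
   0; -1; 0]]])].

(** The knot of the ball differs from that of the sphere in one arc; after this script the two
    polygons have the same vertices. *)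
Definition straighten_B : seq step :=
  [::
   (0%N, None, [:: [:: [:: 50; 0; 50; -61]; [:: 0; 0; 1718118; -3984121]; [:: 0; 1; -1; 4]; [::
   1; 2; 0; 3]; [:: -1; 0; 1; -2]; [:: -1; -1; 0; -1]]]); (1%N, None, [:: [:: [:: 0; 0;
   -1718118; 3984121]; [:: -2522475; 0; 2522475; -1331018]; [:: -1; -1; 1; -1]; [:: 1; 0; -1;
   3]; [:: 0; -1; 0; -1]; [:: -1; 0; 0; 0]; [:: 1; 0; 1; 3]]]); (4%N, None, [:: [:: [:: 15425;
   0; 0; 169]; [:: -2550; 0; 0; 8141]; [:: -1; 1; -1; 0]; [:: 1; 1; -1; -2]; [:: 0; 1; -1;
   -3]]]); (0%N, None, [:: [:: [:: 15425; 0; 0; 169]; [:: 0; 0; -2772; -4441]; [:: 0; 1; 0;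
   0]]]); (1%N, None, [:: [:: [:: 0; 0; 2772; 4441]; [:: 0; 0; -1206; 5207]; [:: 0; 1; 0; 0];
   [:: 1; 2; 1; -2]; [:: 1; 0; 1; 0]]]); (9%N, None, [:: [:: [:: 0; 0; -344574; 2542903]; [:: 0;
   0; 17658; -94001]; [:: -7; 14; 7; -15]; [:: -1; -1; 0; -1]]]); (3%N, None, [:: [:: [:: -6075;
   -6075; 0; -8701]; [:: 4811400; -4811400; 4811400; -19557683]; [:: 0; 0; 1; 0]]]); (2%N, None,
   [:: [:: [:: -1494450; 1494450; -1494450; 5247179]; [:: 145800; 0; 145800; 15749]; [:: -1; 0;
   1; -3]; [:: 2; -2; 0; 3]; [:: -1; -2; 0; -3]]]); (2%N, None, [:: [:: [:: 0; 0; -1250964;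
   1880183]; [:: 0; 0; 1810836; -2154631]; [:: 2; -2; 0; 3]; [:: -2; 2; 0; -1]; [:: -1; -1; -1;
   0]]]); (1%N, None, [:: [:: [:: 0; 0; -1810836; 2154631]; [:: 50683725; 0; 50683725;
   87568793]; [:: -1; 0; 1; -2]; [:: 13; -13; 0; 22]; [:: -2; 2; 0; -1]; [:: 0; 0; 1; 0]; [::
   -1; -1; -1; 0]]]); (2%N, None, [:: [:: [:: 0; 0; -12885804; 4685993]; [:: 0; 0; 39779343;
   2780929]; [:: -1; -1; 0; -1]; [:: 6; -2; -2; 15]; [:: -1; 1; 0; -1]]]); (6%N, None, [:: [::
   [:: 242246700; 0; 0; 264024851]; [:: -5321700; 0; 0; 6058949]; [:: 0; -3; 0; -2]; [:: 0; 0;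
   2; 1]; [:: 3; 12; 0; 13]; [:: 0; 0; -3; 1]]]); (5%N, None, [:: [:: [:: -22817700; 0;
   -22817700; 93014719]; [:: 279450; 0; 0; -983029]; [:: -5; 0; 5; 19]; [:: 0; -3; -3; -4]]]);
   (19%N, None, [:: [:: [:: 13725; 0; -13725; 12893]; [:: -5775; 0; 5775; 2033]; [:: 0; -1; 1;
   -2]; [:: 0; 1; 1; 0]; [:: 1; 1; 0; 0]; [:: 0; -1; 0; 0]]]); (3%N, None, [:: [:: [:: 20700;
   20700; -20700; -22079]; [:: 0; 603; 0; -844]; [:: 1; 1; 1; 2]; [:: 0; -1; 1; 5]; [:: -1; -1;
   1; 3]; [:: -1; 0; -1; 0]]]); (7%N, None, [:: [:: [:: 8100; 0; -8100; -30307]; [:: 2700; 0;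
   2700; -10819]; [:: 0; -9; 0; -17]; [:: 4; 0; 0; -15]]]); (0%N, None, [:: [:: [:: 8100; 0;
   -8100; -30307]; [:: 300; 0; 300; -691]; [:: 0; -9; 0; -17]; [:: 22; -11; -22; -104]]]); (1%N,
   None, [:: [:: [:: -300; 0; -300; 691]; [:: 25; 0; 0; 57]; [:: 1; -2; -2; -7]]]); (0%N, Some
   [:: -30544433018895; -13194139533000; -17042430230125; 1099511627750], [:: [:: [:: 0; -4; -4;
   -5]; [:: -1; 0; -1; -3]; [:: -1; -1; 0; -2]]; [:: [:: -300; 0; -300; 691]; [:: 1; -2; -2;
   -7]]]); (68%N, None, [:: [:: [:: 2025; -4050; -4050; -12533]; [:: 25; -25; -25; 7]; [:: 0;
   -9; 0; -17]; [:: 3; -6; -3; -23]]]); (1%N, None, [:: [:: [:: -100; 150; 50; -203]; [:: -50;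
   0; -50; 61]; [:: -1; -1; 1; -1]]])].

(** First deletes 56 vertices, then moves the remaining ones to small coordinates, with six
    vertices on one side of the plane x_0 = 0 and five on the other. *)
Definition split_knot : seq step :=
  [::
   (42%N, None, [:: [:: [:: 11591100; 0; 0; -26046067]; [:: 0; 134379; 134379; 156140]; [:: 1;
   4; 1; 4]; [:: 2; 4; -4; 3]; [:: 0; -1; 0; 0]]]); (56%N, None, [:: [:: [:: 0; 0; -1810836;
   2154631]; [:: 0; 0; 12885804; -4685993]; [:: -1; -1; 1; 0]; [:: -1; 1; 1; -1]; [:: 1; 0; -1;
   4]; [:: -2; 2; 0; -1]; [:: -1; -1; -1; 0]]]); (43%N, None, [:: [:: [:: 0; 0; -1718118;
   3984121]; [:: 0; -13804; 13804; -381]; [:: 2; -2; 0; 1]; [:: 0; -9; 0; -11]; [:: -1; 1; 0;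
   2]; [:: -1; -3; 0; -4]; [:: 0; 1; 0; 2]]]); (11%N, None, [:: [:: [:: 0; 0; -8262; 63589]; [::
   0; 0; 344574; -2542903]; [:: -1; 0; -1; 8]]]); (57%N, None, [:: [:: [:: 0; -1206; 1206;
   -3899]; [:: 0; 23238; -23238; 205477]; [:: 1; 1; 0; 1]; [:: -1; 1; 1; -2]]]); (29%N, None,
   [:: [:: [:: -674325; 0; 0; 1947614]; [:: 0; 4617; 0; 9154]; [:: 19; 95; 19; 119]; [:: 1; 0;
   -1; 0]; [:: 1; -1; 0; -3]; [:: -1; -4; -1; -4]]]); (0%N, None, [:: [:: [:: -674325; 0; 0;
   1947614]; [:: 224100; 448200; 0; 279673]; [:: 0; 1; 0; 2]; [:: 1; -1; 0; -4]; [:: 0; -36;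
   -12; -59]]]); (55%N, None, [:: [:: [:: 0; -134379; -134379; -156140]; [:: 279450; 0; 0;
   -983029]; [:: 1; 1; -2; -1]]]); (46%N, None, [:: [:: [:: -1494450; 1494450; -1494450;
   5247179]; [:: 0; 0; 1250964; -1880183]; [:: -1; 0; 1; -3]; [:: -1; 1; 1; -1]; [:: 2; -1; -2;
   7]; [:: -1; -2; 0; -3]]]); (43%N, None, [:: [:: [:: 0; 13804; -13804; 381]; [:: -15425;
   -15425; 0; 57731]; [:: -1; 0; -1; 0]; [:: 1; 1; -1; 1]; [:: 0; 0; -2; -3]; [:: 0; 1; 0;
   2]]]); (35%N, None, [:: [:: [:: -376650; 0; 376650; 72613]; [:: 0; 0; -97443; 274271]; [::
   -2; -6; 0; -7]; [:: -1; 2; 1; 5]; [:: 1; -1; 0; -2]]]); (15%N, None, [:: [:: [:: 5591700; 0;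
   5591700; 11701]; [:: 0; 1; 0; 2]; [:: 1; 0; 0; 0]; [:: -1; -7; 1; -8]; [:: -6; -27; 3; -26];
   [:: -1; 0; 2; 3]; [:: 0; 3; 1; 5]; [:: 1; 3; -1; 4]; [:: 0; -1; -1; 0]]]); (19%N, None, [::
   [:: [:: -1494450; 1494450; -1494450; 5247179]; [:: 0; 0; 1810836; -2154631]; [:: -1; 1; 1;
   -1]; [:: 2; -1; -2; 7]; [:: -1; -2; 0; -3]; [:: -9; 0; 9; -25]]]); (19%N, None, [:: [:: [::
   -255150; 0; 255150; 152083]; [:: 0; 0; -97443; 274271]; [:: 1; -1; -1; 0]; [:: 0; -1; 0; -1];
   [:: -1; 2; 2; 5]; [:: 1; -1; 0; -2]; [:: 0; -1; 1; -2]]]); (7%N, None, [:: [:: [:: 13725; 0;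
   -13725; 12893]; [:: 0; -1656; 1656; -2009]; [:: 0; 1; 1; 0]; [:: 1; 1; 0; 0]; [:: 0; -1; 0;
   0]]]); (14%N, None, [:: [:: [:: 0; 0; 2772; 4441]; [:: 0; 23238; -23238; 205477]; [:: 1; 1;
   0; 1]; [:: 0; 1; 1; 0]; [:: 1; 2; 1; -2]; [:: 1; 0; 1; 0]]]); (16%N, None, [:: [:: [:: 0; 0;
   24847236; 15522383]; [:: -662879700; 0; 0; -956612941]; [:: -1; -1; 0; -1]; [:: 0; 1; 0; 1];
   [:: 1; 0; -1; 2]; [:: 7; 0; 0; 15]]]); (16%N, None, [:: [:: [:: -92025; 92025; 0; 296683];
   [:: 3825; -3825; 0; -8629]; [:: -1; -1; -1; 4]; [:: 0; 0; 6; -17]]]); (46%N, None, [:: [::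
   [:: -255150; 0; 255150; 152083]; [:: 0; 0; -28917; 82274]; [:: 1; -1; -1; 0]; [:: 0; -1; 0;
   -1]; [:: -1; 2; 2; 5]; [:: 1; 0; 0; 0]; [:: -1; -2; -1; 2]; [:: 0; -1; 1; -2]]]); (0%N, None,
   [:: [:: [:: -255150; 0; 255150; 152083]; [:: 828225; 0; -828225; 1325378]; [:: 0; -1; 0; -1];
   [:: -1; 2; 2; 5]; [:: 1; 0; 0; 0]; [:: -1; -1; -1; 4]; [:: 0; -1; 1; -2]]]); (29%N, None, [::
   [:: [:: -1494450; 1494450; -1494450; 5247179]; [:: 0; 0; 12885804; -4685993]; [:: -1; 1; 1;
   -1]; [:: 2; -1; -2; 7]; [:: -1; -2; 0; -3]; [:: -9; 0; 9; -25]]]); (21%N, None, [:: [:: [::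
   0; 549; -549; 1271]; [:: -20700; -20700; 20700; 22079]; [:: -1; 0; 2; 1]; [:: 1; 1; 0; 1];
   [:: -1; -1; -1; 3]; [:: 0; 1; 1; 0]]]); (4%N, None, [:: [:: [:: 0; -61308; 61308; -18997];
   [:: -5591700; 0; -5591700; -11701]; [:: 0; 1; 0; 2]; [:: 1; 0; -1; 0]; [:: 1; 3; 0; 4]; [::
   0; 0; -2; -1]]]); (7%N, None, [:: [:: [:: 185100; 185100; 185100; -234347]; [:: 0; 0; -23238;
   170761]; [:: 3; 1; 0; 0]; [:: 0; 2; 1; -1]; [:: 1; 2; 1; -2]]]); (12%N, None, [:: [:: [:: 0;
   0; -12885804; 4685993]; [:: -584147700; 0; 584147700; -997426481]; [:: 0; 1; 0; 1]; [:: 1; 0;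
   -1; 4]; [:: -1; -1; 0; -1]]]); (36%N, None, [:: [:: [:: 0; 0; -344574; 2542903]; [:: -2700;
   13500; 2700; 7169]; [:: 0; 0; 1; -4]; [:: -3; -1; 0; 0]]]); (23%N, None, [:: [:: [:: 0; 189;
   -189; 631]; [:: -165600; -165600; 331200; 386557]; [:: -1; 1; 2; 0]; [:: 1; 1; 0; 1]; [:: -1;
   -2; -1; 2]; [:: 0; 1; 0; 1]]]); (0%N, None, [:: [:: [:: 0; 189; -189; 631]; [:: 0; 4422;
   4422; -2515]; [:: 1; 1; 0; 1]; [:: 0; 0; 2; 3]; [:: -1; -2; -1; 3]; [:: -1; 1; 0; 2]]]);
   (23%N, None, [:: [:: [:: 207060300; 0; 0; 383278709]; [:: -242246700; 0; 0; -264024851]; [::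
   -2; 0; 2; -1]; [:: 0; 1; 0; 1]; [:: 0; 0; -1; 0]]]); (22%N, None, [:: [:: [:: 100; 0; 0;
   203]; [:: 0; -13804; 13804; -381]; [:: -1; -1; 0; -1]; [:: 0; 1; -1; 4]; [:: 39; 65; 0; 105];
   [:: -1; -4; 1; -4]; [:: 0; 1; 0; 2]]]); (20%N, None, [:: [:: [:: -279450; 0; 0; 983029]; [::
   36450; 0; 0; -112019]; [:: 1; -4; -3; -9]; [:: 0; 1; 0; 2]; [:: -1; -4; 0; -4]]]); (23%N,
   None, [:: [:: [:: 0; 0; -8262; 63589]; [:: -2700; 13500; 2700; 7169]; [:: 0; 0; 1; -4]; [::
   -3; -1; 0; 0]; [:: -1; 0; -1; 8]]]); (22%N, None, [:: [:: [:: 0; 0; -13266; -11023]; [::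
   -1532700; 1532700; -1532700; 1156069]; [:: 0; 1; 0; 2]; [:: 1; 1; 0; 1]; [:: 0; 0; 2; 3]; [::
   0; -1; -1; 1]]]); (21%N, None, [:: [:: [:: 5321700; 0; 0; -6058949]; [:: -6718950; 6718950;
   13437900; 36540719]; [:: 10; 45; -5; 44]]]); (28%N, None, [:: [:: [:: -1494450; 1494450;
   -1494450; 5247179]; [:: -584147700; 0; 584147700; -997426481]; [:: -1; 2; 1; 1]; [:: 2; -1;
   -2; 7]; [:: -42; -70; 0; -113]]]); (8%N, None, [:: [:: [:: -674325; 0; 0; 1947614]; [::
   105300; 0; 0; -261991]; [:: 0; 1; 0; 2]; [:: 0; -357; -119; -585]]]); (0%N, None, [:: [:: [::
   -674325; 0; 0; 1947614]; [:: 48600; 0; 0; -76717]; [:: 0; 1; 0; 2]; [:: 0; -357; -119;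
   -585]]]); (4%N, None, [:: [:: [:: -3825; 3825; 0; 8629]; [:: 0; 0; 13266; 11023]; [:: 0; 1;
   1; 0]; [:: 0; -2; -1; 3]; [:: 1; 1; 0; 1]]]); (11%N, None, [:: [:: [:: -8978850; 0; 8978850;
   -66125303]; [:: 206550; 0; 206550; -1612291]]]); (26%N, None, [:: [:: [:: 0; 0; 23238;
   -170761]; [:: 1496475; 0; 0; -653962]]]); (3%N, None, [:: [:: [:: -41400; -82800; 0;
   -122917]; [:: 4811400; -4811400; 4811400; -19557683]; [:: -1; 1; 2; 0]]]); (6%N, None, [::
   [:: [:: 5321700; 0; 0; -6058949]; [:: 1676700; 6706800; -1676700; 6628451]]]); (5%N, None,
   [:: [:: [:: -255150; 0; 255150; 152083]; [:: 0; -459; 0; -638]; [:: -1; 2; 2; 5]; [:: 0; -2;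
   -1; 1]; [:: 2; 0; 0; -1]]]); (10%N, None, [:: [:: [:: -580950; 0; 580950; -3753241]; [::
   206550; 0; 206550; -1612291]]]); (4%N, None, [:: [:: [:: -1494450; 1494450; -1494450;
   5247179]; [:: -155295225; 0; 155295225; -190444138]; [:: -1; 2; 1; 1]; [:: 2; -1; -1; 4]; [::
   -42; -70; 0; -113]]]); (8%N, None, [:: [:: [:: -255150; 255150; 255150; 638383]; [:: 0; 0;
   13266; 11023]; [:: -1; 2; 2; 5]; [:: 1; 0; 0; 0]; [:: 0; -2; -1; 3]; [:: 2; 0; -1; 2]; [:: 0;
   4; 8; 3]]]); (17%N, None, [:: [:: [:: 419175; -419175; 838350; -2079406]; [:: 674325; 0; 0;
   -1947614]; [:: 1; -4; -3; -9]; [:: 0; 1; 0; 2]]]); (11%N, None, [:: [:: [:: 0; 7404; 7404;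
   -9455]; [:: 34425; 68850; 0; 98939]; [:: 2; 2; 0; 3]]]); (0%N, None, [:: [:: [:: 0; 7404;
   7404; -9455]; [:: 15525; 31050; 15525; -35378]]]); (4%N, None, [:: [:: [:: 155295225; 0;
   -155295225; 190444138]; [:: -5321700; 0; 0; 6058949]; [:: 0; -4; -8; -3]; [:: 0; 0; 11; 7];
   [:: -1; 1; 2; 3]; [:: 22; 66; -22; 71]; [:: 0; -1; -1; 0]]]); (13%N, None, [:: [:: [:: 0;
   7404; 7404; -9455]; [:: 3207600; 0; 0; 1553903]; [:: 2; 1; 1; 0]]]); (10%N, None, [:: [:: [::
   1532700; -1532700; 1532700; -1156069]; [:: 0; 1; 0; 2]; [:: 1; 0; 0; 0]; [:: 1; -1; -2; -3];
   [:: -44; -160; 40; -149]; [:: 0; 24; 8; 41]]]); (12%N, None, [:: [:: [:: -16200; 16200; 0;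
   56639]; [:: 0; 0; 13266; 11023]; [:: -3; 0; 3; 4]; [:: -1; 2; 1; 6]; [:: 1; 0; 0; 0]; [:: 0;
   4; 8; 3]]]); (10%N, None, [:: [:: [:: 155295225; 0; -155295225; 190444138]; [:: -419175;
   419175; -838350; 2079406]; [:: -2; -4; -6; -1]; [:: 0; 0; 3; 2]; [:: 282; 1128; -235;
   1127]]]); (10%N, None, [:: [:: [:: 0; 7404; 7404; -9455]; [:: 498150; 0; 0; 337207]; [:: 2;
   1; 1; 0]]]); (3%N, None, [:: [:: [:: 0; 0; 67068; 16279]; [:: 16200; -16200; 0; -56639]; [::
   0; -8; -2; -13]; [:: 0; 1; 0; 2]]]); (4%N, Some [:: -28; -27; 1; 2], [:: [:: [:: -100; 0; 0;
   -203]]; [:: [:: 0; -1; 0; -2]]]); (0%N, Some [:: -16; -19; -1; 2], [:: [:: [:: -75; -75; 75;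
   -421]]; [:: [:: 0; -324; 324; -1151]; [:: 0; -3; 0; -5]]]); (0%N, Some [:: -1; -6; 3; 1], [::
   [:: [:: -75; -75; 75; -421]]; [:: [:: 0; -324; 324; -1151]; [:: 0; -3; 0; -5]]]); (3%N, Some
   [:: -2; 9; -3; 2], [:: [:: [:: 12150; 12150; 0; 22927]; [:: -1; 1; 1; -1]; [:: 2; 1; 1; 0]];
   [:: [:: 0; 13804; -13804; 381]; [:: -1; 0; -1; -1]]]); (5%N, Some [:: 2; 2; 0; 1], [:: [::
   [:: 0; 15327; 0; 20524]; [:: 0; 3; -6; -2]; [:: 1; 0; 0; 0]]; [:: [:: -16200; 16200; 0;
   56639]; [:: -6; 0; 12; 13]; [:: 0; 1; 2; 1]; [:: 2; 0; 0; 1]; [:: 1; 0; 1; 1]; [:: 1; 1; 0;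
   1]]]); (1%N, Some [:: 2; -3; -2; 2], [:: [:: [:: 0; 324; -324; 1151]; [:: 1; 0; -2; -2]; [::
   0; 15; 3; 26]; [:: -258; -1032; 215; -1031]; [:: 1; 0; 0; 0]]; [:: [:: 0; 0; -1; 0]; [:: 0;
   3; -9; -4]; [:: 1; 0; 0; 0]]]); (4%N, Some [:: -1; -3; -2; 2], [:: [:: [:: 0; -2; -4; 3]; [::
   -1; 0; -1; 0]; [:: 0; 0; -3; -2]]; [:: [:: 0; 12; -12; 43]; [:: -22; -66; 22; -71]; [:: 25;
   40; -2; 71]; [:: -2; -1; -1; 0]; [:: -1; 1; -1; 3]]]); (8%N, Some [:: 5; -2; 2; 1], [:: [::
   [:: 1; 0; 0; 1]; [:: 1; -1; 1; -5]; [:: 0; 0; 1; -1]]; [:: [:: 2; -2; 0; -5]; [:: 2; -1; -3;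
   -4]; [:: 0; 15; 3; 26]; [:: -22; -88; 22; -87]]]); (8%N, Some [:: 2; -3; 1; 1], [:: [:: [::
   0; 0; 1; 0]; [:: -2; 1; 3; 5]; [:: 1; 0; 0; 0]; [:: 0; 0; -1; 2]]; [:: [:: 0; 0; 67068;
   16279]; [:: 0; -7; -1; -12]; [:: 0; 0; -1; 2]]]); (10%N, Some [:: 5; -1; 0; 1], [:: [:: [::
   1; -1; 0; -5]; [:: 2; -6; -4; -15]; [:: 0; 0; -1; 2]]; [:: [:: 155295225; 0; -155295225;
   190444138]; [:: 1; 4; -1; 4]; [:: 0; -2; 6; 3]; [:: 0; -1; -3; 0]]]); (10%N, Some [:: -3; -1;
   0; 1], [:: [:: [:: -1; 2; -1; 7]; [:: 0; -2; 6; 3]; [:: 0; -1; -3; 0]; [:: 0; 6; -2; 7]]; [::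
   [:: 0; -29889; -29889; 52840]; [:: -2; 0; 1; -1]; [:: -25; -40; 2; -71]; [:: 1; 0; -1; 4];
   [:: -1; 1; 0; 1]]]); (10%N, Some [:: -1; -2; 3; 1], [:: [:: [:: 0; 0; 1; 0]; [:: -1; 0; 1;
   0]; [:: -3; -12; 3; -20]; [:: 3; 1; -2; 12]; [:: -1; 1; 0; 2]]; [:: [:: 0; 2; 4; -3]; [:: -1;
   1; 1; 0]; [:: 3; 1; 1; 3]]]); (10%N, Some [:: -1; 5; -1; 1], [:: [:: [:: 1; 1; 0; 3]; [:: 0;
   1; 1; 0]; [:: -1; 0; 0; 0]; [:: 3; 1; 1; 3]]; [:: [:: 0; 2; -2; 1]; [:: -1; 0; 0; 0]]]);
   (10%N, Some [:: -1; -2; -1; 1], [:: [:: [:: 0; -1; -2; 3]; [:: -1; 0; 0; 0]; [:: 0; 0; -1;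
   0]]; [:: [:: 0; 12; -12; 43]; [:: 0; -3; 1; -3]; [:: 2; 3; -1; 9]; [:: -3; -1; -1; -2]]]);
   (10%N, Some [:: -2; 0; 4; 1], [:: [:: [:: 0; -1; 1; -1]; [:: 2; 3; -1; 9]; [:: -7; -1; -1;
   -6]; [:: -1; 1; -1; 3]]; [:: [:: -1; 0; 0; -1]; [:: -3; -1; 2; -11]]])].

Definition left_arc : seq (seq Z) := [:: [:: -1; -6; 3; 1]; [:: -2; 0; 4; 1]; [:: -1; -2; -1; 1]; [:: -1; 5; -1; 1]; [:: -1; -2; 3; 1]; [:: -3; -1; 0; 1]].

Definition right_arc : seq (seq Z) := [:: [:: 5; -1; 0; 1]; [:: 2; -3; 1; 1]; [:: 2; 2; 0; 1]; [:: 2; -3; -2; 2]; [:: 5; -2; 2; 1]].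

(** The two points where the polygon crosses the plane. *)
Definition crossing_p : seq Z := [:: 0; -1; 0; 1].

Definition crossing_q : seq Z := [:: 0; -32; 17; 6].

Definition left_trefoil : seq step :=
  [::
   (7%N, None, [:: [:: [:: 1; -1; 1; -1]; [:: 1; 0; -1; 4]; [:: 3; 0; 1; 1]; [:: 1; -1; -1;
   0]]]); (4%N, Some [:: -1; -3; 2; 1], [:: [:: [:: -1; -1; 1; -4]; [:: -3; -3; 1; -10]; [:: 2;
   1; -2; 11]; [:: -1; 1; 1; 1]]; [:: [:: 0; 0; 1; 1]; [:: 0; 1; 2; 0]; [:: 7; 1; 1; 9]]]);
   (3%N, None, [:: [:: [:: 1; 0; 1; 0]; [:: 3; 0; 1; 2]; [:: 9; 1; 4; 4]]]); (5%N, Some [:: 1;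
   2; -1; 1], [:: [:: [:: 1; 1; 0; 2]; [:: 7; 1; 3; 3]]; [:: [:: 1; 1; -1; 4]; [:: 0; -1; -2;
   1]; [:: 1; 0; 3; 4]; [:: 0; 2; -1; 3]]]); (2%N, Some [:: -2; -1; -1; 1], [:: [:: [:: 0; -1;
   -3; 2]; [:: -1; 0; -3; -3]]; [:: [:: -1; -1; 0; -2]; [:: 2; -3; 1; 3]; [:: 1; 1; 0; 4]; [::
   -9; -1; -2; -8]]]); (1%N, Some [:: -1; 2; 0; 1], [:: [:: [:: 1; 1; 0; 4]; [:: 0; 1; 2; 0];
   [:: 1; 0; 0; 2]; [:: -3; -1; -2; 1]]; [:: [:: 0; 1; -1; 0]; [:: -4; 3; -5; -9]]]); (1%N, Some
   [:: 1; -1; -1; 1], [:: [:: [:: 1; -2; 0; 1]; [:: 1; -12; 2; -8]]; [:: [:: 1; 0; 1; 1]; [:: 2;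
   -1; 5; 5]; [:: 1; 0; 0; 2]; [:: -2; -1; -2; 1]]]); (3%N, Some [:: 2; 0; 0; 1], [:: [:: [:: 1;
   -1; 1; 2]; [:: -1; 12; -2; 9]; [:: -1; -2; 4; 3]]; [:: [:: 1; 0; 1; 0]]]); (4%N, Some [:: -2;
   -2; 0; 1], [:: [:: [:: -1; 0; 0; 1]; [:: -5; 1; -12; -7]; [:: 5; -4; 7; 12]; [:: -2; 3; 5;
   3]]; [:: [:: -1; -1; 0; 0]; [:: 1; -7; 4; -2]]]); (4%N, Some [:: 0; 2; 0; 1], [:: [:: [:: 0;
   1; 0; 1]; [:: 5; -1; 12; 8]; [:: 1; 2; -4; -2]; [:: -2; -1; 0; 3]]; [:: [:: -1; 1; 0; -1]]])].

Definition right_trefoil : seq step :=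
  [::
   (5%N, None, [:: [:: [:: -1; 1; 2; 3]; [:: 0; 0; 1; 0]; [:: -6; 3; 16; 5]]]); (0%N, Some [::
   0; 2; 0; 1], [:: [:: [:: -1; 2; -1; 7]; [:: 0; 2; 0; 3]; [:: -1; -2; 7; 5]; [:: -1; -2; -9;
   5]]; [:: [:: -1; 1; 2; 3]; [:: -6; 3; 16; 5]]]); (1%N, Some [:: 4; -3; -1; 1], [:: [:: [:: 1;
   -1; 0; -5]; [:: 2; -6; -4; -15]]; [:: [:: 1; 1; -2; -2]; [:: -1; -3; 12; 8]; [:: -1; -2; -9;
   5]]]); (1%N, Some [:: -2; -2; 0; 1], [:: [:: [:: -1; 0; 2; 2]; [:: -2; 1; 3; 5]; [:: 1; -1;
   9; 1]; [:: 1; -1; -4; 1]]; [:: [:: -1; -1; 0; 1]; [:: -1; -4; 0; -5]]]); (3%N, Some [:: -2;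
   -1; 1; 1], [:: [:: [:: 0; 0; 1; 0]]; [:: [:: 0; -2; 2; -1]; [:: 1; -1; 2; 0]; [:: 1; 4; 0;
   7]; [:: -1; -1; 1; 2]]]); (5%N, Some [:: 3; -1; -2; 1], [:: [:: [:: 1; -2; -1; 1]; [:: 2; -2;
   3; 0]; [:: 0; 1; 0; 2]; [:: -2; -1; -3; 0]]; [:: [:: 2; -1; -1; -2]; [:: 1; 3; -12; -7]]]);
   (5%N, Some [:: 1; 2; 1; 1], [:: [:: [:: 1; 1; 0; -2]]; [:: [:: 0; 1; 0; 2]; [:: -3; 4; -5;
   3]; [:: 1; -1; 9; 1]; [:: 3; -2; 0; 3]]]); (4%N, Some [:: 1; -1; 1; 1], [:: [:: [:: 1; -1; 0;
   0]; [:: 1; -4; 1; -5]]; [:: [:: 1; 0; 0; 0]; [:: 2; 1; 3; 0]; [:: -3; -2; 0; 7]; [:: 3; -1;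
   -5; 3]]]); (3%N, Some [:: 2; 0; 0; 1], [:: [:: [:: 1; -1; 0; 1]; [:: 3; -4; 5; -2]; [:: -1;
   4; -1; 6]; [:: -1; -2; -4; 3]]; [:: [:: 1; 0; 0; -1]]])].

Definition htrefoil : seq (seq Z) :=
  [:: [:: 2; 0; 0; 1]; [:: -2; -1; 1; 1]; [:: 0; 2; 0; 1]; [:: 1; -1; 1; 1];
      [:: -2; -2; 0; 1]; [:: 1; 2; 1; 1]].

Definition hmirror (v : seq Z) : seq Z :=
  [:: coordinate v 0; coordinate v 1; - coordinate v 2; coordinate v 3].
Local Close Scope Z_scope.

Lemma straighten_S_run :
  obind (fun P => run_steps P (straighten_S ++ split_knot))
    (track_knot [:: 10; 1; 9; 14; 15]%N 3 [:: 2; 1; 3]%N) = Some (left_arc ++ right_arc).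
Proof. by vm_compute. Qed.

(** The rotation makes the list of vertices agree with that of the sphere, so that the same script
    applies from there on. *)
Lemma straighten_B_run :
  obind (fun P => obind (fun Q => run_steps (rot 59 Q) split_knot) (run_steps P straighten_B))
    (track_knot [:: 1; 9; 10; 14; 15]%N 3 [:: 2; 12; 13; 10; 8; 3]%N) = Some (left_arc ++ right_arc).
Proof. by vm_compute. Qed.

Lemma left_trefoil_run :
  run_steps (crossing_q :: rcons left_arc crossing_p) left_trefoil = Some (rot 1 (map hmirror htrefoil)).
Proof. by vm_compute. Qed.

Lemma right_trefoil_run :
  run_steps (crossing_p :: rcons right_arc crossing_q) right_trefoil = Some (rot 5 htrefoil).
Proof. by vm_compute. Qed.

(** Facet lists are compared as complexes, as the exchanges do not keep the order of labels. *)
Definition simplified (F G : seq (seq nat)) : bool :=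
  if exchanges F simplification is Some F' then refines F' G && refines G F' else false.

Lemma simplified_S : simplified facets16_92 (sphere_facets [tuple 1; 9; 14; 15]%N 10).
Proof. by vm_compute. Qed.

Lemma simplified_minus : simplified facets_minus (starred [tuple 1; 9; 14; 15]%N 10).
Proof. by vm_compute. Qed.

Lemma simplified_ball : simplified facets_ball [:: [:: 9; 10; 14; 15]%N].
Proof. by vm_compute. Qed.

(** * Knots in the models *)

Section Flat.
Variable R : realType.
Notation space := 'rV[R]_17.

Definition flat (W : seq nat) (x : space) : 'rV[R]_3 :=
  \sum_(i <- W) at_label x i *: hpoint R 3 (place i).

Lemma place_weight i : coordinate (place i) 3 = Z.pos 50.
Proof. by rewrite /place; case: (index _ _) => [|[|[|[|[|[|n]]]]]]. Qed.

Lemma zr_foldr (W : seq nat) (f : nat -> Z) :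
  zr R (foldr (fun i s => Z.add (f i) s) Z0 W) = \sum_(i <- W) zr R (f i).
Proof. by elim: W => [|i W IH]; rewrite ?big_nil // big_cons /= zrD IH. Qed.

Lemma flat_hpoint W v : labels W -> wf17 v ->
  flat W (hpoint R 17 v) = hpoint R 3 (hflat W v).
Proof.
move=> lW /andP[_ /(proper_gt0 R) v0].
have d0 : 0 < zr R (Z.pos 50) by rewrite -zr0 -zr_lt.
have e k (f : nat -> Z) : (k < 3)%N -> (forall i, f i = Z.mul (coordinate (place i) k) (coordinate v i)) ->
    \sum_(i <- W) at_label (hpoint R 17 v) i * (zr R (coordinate (place i) k) / zr R (coordinate (place i) 3))
    = zr R (foldr (fun i s => Z.add (f i) s) Z0 W) / zr R (Z.mul (Z.pos 50) (coordinate v 17)).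
  move=> _ fE; rewrite zr_foldr mulr_suml; apply: eq_big_seq => i iW.
  rewrite at_hpoint ?(allP lW) // place_weight fE !zrM; field.
  by rewrite !gt_eqF.
apply/rowP => k; rewrite summxE [RHS]mxE.
under eq_bigr => i _ do rewrite mxE [hpoint R 3 _ _ _]mxE.
by case: k => [[|[|[|k]]] kl] //; apply: e.
Qed.

Lemma flatD W a b (x y : space) : flat W (a *: x + b *: y) = a *: flat W x + b *: flat W y.
Proof.
rewrite /flat !scaler_sumr -big_split /=; apply: eq_bigr => i _.
by rewrite at_labelD scalerDl !scalerA.
Qed.

Lemma flat_hchain W u P : labels W -> wf17 u -> all wf17 P ->
  flat W @` hchain R 17 u P = hchain R 3 (hflat W u) (map (hflat W) P).
Proof.
move=> lW; elim: P u => [|v P IH] u wu; first by rewrite /hchain /= image_set0.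
move=> /= /andP[wv wP]; rewrite /hchain /= image_setU.
rewrite -[chain (hpoint R 17 v) _]/(hchain R 17 v P) IH // image_seg; last first.
  by move=> t _; rewrite flatD.
by rewrite !flat_hpoint.
Qed.

Lemma same_point_hpoint u v : same_point u v -> hpoint R 3 u = hpoint R 3 v.
Proof.
case/and5P => _ _ /(proper_gt0 R) u0 /(proper_gt0 R) v0 /allP e; apply/rowP => k; rewrite !mxE.
have /Z.eqb_eq/(congr1 (zr R)) := e k (ltac:(by rewrite mem_iota ltn_ord)).
rewrite !zrM => h; apply/eqP; by rewrite eqr_div ?h // gt_eqF.
Qed.

Lemma renorm_hpoint v : hpoint R 3 (renorm v) = hpoint R 3 v.
Proof. by rewrite /renorm; case: ifP => // /same_point_hpoint. Qed.

Lemma wf_renorm v : wf [:: v] -> wf [:: renorm v].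
Proof.
rewrite /renorm; case: ifP => // /and5P[_ s _ p _] _.
by rewrite /wf /= s p.
Qed.

Lemma hchain_closed n u P : P != [::] -> last u P = u -> hchain R n u P = hpolygon R n (belast u P).
Proof.
by case/lastP: P => // P w _; rewrite last_rcons belast_rcons hpolygon_cons => ->.
Qed.

Lemma disjoint_simplification :
  all (fun m : seq nat * seq nat => all (fun i => i \notin m.2) m.1) simplification.
Proof. by vm_compute. Qed.

Lemma track_knotP W u P Q : labels W -> track_knot W u P = Some Q ->
  wf Q /\ flat W @` (psis (R := R) simplification @` hchain R 17 (hvertex u) (map hvertex P)) = hpolygon R 3 Q.
Proof.
move=> lW; rewrite /track_knot.
case E: (track _ _) => [[u' P']|] //; case: ifP => // /andP[/eqP lP nP] [<-].
have wP : all wf17 (map hvertex P) by rewrite all_map; apply/allP => i _; exact: wf17_hvertex.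
have [wu' wP' ->] := trackP R disjoint_simplification (wf17_hvertex u) wP E.
have wb : all wf17 (belast u' P') by apply/allP => v /mem_belast; rewrite inE => /orP[/eqP ->|/(allP wP')].
split.
  rewrite /wf all_map; apply/allP => v /(allP wb) /andP[_ pv].
  have : wf [:: hflat W v].
    rewrite /wf all_seq1 /proper -[coordinate _ 3]/(Z.mul (Z.pos 50) (coordinate v 17)).
    apply/andP; split=> //; move: pv; rewrite /proper; move: (coordinate v 17) => z; lia.
  by move=> /wf_renorm; rewrite /wf /= andbT.
rewrite flat_hchain // hchain_closed; first last.
- by rewrite last_map lP.
- by case: (P') nP.
rewrite belast_map /hpolygon -!map_comp; congr polygon.
by apply: eq_map => v /=; rewrite renorm_hpoint.
Qed.
End Flat.

Section Embedding.
Variables (R : realType) (T : 4.-tuple nat) (b : nat) (c : 'rV[R]_3) (beta : 'I_4 -> 'rV[R]_3).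
Notation space := 'rV[R]_17.
Notation W := (b :: val T).

Definition centred (i : 'I_4) : 'rV[R]_3 := hpoint R 3 (place (tnth T i)) - c.

Hypothesis dual_sum : forall u, \sum_i dual beta i u = 0.
Hypothesis dual_span : forall u, \sum_i dual beta i u *: centred i = u.
Hypothesis dual_vertex : forall i j, dual beta i (centred j) = (i == j)%:R - 4^-1.
Hypothesis labW : labels W.
Hypothesis uniqW : uniq W.

Notation ball_of := (ball_of centred beta T).

(** The two expressions for the last simplex agree: the weights sum to 1, and b carries no weight
    or lies at the centre. *)
Lemma combine_flat (x : space) :
  (forall j, (j < 17)%N -> j \notin T -> j != b -> at_label x j = 0) ->
  \sum_j x ord0 j = 1 -> at_label x b *: (hpoint R 3 (place b) - c) = 0 ->
  combine centred T x = flat W x - c.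
Proof.
move=> x0 x1 xb; have [bT uT] : b \notin T /\ uniq T by case/andP: uniqW.
have [bl lT] : (b < 17)%N /\ labels T by case/andP: labW.
have -> : c = \sum_i onT T x i *: c + at_label x b *: c.
  by rewrite -scaler_suml -scalerDl -(sum_onT lT uT bT bl x0) x1 scale1r.
rewrite /flat big_cons big_tuple.
move/eqP: xb; rewrite scalerBr subr_eq0 => /eqP ->.
rewrite [X in X - _]addrC opprD addrACA subrr addr0 -sumrB.
by apply: eq_bigr => i _; rewrite /onT /centred scalerBr.
Qed.

(** Translations and the radial map are isotopic to the identity, so that up to isotopy the
    homeomorphism acts on the path as the exchanges followed by the affine map flat, which
    tracking computes. *)
Lemma model_knot (F' : seq (seq nat)) u P Q :
  (forall x, realization (cplx F') x ->
    [/\ forall j, (j < 17)%N -> j \notin T -> j != b -> at_label x j = 0,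
        \sum_j x ord0 j = 1 & at_label x b *: (hpoint R 3 (place b) - c) = 0]) ->
  (forall x, hchain R 17 (hvertex u) (map hvertex P) x -> realization (cplx F') (psis simplification x)) ->
  track_knot W u P = Some Q ->
  isotopic ((ball_of \o psis simplification) @` hchain R 17 (hvertex u) (map hvertex P))
    (hpolygon R 3 Q).
Proof.
move=> inF' PF' tr; have [wQ eQ] := track_knotP R labW tr.
set C := hchain _ _ _ _ in PF' eQ *.
have -> : (ball_of \o psis simplification) @` C =
    radial beta 1 @` ((fun y => y + - c) @` (flat W @` (psis simplification @` C))).
  rewrite !image_comp; apply: eq_imagel => x Cx /=.
  by rewrite /ball_of /=; have [h1 h2 h3] := inF' _ (PF' x Cx); rewrite combine_flat.
rewrite eQ; apply: isotopic_sym.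
apply: isotopic_trans (isotopic_translation _ (- c)) _.
exact: (radial_isotopic dual_sum dual_span).
Qed.
End Embedding.

(** * Positions of the last tetrahedra in space *)

Section Tables.
Variable R : realType.

Definition table (rows : seq (seq R)) (i : 'I_4) : 'rV[R]_3 :=
  \row_k nth 0 (nth [::] rows i) k.

(** Coordinates of the vertices relative to their centroid, and below the dual forms. *)
Definition legs_S : seq (seq R) :=
  [:: [:: -51 / 2; -10; -25 / 2]; [:: -15 / 2; 10; 0]; [:: 30; 0; 0]; [:: 3; 0; 25 / 2]].

Definition forms_S : seq (seq R) :=
  [:: [:: -1 / 120; -1 / 32; -9 / 500]; [:: -1 / 120; 11 / 160; -9 / 500];
      [:: 1 / 40; -1 / 160; -13 / 500]; [:: -1 / 120; -1 / 32; 31 / 500]].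

Definition legs_B : seq (seq R) :=
  [:: [:: -111 / 8; 15 / 2; -25 / 8]; [:: -51 / 8; -5 / 2; -25 / 8];
      [:: 189 / 8; -5 / 2; -25 / 8]; [:: -27 / 8; -5 / 2; 75 / 8]].

Definition forms_B : seq (seq R) :=
  [:: [:: 0; 1 / 10; 0]; [:: -1 / 30; -1 / 8; -9 / 125];
      [:: 1 / 30; 1 / 40; -1 / 125]; [:: 0; 0; 2 / 25]].

Definition dual_pair (V B : 'I_4 -> 'rV[R]_3) : Prop :=
  [/\ forall u, \sum_i dual B i u = 0, forall u, \sum_i dual B i u *: V i = u &
      forall i j, dual B i (V j) = (i == j)%:R - 4^-1].

Lemma dual_table rows i u : dual (table rows) i u =
  nth 0 (nth [::] rows i) 0 * u ord0 (inord 0) + nth 0 (nth [::] rows i) 1 * u ord0 (inord 1)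
  + nth 0 (nth [::] rows i) 2 * u ord0 (inord 2).
Proof.
rewrite /dual 3!big_ord_recl big_ord0 addr0 addrA !mxE /=.
by congr (_ * u _ _ + _ * u _ _ + _ * u _ _); apply/val_inj; rewrite /= inordK.
Qed.

Lemma sum4 (V : nmodType) (f : 'I_4 -> V) :
  \sum_i f i = f (inord 0) + f (inord 1) + f (inord 2) + f (inord 3).
Proof.
rewrite 4!big_ord_recl big_ord0 addr0 !addrA.
by congr (f _ + f _ + f _ + f _); apply/val_inj; rewrite /= inordK.
Qed.

Lemma dual_pair_S : dual_pair (table legs_S) (table forms_S).
Proof.
split.
- move=> u; rewrite sum4 !dual_table !inordK //=; by field.
- move=> u; rewrite sum4 !dual_table; apply/rowP => k; rewrite !mxE !inordK //=.
  have -> : u ord0 k = u ord0 (inord k) by congr (u _ _); rewrite inord_val.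
  case: k => [[|[|[|k]]] kl] //=; by field.
- move=> i j; rewrite dual_table !mxE !inordK //.
  rewrite -val_eqE; case: i => [[|[|[|[|i]]]] il] //=; case: j => [[|[|[|[|j]]]] jl] //=; by field.
Qed.

Lemma dual_pair_B : dual_pair (table legs_B) (table forms_B).
Proof.
split.
- move=> u; rewrite sum4 !dual_table !inordK //=; by field.
- move=> u; rewrite sum4 !dual_table; apply/rowP => k; rewrite !mxE !inordK //=.
  have -> : u ord0 k = u ord0 (inord k) by congr (u _ _); rewrite inord_val.
  case: k => [[|[|[|k]]] kl] //=; by field.
- move=> i j; rewrite dual_table !mxE !inordK //.
  rewrite -val_eqE; case: i => [[|[|[|[|i]]]] il] //=; case: j => [[|[|[|[|j]]]] jl] //=; by field.
Qed.

Lemma zr_pos p : zr R (Z.pos p) = (Pos.to_nat p)%:R.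
Proof. by rewrite /zr (_ : int_of_Z (Z.pos p) = Pos.to_nat p) //; lia. Qed.

Lemma zr_neg p : zr R (Z.neg p) = - (Pos.to_nat p)%:R.
Proof. by rewrite -[Z.neg p]/(Z.opp (Z.pos p)) zrN zr_pos. Qed.

Lemma coordinates_place :
  [/\ forall k, (k < 3)%N -> (hpoint R 3 (place 1)) ord0 (inord k) = nth 0 [:: -1389 / 50; -600 / 50; -775 / 50] k,
   forall k, (k < 3)%N -> (hpoint R 3 (place 9)) ord0 (inord k) = nth 0 [:: -489 / 50; 400 / 50; -150 / 50] k,
   forall k, (k < 3)%N -> (hpoint R 3 (place 10)) ord0 (inord k) = nth 0 [:: -114 / 50; -100 / 50; -150 / 50] k,
   forall k, (k < 3)%N -> (hpoint R 3 (place 14)) ord0 (inord k) = nth 0 [:: 1386 / 50; -100 / 50; -150 / 50] k &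
   forall k, (k < 3)%N -> (hpoint R 3 (place 15)) ord0 (inord k) = nth 0 [:: 36 / 50; -100 / 50; 475 / 50] k].
Proof.
have e (n : nat) z : zr R z / zr R (Z.pos 50) = zr R z / 50%:R by rewrite [zr R (Z.pos 50)]zr_pos.
by split=> k kl; rewrite mxE !inordK // place_weight (e 0%N); case: k kl => [|[|[|k]]] // _;
  congr (_ / _); rewrite ?zr_neg ?zr_pos.
Qed.

Definition base_S := [tuple 1; 9; 14; 15]%N.

Definition base_B := [tuple 9; 10; 14; 15]%N.

Definition centre_S : 'rV[R]_3 := hpoint R 3 (place 10).

Definition centre_B : 'rV[R]_3 := table [:: [:: 819 / 200; 1 / 2; 1 / 8]] ord0.

Lemma centred_S : centred base_S centre_S = table legs_S.
Proof.
have [h1 h9 h10 h14 h15] := coordinates_place.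
apply/funext => i; apply/rowP => k; rewrite -[k]inord_val /centred mxE [RHS]mxE [X in _ + X]mxE h10 // inordK //.
case: i => [[|[|[|[|i]]]] il] //; rewrite /tnth /= ?h1 ?h9 ?h14 ?h15 //;
  case: k => [[|[|[|k]]] kl] //=; by field.
Qed.

Lemma centred_B : centred base_B centre_B = table legs_B.
Proof.
have [h1 h9 h10 h14 h15] := coordinates_place.
apply/funext => i; apply/rowP => k; rewrite -[k]inord_val /centred mxE [RHS]mxE [X in _ + X]mxE [centre_B _ _]mxE inordK //.
case: i => [[|[|[|[|i]]]] il] //; rewrite /tnth /= ?h9 ?h10 ?h14 ?h15 //;
  case: k => [[|[|[|k]]] kl] //=; by field.
Qed.
End Tables.

(** * Homeomorphisms to the ball and to the sphere *)

Section Homeomorphisms.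
Variable R : realType.

Lemma simplifiedP F G : all labels F -> all labels G -> simplified F G ->
  mutually_inverse (realization (R := R) (cplx F)) (realization (cplx G))
    (psis simplification) (psis_inv simplification).
Proof.
move=> lF lG; rewrite /simplified; case E: (exchanges _ _) => [F'|] // /andP[FG GF].
have [lF' h] := exchangesP R lF E.
by rewrite -(cplx_eq lF' lG FG GF).
Qed.

Lemma dual_S : dual_pair (centred base_S (centre_S R)) (table (forms_S R)).
Proof. by rewrite centred_S; exact: dual_pair_S. Qed.

Lemma dual_B : dual_pair (centred base_B (centre_B R)) (table (forms_B R)).
Proof. by rewrite centred_B; exact: dual_pair_B. Qed.

Definition embed_ball : 'rV[R]_17 -> 'rV[R]_3 :=
  ball_of (centred base_B (centre_B R)) (table (forms_B R)) base_B \o psis simplification.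

Definition embed_minus : 'rV[R]_17 -> 'rV[R]_3 :=
  ball_of (centred base_S (centre_S R)) (table (forms_S R)) base_S \o psis simplification.

Definition embed_sphere : 'rV[R]_17 -> 'rV[R]_4 :=
  sphere_of (centred base_S (centre_S R)) (table (forms_S R)) base_S 10 \o psis simplification.

Lemma base_S_ok : [/\ labels base_S, uniq base_S, 10%N \notin base_S & (10 < 17)%N].
Proof. by []. Qed.

Lemma base_B_ok : [/\ labels base_B, uniq base_B, 1%N \notin base_B & (1 < 17)%N].
Proof. by []. Qed.

Lemma ball_homeo : exists g, mutually_inverse (realization B15_66) (@unit_ball R 3) embed_ball g.
Proof.
have [h1 h2 h3] := dual_B; have [l u n b] := base_B_ok.
have M := simplex_ball h1 h2 h3 l u n b.
have lG : all labels [:: val base_B] by [].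
rewrite B15_66_E; eexists.
exact: mutually_inverse_comp (simplifiedP labels_facets_ball lG simplified_ball) M.
Qed.

Lemma labels_starred_S : all labels (starred base_S 10). Proof. by []. Qed.

Lemma simplify_minus : mutually_inverse (realization (R := R) S16_92_minus)
  (realization (cplx (starred base_S 10))) (psis simplification) (psis_inv simplification).
Proof.
rewrite S16_92_minus_E.
exact: (simplifiedP labels_facets_minus labels_starred_S simplified_minus).
Qed.

Lemma minus_homeo : exists g, mutually_inverse (realization S16_92_minus) (@unit_ball R 3) embed_minus g.
Proof.
have [h1 h2 h3] := dual_S; have [l u n b] := base_S_ok.
have M := starred_ball h1 h2 h3 l u n b.
by eexists; exact: mutually_inverse_comp simplify_minus M.
Qed.

Lemma sphere_homeo : exists g, mutually_inverse (realization S16_92) (@unit_sphere R 3) embed_sphere g.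
Proof.
have [h1 h2 h3] := dual_S; have [l u n b] := base_S_ok.
have M := sphere_model h1 h2 h3 l u n b.
have lG : all labels (sphere_facets base_S 10) by [].
rewrite S16_92_E; eexists.
exact: mutually_inverse_comp (simplifiedP labels_facets lG simplified_S) M.
Qed.

(** * The knots *)

Definition edges_sphere : seq (seq nat) := edge_list 3 [:: 2; 1; 3]%N.

Definition edges_ball : seq (seq nat) := edge_list 3 [:: 2; 12; 13; 10; 8; 3]%N.

Lemma edges_sphere_minus : cplx edges_sphere \subset S16_92_minus.
Proof. by rewrite S16_92_minus_E; apply: cplx_sub; vm_compute. Qed.

Lemma edges_ball_sub : cplx edges_ball \subset B15_66.
Proof. by rewrite B15_66_E; apply: cplx_sub; vm_compute. Qed.

Lemma realization_sub n (K L : {set {set 'I_n}}) : (K \subset L)%SET ->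
  realization (R := R) K `<=` realization L.
Proof. by move=> /fintype.subsetP KL x [x0 x1 /KL xL]. Qed.

Definition knot_polygon : set 'rV[R]_3 := hpolygon R 3 (left_arc ++ right_arc).

Lemma knot_minus : isotopic (embed_minus @` realization (cplx edges_sphere)) knot_polygon.
Proof.
have [h1 h2 h3] := dual_S; have [l u n b] := base_S_ok.
rewrite /edges_sphere realization_path //.
have lW : labels (10%N :: val base_S) by [].
have uW : uniq (10%N :: val base_S) by [].
case E: (track_knot (10%N :: val base_S) 3 [:: 2; 1; 3]%N) => [P|]; last first.
  by have := straighten_S_run; rewrite E.
have [wP _] := track_knotP R lW E.
have := straighten_S_run; rewrite E => run.
have [_] := run_stepsP R wP (run : run_steps P (straighten_S ++ split_knot) = _).
apply: isotopic_trans; apply: (model_knot h1 h2 lW uW (F' := starred base_S 10) _ _ E).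
  move=> x /(realizationP _ labels_starred_S)[x0 x1 [s sF xs]]; split; [|exact: x1|by rewrite /centre_S subrr scaler0].
  move=> j jl jT jb; apply: (xs j jl); have /mapP[y _ ->] := sF.
  by rewrite inE negb_or jb mem_filter (negbTE jT) andbF.
move=> x Cx; have [_ _ [AB _] _ _] := simplify_minus; apply: AB.
by apply: (realization_sub edges_sphere_minus); rewrite /edges_sphere realization_path.
Qed.

Lemma obind_Some (A B : Type) (f : A -> option B) o y :
  obind f o = Some y -> exists2 x, o = Some x & f x = Some y.
Proof. by case: o => //= x e; exists x. Qed.

Lemma knot_ball : isotopic (embed_ball @` realization (cplx edges_ball)) knot_polygon.
Proof.
have [h1 h2 h3] := dual_B; have [l u n b] := base_B_ok.
rewrite /edges_ball realization_path //.
have lW : labels (1%N :: val base_B) by [].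
have uW : uniq (1%N :: val base_B) by [].
case E: (track_knot (1%N :: val base_B) 3 [:: 2; 12; 13; 10; 8; 3]%N) => [P|]; last first.
  by have := straighten_B_run; rewrite E.
have [wP _] := track_knotP R lW E.
have := straighten_B_run; rewrite E => runB.
have [Q E2 run] := obind_Some (runB : obind _ (run_steps P straighten_B) = _).
have [wQ iQ] := run_stepsP R wP E2.
apply: isotopic_trans (isotopic_trans iQ _); last first.
  rewrite -(hpolygon_rot R 3 59); have wQ' : wf (rot 59 Q).
    by rewrite /wf (eq_all_r (mem_rot 59 Q)).
  by have [] := run_stepsP R wQ' (run : run_steps (rot 59 Q) split_knot = _).
have lG : all labels [:: val base_B] by [].
apply: (model_knot h1 h2 lW uW (F' := [:: val base_B]) _ _ E).
  move=> x /(realizationP _ lG)[x0 x1 [s]]; rewrite inE => /eqP -> xs; split; [|exact: x1|].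
    by move=> j jl jT jb; exact: xs.
  by rewrite (xs 1%N) ?scale0r.
move=> x Cx.
have [_ _ [AB _] _ _] := simplifiedP labels_facets_ball lG simplified_ball; apply: AB.
by rewrite -B15_66_E; apply: (realization_sub edges_ball_sub); rewrite /edges_ball realization_path.
Qed.
End Homeomorphisms.

(** * The double trefoil *)

Lemma mutually_inverse_image (T U : topologicalType) (A C : set T) (B : set U) f g :
  mutually_inverse A B f g -> C `<=` A -> mutually_inverse C (f @` C) f g.
Proof.
move=> [cf cg _ gf _] CA; split=> //.
- by split=> [x Cx|_ [x Cx <-]]; [exists x | rewrite gf //; exact: CA].
- by move=> x /CA /gf.
- by move=> _ [x /CA Ax <-]; rewrite gf.
Qed.

Section Double.
Variable R : realType.
Notation space := 'rV[R]_3.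

Lemma isotopic_inverse (K L : set space) : isotopic K L ->
  exists f g, mutually_inverse K L f g.
Proof.
case=> H [_ Hh _ <-]; have [g hg] : exists g, mutually_inverse setT setT (H 1) g by apply: Hh; lra.
by exists (H 1), g; exact: mutually_inverse_image hg _.
Qed.

(** Subdividing the edge with labels 2 and 3 at a new vertex 0. *)
Lemma triangle_square : exists f g,
  mutually_inverse (realization (R := R) (cplx edges_sphere)) (realization (R := R) (cplx square_cycle)) f g.
Proof.
have lE : all labels edges_sphere by [].
have lS : all labels square_cycle by [].
pose m := [:: ([:: 2; 3], [:: 0])]%N.
have [F EF FS] : exists2 F, exchanges edges_sphere m = Some F & refines F square_cycle && refines square_cycle F.
  by vm_compute; eexists.
have [lF M] := exchangesP R lE EF; have /andP[h1 h2] := FS.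
by exists (psis m), (psis_inv m); rewrite -(cplx_eq lF lS h1 h2).
Qed.

(** The polygon is the image of the circle: the circle is a cycle of edges, which lies in the
    ball, whose image there is isotopic to the polygon. *)
Lemma knot_knot_polygon : knot (@knot_polygon R).
Proof.
have [f1 [g1 M1]] := triangle_square; have [g2 M2] := minus_homeo R.
have M3 := mutually_inverse_image M2 (realization_sub edges_sphere_minus).
have [f4 [g4 M4]] := isotopic_inverse (knot_minus R).
have M := mutually_inverse_comp (mutually_inverse_comp (mutually_inverse_comp
  (circle_model R) (mutually_inverse_sym M1)) M3) M4.
by eexists; exact: mutually_inverse_homeo M.
Qed.

(** Along each segment the form is a convex combination of the values at its ends, one of which is
    positive. *)
Lemma chain_side (l : space -> R) (L : seq space) p q :
  (forall t x y, l ((1 - t) *: x + t *: y) = (1 - t) * l x + t * l y) ->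
  L != [::] -> all (fun x => 0 < l x) L -> l p = 0 -> l q = 0 ->
  forall x, chain p (rcons L q) x -> 0 <= l x /\ (l x = 0 -> x = p \/ x = q).
Proof.
move=> lD; case: L => // u L _ /= /andP[u0 L0] lp lq x [/segP[t /andP[t0 t1] <-]|].
  rewrite lD lp mulr0 add0r; split; first by rewrite mulr_ge0 // ltW.
  move/eqP; rewrite mulf_eq0 (gt_eqF u0) orbF => /eqP ->.
  by left; rewrite subr0 scale1r scale0r addr0.
suff : chain u (rcons L q) x -> 0 <= l x /\ (l x = 0 -> x = q) by move=> h /h[h1 h2]; split=> // /h2; right.
elim: L u u0 L0 {lp p} => [|v L IH] u u0 /=.
  move=> _ [/segP[t /andP[t0 t1] <-]|//]; rewrite lD lq mulr0 addr0.
  split; first by rewrite mulr_ge0 ?subr_ge0 // ltW.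
  move/eqP; rewrite mulf_eq0 (gt_eqF u0) orbF subr_eq0 => /eqP <-.
  by rewrite subrr scale1r scale0r add0r.
move=> /andP[v0 L0] [/segP[t /andP[t0 t1] <-]|]; last exact: IH.
have lt : 0 < l ((1 - t) *: u + t *: v).
  rewrite lD; have [->|t'] := eqVneq t 0; first by rewrite subr0 mul1r mul0r addr0.
  apply: ltr_wpDl; first by rewrite mulr_ge0 ?subr_ge0 ?(ltW u0).
  by rewrite mulr_gt0 // lt_def t'.
by split; [exact: ltW | move=> e; rewrite e ltxx in lt].
Qed.

(** Since A and B lie strictly on the two sides, p and q are the only points of the plane, and
    each half is an arc from p to q that the segment between them closes. *)
Lemma polygon_cut (l : space -> R) (A B : seq space) p q :
  (forall t x y, l ((1 - t) *: x + t *: y) = (1 - t) * l x + t * l y) ->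
  A != [::] -> B != [::] -> all (fun x => l x < 0) A -> all (fun x => 0 < l x) B ->
  l p = 0 -> l q = 0 -> seg (last p A) (head q B) p -> seg (last q B) (head p A) q ->
  [/\ polygon (A ++ B) `&` [set x | l x = 0] = [set p; q],
      polygon (A ++ B) `&` [set x | l x <= 0] `|` seg p q = polygon (q :: rcons A p) &
      polygon (A ++ B) `&` [set x | 0 <= l x] `|` seg p q = polygon (p :: rcons B q)].
Proof.
move=> lD A0 B0 lA lB lp lq sp sq.
have E : polygon (A ++ B) = chain q (rcons A p) `|` chain p (rcons B q).
  case: A A0 lA sp sq => // a A _ _ sp sq; case: B B0 lB sp sq => // b B _ _ sp sq.
  rewrite cat_cons polygon_cons -cats1 -catA cat_cons chain_cat cats1.
  (* the two edges that cross the plane are split at p and at q *)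
  have last_chain (u : space) (S : seq space) (v w : space) : seg (last u S) w v ->
      chain u (rcons S w) = chain u (rcons S v) `|` seg v w.
    elim: S u => [|s S IH] u /= h; first by rewrite !setU0; exact: seg_split.
    by rewrite IH // setUA.
  rewrite (last_chain a A p b sp) (last_chain b B q a sq) /=.
  move: (seg q a) (seg p b) (chain a _) (chain b _) => S1 S2 S3 S4.
  by apply/seteqP; split=> x [[]|[]] h; rewrite /setU /=; tauto.
have hA x : chain q (rcons A p) x -> l x <= 0 /\ (l x = 0 -> x = p \/ x = q).
  have lD' t y z : - l ((1 - t) *: y + t *: z) = (1 - t) * - l y + t * - l z by rewrite lD; ring.
  have lA' : all (fun x => 0 < - l x) A by apply: sub_all lA => y; rewrite oppr_gt0.
  move=> /(chain_side lD' A0 lA'); rewrite lp lq oppr0 => /(_ erefl erefl)[].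
  rewrite oppr_ge0 => h1 h2; split=> // lx; rewrite lx oppr0 in h2.
  by case: (h2 erefl); [right | left].
have hB x : chain p (rcons B q) x -> 0 <= l x /\ (l x = 0 -> x = p \/ x = q).
  by apply: chain_side.
have [pA qA] : chain q (rcons A p) p /\ chain q (rcons A p) q.
  by split; [apply: chain_last; rewrite ?last_rcons // | apply: chain_head]; case: (A).
have [pB qB] : chain p (rcons B q) p /\ chain p (rcons B q) q.
  by split; [apply: chain_head | apply: chain_last; rewrite ?last_rcons //]; case: (B).
split.
- rewrite E; apply/seteqP; split=> x.
    by move=> [[/hA[_ h]|/hB[_ h]] /h].
  by case=> ->; split=> //; left.
- have -> : polygon (A ++ B) `&` [set x | l x <= 0] = chain q (rcons A p).
    rewrite E; apply/seteqP; split=> x.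
      move=> [[//|/hB[h1 h2]] /= h3]; have /h2[->|->] // : l x = 0.
      by apply/le_anti; rewrite h1 h3.
    by move=> xA; split; [left | have [] := hA x xA].
  by rewrite polygon_cons -[rcons (rcons _ _) _]cats1 cat_rcons chain_cat /= setU0.
- have -> : polygon (A ++ B) `&` [set x | 0 <= l x] = chain p (rcons B q).
    rewrite E; apply/seteqP; split=> x.
      move=> [[/hA[h1 h2]|//] /= h3]; have /h2[->|->] // : l x = 0.
      by apply/le_anti; rewrite h1 h3.
    by move=> xB; split; [right | have [] := hB x xB].
  by rewrite polygon_cons -[rcons (rcons _ _) _]cats1 cat_rcons chain_cat /= setU0 (seg_sym q).
Qed.

Lemma htrefoil_standard : hpolygon R 3 htrefoil = @standard_trefoil R.
Proof.
have e a b c : hpoint R 3 [:: a; b; c; Z.pos 1] = point3 (zr R a) (zr R b) (zr R c).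
  have z1 : zr R (Z.pos 1) = 1 by rewrite zr_pos.
  apply/rowP => k; rewrite !mxE (_ : coordinate _ 3 = Z.pos 1) // z1 divr1.
  by case: k => [[|[|[|k]]] kl].
have [z0 z1 z2] : [/\ zr R Z0 = 0, zr R (Z.pos 1) = 1 & zr R (Z.pos 2) = 2].
  by split; rewrite ?zr_pos.
have [n1 n2] : zr R (Z.neg 1) = - 1 /\ zr R (Z.neg 2) = - 2 by split; rewrite zr_neg.
rewrite /hpolygon /htrefoil [map _ _]/= !e z0 z1 z2 n1 n2; reflexivity.
Qed.

Lemma mirror_hpoint v : mirror (hpoint R 3 v) = hpoint R 3 (hmirror v).
Proof.
apply/rowP => k; rewrite !mxE !inordK // [coordinate (hmirror v) 3]/(coordinate v 3).
case: k => [[|[|[|k]]] kl] //=.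
by rewrite -mulNr -zrN.
Qed.

Lemma mirror_chain u P : @mirror R @` hchain R 3 u P = hchain R 3 (hmirror u) (map hmirror P).
Proof.
have lin (p q : space) : affine_on (@mirror R) p q.
  move=> t _; apply/rowP => k; rewrite !mxE.
  by case: k => [[|[|[|k]]] kl] //=; ring.
elim: P u => [|v P IH] u; first by rewrite /hchain /= image_set0.
rewrite /hchain /= image_setU -[chain (hpoint R 3 v) _]/(hchain R 3 v P) IH image_seg //.
by rewrite !mirror_hpoint.
Qed.

Lemma mirror_hpolygon P : @mirror R @` hpolygon R 3 P = hpolygon R 3 (map hmirror P).
Proof.
case: P => [|p P]; last by rewrite /= !hpolygon_cons mirror_chain map_rcons.
rewrite -[hpolygon R 3 [::]]/(@polygon R 3 [::]); have -> : @polygon R 3 [::] = set0.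
  by apply/seteqP; split=> // x; rewrite /polygon => /bigcup_seq[].
by rewrite image_set0.
Qed.

Lemma hpoint_between u v w c d : wf [:: u; v] -> Z.ltb Z0 c -> Z.ltb Z0 d ->
  same_point (hadd (hscale c u) (hscale d v)) w ->
  seg (hpoint R 3 u) (hpoint R 3 v) (hpoint R 3 w).
Proof.
move=> /and3P[/andP[/eqP su pu] /andP[/eqP sv pv] _] c0 d0 /(same_point_hpoint R) <-.
rewrite -(hpoint_hscale R 3 u c0) -(hpoint_hscale R 3 v d0).
have pp e x : Z.ltb Z0 e -> proper 3 x -> proper 3 (hscale e x).
  by rewrite /proper coordinate_hscale; lia.
by apply: hadd_seg; rewrite ?size_map ?su ?sv ?pp.
Qed.

(** The summands are taken to be the two halves themselves, so that only their being trefoils has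
    to be shown. *)
Lemma double_trefoil_knot_polygon K : isotopic K (@knot_polygon R) -> double_trefoil K.
Proof.
move=> iK; pose l (x : space) := x ord0 ord0.
have lD t (x y : space) : l ((1 - t) *: x + t *: y) = (1 - t) * l x + t * l y by rewrite /l !mxE.
have lh v : l (hpoint R 3 v) = zr R (coordinate v 0) / zr R (coordinate v 3) by rewrite /l mxE.
have lneg v : proper 3 v && Z.ltb (coordinate v 0) Z0 -> l (hpoint R 3 v) < 0.
  by rewrite lh => /andP[/(proper_gt0 R) v3]; rewrite (zr_lt R) zr0 => ?; rewrite pmulr_llt0 ?invr_gt0.
have lpos v : proper 3 v && Z.ltb Z0 (coordinate v 0) -> 0 < l (hpoint R 3 v).
  by rewrite lh => /andP[/(proper_gt0 R) v3]; rewrite (zr_lt R) zr0 => ?; rewrite pmulr_lgt0 ?invr_gt0.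
pose A := map (hpoint R 3) left_arc; pose B := map (hpoint R 3) right_arc.
pose p := hpoint R 3 crossing_p; pose q := hpoint R 3 crossing_q.
have kE : @knot_polygon R = polygon (A ++ B) by rewrite /knot_polygon /hpolygon map_cat.
have lA : all (fun x => l x < 0) A.
  rewrite all_map; apply/allP => v vA; apply: lneg.
  by move: v vA; apply/allP; vm_compute.
have lB : all (fun x => 0 < l x) B.
  rewrite all_map; apply/allP => v vA; apply: lpos.
  by move: v vA; apply/allP; vm_compute.
have [lp lq] : l p = 0 /\ l q = 0 by rewrite /p /q !lh /= !zr0 !mul0r.
(* the first coordinates at the ends of the two crossing edges are -3 and 5, 5 and -1 *)
have sp : seg (last p A) (head q B) p.
  by rewrite /A last_map; apply: (hpoint_between (c := Z.pos 5) (d := Z.pos 3)); vm_compute.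
have sq : seg (last q B) (head p A) q.
  by rewrite /B last_map; apply: (hpoint_between (c := Z.pos 1) (d := Z.pos 5)); vm_compute.
have [A0 B0] : A != [::] /\ B != [::] by [].
have [cut cutA cutB] := polygon_cut lD A0 B0 lA lB lp lq sp sq.
rewrite -kE in cut cutA cutB.
exists ((@knot_polygon R `&` [set x | l x <= 0]) `|` seg p q),
       ((@knot_polygon R `&` [set x | 0 <= l x]) `|` seg p q); split.
- right; apply: isotopic_ambient; rewrite cutA -htrefoil_standard mirror_hpolygon.
  have -> : polygon (q :: rcons A p) = hpolygon R 3 (crossing_q :: rcons left_arc crossing_p).
    by rewrite /hpolygon map_cons map_rcons.
  rewrite -(hpolygon_rot R 3 1 (map _ _)).
  have wL : wf (crossing_q :: rcons left_arc crossing_p) by vm_compute.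
  by have [_] := run_stepsP R wL left_trefoil_run.
- left; apply: isotopic_ambient; rewrite cutB -htrefoil_standard.
  have -> : polygon (p :: rcons B q) = hpolygon R 3 (crossing_p :: rcons right_arc crossing_q).
    by rewrite /hpolygon map_cons map_rcons.
  rewrite -(hpolygon_rot R 3 5 htrefoil).
  have wR : wf (crossing_p :: rcons right_arc crossing_q) by vm_compute.
  by have [_] := run_stepsP R wR right_trefoil_run.
- exists (@knot_polygon R), p, q; split.
  + exact: isotopic_ambient.
  + split; first exact: knot_knot_polygon.
    by rewrite kE; exists (zip (A ++ B) (rot 1 (A ++ B))).
  + split; last exact: cut.
    move=> /rowP/(_ ord_max); rewrite !mxE => /esym/eqP; apply/negP; rewrite /= zr0 mul0r gt_eqF //.
    by rewrite divr_gt0 // -zr0 -zr_lt.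
  + exact/isotopic_ambient/isotopic_refl.
  + exact/isotopic_ambient/isotopic_refl.
Qed.
End Double.

(** * The sphere and the two balls *)

Lemma simplex_pair i j : simplex [:: i; j] = [set label i; label j]%SET.
Proof. by apply/setP => k; rewrite !inE. Qed.

Lemma simplex_neq s t : labels s -> labels t -> ~~ (sub s t && sub t s) -> simplex s != simplex t.
Proof. by move=> ls lt; rewrite finset.eqEsubset !simplex_sub. Qed.

Lemma labels_edges_sphere : all labels edges_sphere. Proof. by []. Qed.

Lemma faces_edges_sphere : faces (cplx edges_sphere) 1 = [set:: map simplex edges_sphere].
Proof.
apply/setP => t; rewrite inE [RHS]inE; apply/andP/mapP.
  rewrite in_cplx => -[/andP[_ /hasP[s sF ts]] /eqP t2]; exists s => //.
  have ls := allP labels_edges_sphere s sF.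
  apply/eqP; rewrite eqEcard ts t2 card_simplex //.
    by move: sF; rewrite !inE => /or3P[] /eqP ->.
  by move: sF; rewrite !inE => /or3P[] /eqP ->.
move=> [s sF ->]; rewrite in_cplx_simplex ?(allP labels_edges_sphere _ sF) //.
by move: sF; rewrite !inE => /or3P[] /eqP ->; rewrite card_simplex.
Qed.

Lemma three_edges (K : {set {set 'I_17}}) : cplx edges_sphere \subset K -> three_edge_subcomplex K (cplx edges_sphere).
Proof.
move=> sK; split=> //; first exact: cplx_complex.
- move=> t; rewrite in_cplx => /andP[_ /hasP[s sF ts]].
  apply: leq_trans (subset_leq_card ts) _.
  by move: sF; rewrite !inE => /or3P[] /eqP ->; rewrite card_simplex.
- rewrite faces_edges_sphere cardsE; have u : uniq (map simplex edges_sphere).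
    by rewrite /= !inE !negb_or !simplex_neq.
  by rewrite (card_uniqP u).
Qed.

Section Main.
Variable R : realType.

Lemma is_ball3_minus : is_ball3 R S16_92_minus.
Proof.
split; first by rewrite S16_92_minus_E; exact: cplx_complex.
by have [g /mutually_inverse_homeo h] := minus_homeo R; eexists; exact: h.
Qed.

Lemma is_ball3_ball : is_ball3 R B15_66.
Proof.
split; first by rewrite B15_66_E; exact: cplx_complex.
by have [g /mutually_inverse_homeo h] := ball_homeo R; eexists; exact: h.
Qed.

Lemma is_sphere3_sphere : is_sphere3 R S16_92.
Proof.
split; first by rewrite S16_92_E; exact: cplx_complex.
by have [g /mutually_inverse_homeo h] := sphere_homeo R; eexists; exact: h.
Qed.

Lemma knotted_ball_minus : knotted_ball R S16_92_minus.
Proof.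
exists (cplx edges_sphere); split; first exact/three_edges/edges_sphere_minus.
have [g /mutually_inverse_homeo h] := minus_homeo R; exists (@embed_minus R) => //.
exact/double_trefoil_knot_polygon/knot_minus.
Qed.

Lemma knotted_sphere_S16_92 : knotted_sphere R S16_92.
Proof.
have sub_S : cplx edges_sphere \subset S16_92.
  by apply: fintype.subset_trans edges_sphere_minus _; exact: finset.subsetDl.
exists (cplx edges_sphere); split; first exact: three_edges sub_S.
have [h1 h2 h3] := dual_S R; have [l u n b] := base_S_ok.
have st (x : 'rV[R]_17) : realization (cplx edges_sphere) x ->
    embed_sphere x ord0 ord_max <> 1 /\ stereographic (embed_sphere x) = embed_minus x.
  move=> xC; have [_ _ [AB _] _ _] := simplify_minus R.
  exact: (stereographic_sphere h1 h3 l u n b (AB x (realization_sub edges_sphere_minus xC))).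
have [g /mutually_inverse_homeo h] := sphere_homeo R; exists (@embed_sphere R); split=> //.
  by move=> x /st[].
apply: double_trefoil_knot_polygon; rewrite image_comp.
rewrite (eq_imagel (f' := @embed_minus R)); first exact: knot_minus.
by move=> x /st[].
Qed.

(** Together with the edge from 2 to 3 it closes up to the knot of the ball. *)
Definition boundary_path : seq nat := [:: 12; 13; 10; 8; 3]%N.

Lemma knotted_edge_ball : knotted_spanning_edge (@double_trefoil R) B15_66 [set label 2; label 3]%SET.
Proof.
have l23 : labels [:: 2; 3]%N by [].
have card2 i j : labels [:: i; j] -> i != j -> #|simplex [:: i; j]| == 2%N.
  by move=> lij ij; rewrite card_simplex //= inE ij.
split.
  apply/and3P; split.
  - rewrite -simplex_pair inE (card2 2%N 3%N l23 isT) B15_66_E (in_cplx_simplex labels_facets_ball l23).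
    by vm_compute.
  - rewrite -simplex_pair boundary_ball (in_cplx_simplex labels_boundary_ball l23).
    by vm_compute.
  - have vb i : (i < 17)%N -> has (fun s => i \in s) (boundary_list facets_ball) ->
        label i \in vertices (boundary3 B15_66).
      by move=> il h; rewrite boundary_ball (in_vertices _ labels_boundary_ball) val_label.
    apply/fintype.subsetP => v /set2P[] ->; apply: vb; by vm_compute.
exists (label 2), (label 3), (map label boundary_path); split; [by [] | | by [] | | ].
- have joined i j : labels [:: i; j] -> i != j -> has (sub [:: i; j]) (boundary_list facets_ball) ->
      joined_by_edge (boundary3 B15_66) (label i) (label j).
    move=> lij ij h; rewrite /joined_by_edge -simplex_pair inE (card2 i j lij ij).
    by rewrite boundary_ball (in_cplx_simplex labels_boundary_ball lij) h.
  do 5 (apply/andP; split; first by apply: joined; vm_compute).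
  by [].
- rewrite -[_ :: _]/(map label (2 :: boundary_path)%N) map_inj_in_uniq //.
  move=> i j ib jb /(congr1 val).
  have lb : labels (2 :: boundary_path)%N by [].
  by rewrite !val_label ?(allP lb).
have -> : generated ([set label 2; label 3]%SET |: path_edges (label 2) (map label boundary_path))
    = cplx edges_ball.
  rewrite /cplx; congr generated; apply/setP => t; rewrite !inE.
  by rewrite !simplex_pair [[set label 3; label 2]%SET]finset.setUC.
have [g /mutually_inverse_homeo h] := ball_homeo R; exists (@embed_ball R) => //.
exact/double_trefoil_knot_polygon/knot_ball.
Qed.
End Main.

Theorem theorem3 (R : realType) :
  [/\ #|vertices B15_66| = 15%N,
      is_ball3 R B15_66,
      exists e : {set 'I_17}, knotted_spanning_edge (@double_trefoil R) B15_66 e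
    & ~ collapsible B15_66]
  /\
  [/\ label 1 \notin vertices B15_66,
      cone_off (label 1) B15_66 = S16_92,
      is_sphere3 R S16_92,
      knotted_sphere R S16_92
    & LC_sphere S16_92]
  /\
  [/\ is_ball3 R S16_92_minus,
      knotted_ball R S16_92_minus,
      collapsible S16_92_minus
    & LC_ball S16_92_minus].
Proof.
split; last split.
- split; [exact: card_vertices_ball | exact: is_ball3_ball | | exact: not_collapsible_ball].
  by eexists; exact: knotted_edge_ball.
- split; [exact: apex_notin_ball | exact: cone_off_ball | exact: is_sphere3_sphere
         | exact: knotted_sphere_S16_92 | exact: LC_sphere_S16_92].
- split; [exact: is_ball3_minus | exact: knotted_ball_minus | exact: collapsible_minus | exact: LC_ball_minus].
Qed.
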